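(* Let $f,g\in\mathcal{O}_K[x_1,\ldots,x_n]\setminus\pi\mathcal{O}_K[x_1,\ldots,x_n]$ ($n\ge 2$) be non-constant co-prime polynomials with $f(\boldsymbol 0)=g(\boldsymbol 0)=0$ such that $\frac fg$ is non-degenerate over $\mathbb{F}_q$ with respect to $\Gamma(\frac fg)$. Let $\gamma_1,\ldots,\gamma_l$ be all the facets of $\Gamma(\frac fg)$ and let $\boldsymbol w_1,\ldots,\boldsymbol w_l\in\mathbb{N}^n\setminus\{\boldsymbol 0\}$ be the unique primitive vectors perpendicular to $\gamma_1,\ldots,\gamma_l$ respectively. Then: (i) If $\chi=\chi_{triv}$ and $s$ is a pole of the meromorphic continuation of $Z(s,\frac fg)$, then one of the following holds: $s=1+\frac{2\pi\sqrt{-1}\,k}{\ln q}$ with $k\in\mathbb{Z}$; or $s=-1+\frac{2\pi\sqrt{-1}\,k}{\ln q}$ with $k\in\mathbb{Z}$; or $$s=\frac{\sigma(\boldsymbol w_i)}{d(\boldsymbol w_i,\Gamma(g))-d(\boldsymbol w_i,\Gamma(f))}+\frac{2\pi\sqrt{-1}\,k}{\{d(\boldsymbol w_i,\Gamma(g))-d(\boldsymbol w_i,\Gamma(f))\}\ln q}$$ with $k\in\mathbb{Z}$, $i\in\{1,\ldots,l\}$ and $d(\boldsymbol w_i,\Gamma(g))-d(\boldsymbol w_i,\Gamma(f))\neq0$. (ii) If $\chi\ne\chi_{triv}$ is a character of $\mathcal{O}_K^\times$ and $s$ is a pole of the meromorphic continuation of $Z(s,\chi,\frac fg)$, then $$s=\frac{\sigma(\boldsymbol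 w_i)}{d(\boldsymbol w_i,\Gamma(g))-d(\boldsymbol w_i,\Gamma(f))}+\frac{2\pi\sqrt{-1}\,k}{\{d(\boldsymbol w_i,\Gamma(g))-d(\boldsymbol w_i,\Gamma(f))\}\ln q}$$ with $k\in\mathbb{Z}$, $i\in\{1,\ldots,l\}$ and $d(\boldsymbol w_i,\Gamma(g))-d(\boldsymbol w_i,\Gamma(f))\neq0$. (Here $\pi$ in $2\pi\sqrt{-1}$ is the real number $3.14\ldots$.)
   Context: $K$ is a non-Archimedean local field of arbitrary characteristic, $\mathcal{O}_K$ its ring of integers, $\pi$ a fixed uniformizer, $\mathbb{F}_q$ the residue field, $\nu$ the valuation, $|z|_K=q^{-\nu(z)}$, $ac(z)=z\pi^{-\nu(z)}$ for $z\ne0$. $|d\boldsymbol x|_K$ is the Haar measure on $K^n$ with $\mathcal{O}_K^n$ of measure $1$. A bar denotes reduction modulo $\pi\mathcal{O}_K$. A character $\chi$ of $\mathcal{O}_K^\times$ is a continuous homomorphism to the complex unit circle, with $\chi(0)=0$ formally; $\chi_{triv}$ is the trivial character. Newton polyhedra. $\mathbb{R}_+=\{x\in\mathbb{R}:x\ge0\}$. For a non-constant polynomial $h=\sum c_{\boldsymbol m}\boldsymbol x^{\boldsymbol m}$ over $\mathcal{O}_K$ with $h(\boldsymbol 0)=0$, $\Gamma(h)$ is the convex hull of $\bigcup_{c_{\boldsymbol m}\ne0}(\boldsymbol m+\mathbb{R}_+^n)$. For $\boldsymbol k\in\mathbb{R}_+^n$: $d(\boldsymbol k,\Gamma)=\min_{\boldsymbol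 x\in\Gamma}\langle\boldsymbol k,\boldsymbol x\rangle$, $F(\boldsymbol k,\Gamma)=\{\boldsymbol x\in\Gamma:\langle\boldsymbol k,\boldsymbol x\rangle=d(\boldsymbol k,\Gamma)\}$, $h_{\boldsymbol k}(\boldsymbol x)=\sum_{\boldsymbol m\in F(\boldsymbol k,\Gamma(h))}c_{\boldsymbol m}\boldsymbol x^{\boldsymbol m}$, and $\sigma(\boldsymbol k)=k_1+\cdots+k_n$. Put $\Gamma(\frac fg)=\Gamma(fg)$. Non-degeneracy. $\frac fg$ is non-degenerate over $\mathbb{F}_q$ with respect to $\Gamma(\frac fg)$ if, with $(h_1,h_2)=(f,g)$, for every $\boldsymbol k\in\mathbb{R}_+^n$, every non-empty $I\subseteq\{1,2\}$ and every $\overline{\boldsymbol z}\in(\mathbb{F}_q^\times)^n$ such that $\overline h_{i,\boldsymbol k}(\overline{\boldsymbol z})=0\Leftrightarrow i\in I$, the matrix $[\partial\overline h_{i,\boldsymbol k}/\partial x_j(\overline{\boldsymbol z})]_{i\in I,1\le j\le n}$ has rank $\mathrm{Card}(I)$. Zeta function. $Z(s,\chi,\frac fg):=Z(s,-s,\chi,\chi^{-1},f,g)$, where $Z(s_1,s_2,\chi_1,\chi_2,f,g)$ is the meromorphic continuation to $\mathbb{C}^2$ (as a rational function of $q^{-s_1},q^{-s_2}$) of $\int_{\mathcal{O}_K^n}\chi_1(ac(f(\boldsymbol x)))\chi_2(ac(g(\boldsymbol x)))|f(\boldsymbol x)|_K^{s_1}|g(\boldsymbol x)|_K^{s_2}|d\boldsymbol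 x|_K$, $\operatorname{Re}(s_i)>0$. $Z(s,\frac fg)$ denotes $Z(s,\chi_{triv},\frac fg)$. *)

(* Defs.v *)
From HB Require Import structures.
From mathcomp Require Import all_boot all_order all_algebra.
(* The notations of mpoly clash with those of MathComp-Analysis. *)
From mathcomp Require Import -(notations) mpoly.
From mathcomp Require Import polyXY complex.
From mathcomp Require Import all_classical all_reals all_analysis.

Set Implicit Arguments.
Unset Strict Implicit.
Unset Printing Implicit Defensive.

Import Order.TTheory GRing.Theory Num.Theory.
Import numFieldNormedType.Exports.

Local Open Scope classical_set_scope.
Local Open Scope ring_scope.
Local Open Scope complex_scope.

Notation "{ 'mpoly' T [ n ] }" := (mpoly n T)
  (at level 0, T, n at level 2, format "{ 'mpoly'  T [ n ] }") : type_scope.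
Notation "p .@[ v ]" := (meval v p)
  (at level 1, left associativity, format "p .@[ v ]") : ring_scope.
Notation "p @_ m" := (mcoeff m p)
  (at level 3, m at level 2, left associativity, format "p @_ m") : ring_scope.
Notation "p ^`M ( i )" := (mderiv i p)
  (at level 3, left associativity, format "p ^`M ( i )") : ring_scope.

(* [vge nu m x] says nu(x) >= m, with the convention nu(0) = +oo; the integer
   [nu 0] is never used. *)
Definition vge (K : fieldType) (nu : K -> int) (m : int) (x : K) : bool :=
  (x == 0) || (m <= nu x).

(* A non-Archimedean local field: a field complete with respect to a normalized
   discrete valuation [nu], with finite residue field.  The residue field
   O_K / pi O_K is given up to isomorphism by a finite field together with a
   surjective ring morphism [red] from O_K whose kernel is pi O_K; the values
   of [red] outside O_K are irrelevant. *)
Record localField := LocalField {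
  lf_sort :> fieldType;
  nu : lf_sort -> int;
  nuM : forall x y, x != 0 -> y != 0 -> nu (x * y) = nu x + nu y;
  nuD : forall m x y, vge nu m x -> vge nu m y -> vge nu m (x + y);
  nu_normalized : exists2 x, x != 0 & nu x = 1;
  nu_complete : forall u : nat -> lf_sort,
    (forall m : int, exists N : nat, forall i j : nat,
        (N <= i)%N -> (N <= j)%N -> vge nu m (u i - u j)) ->
    exists a, forall m : int, exists N : nat, forall i : nat,
        (N <= i)%N -> vge nu m (u i - a);
  residue : finFieldType;
  red : lf_sort -> residue;
  red1 : red 1 = 1;
  redD : forall x y, vge nu 0 x -> vge nu 0 y -> red (x + y) = red x + red y;
  redM : forall x y, vge nu 0 x -> vge nu 0 y -> red (x * y) = red x * red y;
  red_ker : forall x, vge nu 0 x -> (red x == 0) = vge nu 1 x;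
  red_onto : forall a : residue, exists2 x, vge nu 0 x & red x = a
}.

Section LocalField.
Variable K : localField.

Definition integers : {pred K} := fun x => vge (@nu K) 0 x.
Definition maxideal : {pred K} := fun x => vge (@nu K) 1 x.
Definition unitsO : {pred K} := fun x => (x != 0) && (nu x == 0).

Definition uniformizer (varpi : K) := varpi != 0 /\ nu varpi = 1.

Definition resq : nat := #|{: residue K}|.

(* For z = 0 this gives 0, in accordance with the convention chi(0) = 0. *)
Definition ac (varpi z : K) : K := z * varpi ^ (- nu z).

Definition absK (R : realType) (z : K) : R :=
  if z == 0 then 0 else resq%:R ^ (- nu z).

End LocalField.

Arguments integers K : clear implicits.
Arguments maxideal K : clear implicits.
Arguments unitsO K : clear implicits.

Definition affineK (K : localField) (n : nat) : Type := 'rV[K]_n.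
HB.instance Definition _ K n := GRing.Zmodule.on (affineK K n).
HB.instance Definition _ K n :=
  isPointed.Build (affineK K n) (0 : 'rV[K]_n).

Definition coordK (K : localField) n (x : affineK K n) (i : 'I_n) : K :=
  (x : 'rV[K]_n) 0 i.

Definition openK (K : localField) n : set (set (affineK K n)) :=
  [set U | forall x, U x -> exists m : int, forall y,
     (forall i, vge (@nu K) m (coordK (y - x) i)) -> U y].

Definition borelK (K : localField) n := g_sigma_algebraType (@openK K n).

Definition integralK (K : localField) n : set (affineK K n) :=
  [set x | forall i, coordK x i \in integers K].

Definition is_haar (R : realType) (K : localField) n
    (mu : {measure set (borelK K n) -> \bar R}) : Prop :=
  (forall (a : affineK K n) (A : set (borelK K n)), measurable A ->
     mu [set a + x | x in (A : set (affineK K n))] = mu A) /\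
  mu (@integralK K n) = 1%E.

Section Zeta.
Variables (R : realType) (K : localField).
Local Notation C := R[i].

Definition cexp (z : C) : C :=
  (expR (complex.Re z))%:C * (cos (complex.Im z) +i* sin (complex.Im z)).

(* [cpow x s] is x^s for a real number x >= 0, with 0^s = 0. *)
Definition cpow (x : R) (s : C) : C :=
  if x == 0 then 0 else cexp (s * (ln x)%:C).

(* Characters of the unit group of O_K, extended by 0 to K. *)
Record is_character (chi : K -> C) : Prop := IsCharacter {
  char_out : forall x, x \notin unitsO K -> chi x = 0;
  charM : {in unitsO K &, forall x y, chi (x * y) = chi x * chi y};
  char_circle : {in unitsO K, forall x, `|chi x| = 1};
  char_cont : {in unitsO K, forall x (e : R), 0 < e ->
    exists m : int, {in unitsO K, forall y,
      vge (@nu K) m (y - x) -> `|chi y - chi x| < e%:C}}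
}.

Definition chi_triv : K -> C := fun x => (x \in unitsO K)%:R.

Definition char_inv (chi : K -> C) : K -> C := fun x => (chi x)^-1.

Section Integral.
Variables (n : nat) (mu : {measure set (borelK K n) -> \bar R}) (varpi : K).

Definition Cintegral (D : set (borelK K n)) (F : borelK K n -> C) : C :=
  Rintegral mu D (fun x => complex.Re (F x)) +i*
  Rintegral mu D (fun x => complex.Im (F x)).

Definition zeta_integral (chi1 chi2 : K -> C) (f g : {mpoly K[n]}) (s1 s2 : C) : C :=
  Cintegral (@integralK K n) (fun x =>
    chi1 (ac varpi f.@[coordK x]) * chi2 (ac varpi g.@[coordK x]) *
    cpow (absK R f.@[coordK x]) s1 * cpow (absK R g.@[coordK x]) s2).

(* q^{-s} *)
Definition qpow (s : C) : C := cpow (resq K)%:R (- s).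

(* P(q^{-s1}, q^{-s2}) / Q(q^{-s1}, q^{-s2}) is the meromorphic continuation
   of Z(s1, s2, chi1, chi2, f, g) to C^2. *)
Definition zeta_continuation (chi1 chi2 : K -> C) (f g : {mpoly K[n]})
    (P Q : {poly {poly C}}) : Prop :=
  Q != 0 /\
  forall s1 s2 : C, 0 < complex.Re s1 -> 0 < complex.Re s2 ->
    zeta_integral chi1 chi2 f g s1 s2 * Q.[qpow s1, qpow s2] =
    P.[qpow s1, qpow s2].

(* [Z] is Z(s, chi, f/g): the restriction to (s, -s) of the meromorphic
   continuation for (chi, chi^{-1}), the line (s, -s) not being contained in
   the zero set of the denominator.  The values of [Z] at the isolated zeros
   of the denominator are immaterial for the notion of pole below, and any
   two such [Z] agree outside a discrete set. *)
Definition is_zeta (chi : K -> C) (f g : {mpoly K[n]}) (Z : C -> C) : Prop :=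
  exists P Q : {poly {poly C}},
    [/\ zeta_continuation chi (char_inv chi) f g P Q,
        exists s, Q.[qpow s, qpow (- s)] != 0 &
        forall s, Z s = P.[qpow s, qpow (- s)] / Q.[qpow s, qpow (- s)]].

End Integral.

Definition is_pole (Z : C -> C) (s : C) : Prop :=
  (fun t : C^o => `|Z t| : C^o) @ (s : C^o)^' --> +oo.

End Zeta.

Arguments chi_triv R K : clear implicits.

Section Newton.
Variables (R : realType) (n : nat).

Definition dotv (x y : 'rV[R]_n) : R := \sum_i x 0 i * y 0 i.

Definition mvec (m : multinom n) : 'rV[R]_n := \row_i (m i)%:R.

Definition orthant : set 'rV[R]_n := [set x | forall i, 0 <= x 0 i].

Definition newton (A : fieldType) (h : {mpoly A[n]}) : set 'rV[R]_n :=
  smallest (@convex_set R 'rV[R]_n)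
    (\bigcup_(m in [set m | m \in msupp h]) [set mvec m + x | x in orthant]).

Definition dmin (k : 'rV[R]_n) (G : set 'rV[R]_n) : R := inf [set dotv k x | x in G].

Definition face (k : 'rV[R]_n) (G : set 'rV[R]_n) : set 'rV[R]_n :=
  [set x | G x /\ dotv k x = dmin k G].

Definition sigmav (k : 'rV[R]_n) : R := \sum_i k 0 i.

Definition face_poly (A : fieldType) (k : 'rV[R]_n) (h : {mpoly A[n]}) : {mpoly A[n]} :=
  \sum_(m <- msupp h | `[< face k (newton h) (mvec m) >])
    h@_m *: mpolyX A m.

(* The direction of the affine span of [t] has dimension [d]. *)
Definition has_affdim (t : set 'rV[R]_n) (d : nat) : Prop :=
  exists U : {vspace 'rV[R]_n},
    [/\ \dim U = d, (forall x y, t x -> t y -> y - x \in U) &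
        forall V : {vspace 'rV[R]_n},
          (forall x y, t x -> t y -> y - x \in V) -> (U <= V)%VS].

Definition is_face (G t : set 'rV[R]_n) : Prop :=
  exists (a : 'rV[R]_n) (b : R),
    [/\ a != 0, G `<=` [set x | b <= dotv a x],
        t = G `&` [set x | dotv a x = b] & t !=set0].

Definition is_facet (G t : set 'rV[R]_n) : Prop :=
  is_face G t /\ has_affdim t n.-1.

Definition primitive (w : multinom n) : Prop := (\big[gcdn/0]_(i < n) w i)%N = 1%N.

Definition perpendicular (v : 'rV[R]_n) (t : set 'rV[R]_n) : Prop :=
  forall x y, t x -> t y -> dotv v (y - x) = 0.

End Newton.

Definition reduction (K : localField) n (h : {mpoly K[n]}) : {mpoly (residue K)[n]} :=
  map_mpoly (@red K) h.

Definition newton_nondegenerate (R : realType) (K : localField) n (f g : {mpoly K[n]}) : Prop :=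
  let h (i : 'I_2) := if i == 0 then f else g in
  forall (k : 'rV[R]_n) (I : {set 'I_2}) (z : 'I_n -> residue K),
    let hbar i := reduction (face_poly k (h i)) in
    orthant k -> I != finset.set0 -> (forall j, z j != 0) ->
    (forall i, ((hbar i).@[z] == 0) = (i \in I)) ->
    \rank (\matrix_(i < #|I|, j < n) ((hbar (enum_val i))^`M(j)).@[z]) = #|I|.

Definition nonconstant n (A : fieldType) (f : {mpoly A[n]}) : Prop :=
  forall c : A, f <> mpolyC n c.

Definition mdivides n (A : fieldType) (h f : {mpoly A[n]}) : Prop :=
  exists u, f = u * h.

(* For polynomials over O_K that do not vanish modulo pi, coprimality over O_K
   and over K are the same by Gauss' lemma. *)
Definition mcoprime n (A : fieldType) (f g : {mpoly A[n]}) : Prop :=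
  forall h, mdivides h f -> mdivides h g -> mdivides h 1.

Section Candidates.
Variables (R : realType) (K : localField) (n : nat) (f g : {mpoly K[n]}).

Definition ddiff (w : multinom n) : R :=
  dmin (mvec R w) (newton g) - dmin (mvec R w) (newton f).

Definition facet_candidate (w : multinom n) (k : int) : R[i] :=
  (sigmav (mvec R w) / ddiff w) +i*
  (2 * pi * k%:~R / (ddiff w * ln (resq K)%:R)).

Definition unit_candidate (e : R) (k : int) : R[i] :=
  e +i* (2 * pi * k%:~R / ln (resq K)%:R).

End Candidates.

(* Main.v *)
Require Import Defs.
From mathcomp Require Import all_boot all_order all_algebra.
From mathcomp Require Import -(notations) mpoly.
From mathcomp Require Import polyXY complex.
From mathcomp Require Import all_classical all_reals all_analysis.
From mathcomp Require Import ring lra zify.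

(** Put [t1 = q^-s1] and [t2 = q^-s2].  The integral over [O^n] is the sum, over the vectors [k] of
    natural numbers, of the integrals over the tori of points whose coordinates have valuations [k].
    The substitution [x = pi^k u] extracts from the torus of [k] the monomial
    [q^-sigma(k) t1^d(k, f) t2^d(k, g)] and leaves an integral over the unit torus of the scaled
    polynomials [pi^-d(k) f(pi^k u)], which reduce modulo [pi] to the face polynomials.

    Non-degeneracy makes this remaining integral elementary.  Near a point of the unit torus those of
    the two scaled polynomials that vanish modulo [pi] behave as independent coordinates, and the
    others have constant angular component on small discs.  The mean of the integrand over a polydisc
    is then a product of means of one-variable functions ([means_prod], [local_integral]).  The proof
    compares two functions of discs that satisfy the same averaging relation and have the same limit;
    it needs no change of variables.  The one-variable means are polynomials in [t] for a nontrivial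
    character, by orthogonality, and have the denominator [1 - t / q] for the trivial one
    ([means_nontrivial], [means_trivial]).

    It remains to sum over [k].  The supporting functions [d(k, f)] and [d(k, g)] are linear on the
    cones of the normal fan of the Newton polyhedron of [f g], because they add up to the supporting
    function of the product ([support_minM], [support_minD]).  Each cone is generated by the facet
    normals that it contains ([fan_cone_generated]), so each lattice point of the cone is a bounded
    remainder plus a combination of facet normals with natural coefficients ([fan_repr]).  Choosing
    the least such representation for a monomial order makes it unique, and by Dickson's lemma the
    set of chosen exponents is described by truncations ([good_trunc]).  The integral over the unit
    torus only depends on truncations as well ([torus_coef_eq]).  The sum is therefore a finite
    combination of multiple geometric series, with ratios
    [X_i = q^-sigma(w_i) t1^d(w_i, f) t2^d(w_i, g)].  Its product with all [1 - X_i], and with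
    [(1 - t1 / q) (1 - t2 / q)] for the trivial character, is a polynomial ([zeta_rational]).  This
    argument avoids subdividing the fan into simplicial cones.

    Any other continuation is the same fraction, since the integral determines it on an infinite grid
    ([continuation_unique]).  Hence a pole on the line [(s, -s)] is a zero of this denominator
    ([pole_denominator]), and the zeros on the line are the candidates of the theorem ([unit_zero],
    [unit_zeroN], [facet_zero]). *)

Set Implicit Arguments.
Unset Strict Implicit.
Unset Printing Implicit Defensive.

Import Order.TTheory GRing.Theory Num.Theory.
Import numFieldNormedType.Exports.
Import ComplexField.Normc.

Local Open Scope classical_set_scope.
Local Open Scope ring_scope.

(** * Valuations and residues *)

Section Valuation.
Variable K : localField.
Local Notation nu := (@nu K).
Local Notation "m <=v x" := (vge nu m x) (at level 70).

Lemma vge0 m : m <=v 0. Proof. by rewrite /vge eqxx. Qed.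

Lemma vge_nu m x : x != 0 -> (m <=v x) = (m <= nu x).
Proof. by rewrite /vge => /negbTE ->. Qed.

Lemma vgeW m m' x : m' <= m -> m <=v x -> m' <=v x.
Proof. by move=> lem /orP[/eqP->|h]; rewrite /vge ?eqxx // (le_trans lem h) orbT. Qed.

Lemma nu1 : nu 1 = 0.
Proof.
have /eqP := nuM (oner_neq0 K) (oner_neq0 K).
by rewrite mulr1 -subr_eq0 opprD addrA subrr add0r oppr_eq0 => /eqP.
Qed.

Lemma nuN1 : nu (-1) = 0.
Proof.
have h : (-1 : K) != 0 by rewrite oppr_eq0 oner_eq0.
have := nuM h h; rewrite mulrNN mulr1 nu1 => /esym/eqP.
by rewrite -mulr2n mulrn_eq0 /= => /eqP.
Qed.

Lemma nuN x : nu (- x) = nu x.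
Proof.
have [->|x0] := eqVneq x 0; first by rewrite oppr0.
by rewrite -mulN1r nuM ?nuN1 ?add0r // oppr_eq0 oner_eq0.
Qed.

Lemma nuV x : x != 0 -> nu x^-1 = - nu x.
Proof.
move=> x0; have := nuM x0 (_ : x^-1 != 0); rewrite invr_eq0 => /(_ x0).
by rewrite mulfV // nu1 => /esym/eqP; rewrite addrC addr_eq0 => /eqP.
Qed.

Lemma nuX x k : x != 0 -> nu (x ^+ k) = k%:Z * nu x.
Proof.
move=> x0; elim: k => [|k IH]; first by rewrite expr0 nu1 mul0r.
by rewrite exprS nuM ?expf_neq0 // IH intS mulrDl mul1r.
Qed.

Lemma nuXz x (k : int) : x != 0 -> nu (x ^ k) = k * nu x.
Proof.
move=> x0; case: k => k; first exact: nuX.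
by rewrite NegzE -exprnN nuV ?expf_neq0 // nuX // mulNr.
Qed.

Lemma vgeN m x : (m <=v - x) = (m <=v x).
Proof. by rewrite /vge oppr_eq0 nuN. Qed.

Lemma vgeD m x y : m <=v x -> m <=v y -> m <=v x + y.
Proof. exact: nuD. Qed.

Lemma vgeB m x y : m <=v x -> m <=v y -> m <=v x - y.
Proof. by move=> hx hy; apply: nuD => //; rewrite vgeN. Qed.

Lemma vgeBC m x y : (m <=v x - y) = (m <=v y - x).
Proof. by rewrite -(vgeN _ (x - y)) opprB. Qed.

Lemma vgeM m m' x y : m <=v x -> m' <=v y -> m + m' <=v x * y.
Proof.
have [->|x0] := eqVneq x 0; first by rewrite mul0r !vge0.
have [->|y0] := eqVneq y 0; first by rewrite mulr0 !vge0.
by rewrite !vge_nu ?mulf_neq0 // nuM //; apply: lerD.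
Qed.

Lemma vgeMl m x y : 0 <=v x -> m <=v y -> m <=v x * y.
Proof. by move=> hx hy; rewrite -[m]add0r; apply: vgeM. Qed.

Lemma vge1 : 0 <=v 1. Proof. by rewrite vge_nu ?oner_eq0 // nu1. Qed.

Lemma vge_sum m (I : Type) (r : seq I) (P : pred I) (F : I -> K) :
  (forall i, P i -> m <=v F i) -> m <=v \sum_(i <- r | P i) F i.
Proof. by move=> h; elim/big_ind: _ => //; [exact: vge0 | move=> x y; apply: vgeD]. Qed.

Lemma vge_exp x k : 0 <=v x -> 0 <=v x ^+ k.
Proof. by move=> h; elim: k => [|k IH]; rewrite ?expr0 ?vge1 // exprS vgeMl. Qed.

Lemma vge_prod (I : Type) (r : seq I) (P : pred I) (F : I -> K) :
  (forall i, P i -> 0 <=v F i) -> 0 <=v \prod_(i <- r | P i) F i.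
Proof. by move=> h; elim/big_ind: _ => //; [exact: vge1 | move=> x y; apply: vgeMl]. Qed.

Lemma vge_trans m x y z : m <=v x - y -> m <=v y - z -> m <=v x - z.
Proof. by move=> h1 h2; have := vgeD h1 h2; rewrite addrA subrK. Qed.

(** The ultrametric inequality is an equality when the valuations differ. *)
Lemma nu_close x y : x != 0 -> nu x + 1 <=v y - x -> y != 0 /\ nu y = nu x.
Proof.
move=> x0 h.
have y0 : y != 0.
  apply/eqP => y0; move: h; rewrite y0 sub0r vgeN vge_nu //.
  by rewrite gerDl ler10.
have ge : nu x <= nu y.
  rewrite -vge_nu // -[y](subrK x); apply: vgeD; last by rewrite vge_nu.
  by apply: vgeW h; rewrite lerDl.
split=> //; apply/eqP; rewrite eq_le ge andbT leNgt; apply/negP => lt.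
have : nu x + 1 <=v y - (y - x) by apply: vgeB => //; rewrite vge_nu ?lezD1.
by rewrite subKr vge_nu // gerDl ler10.
Qed.

Lemma nu_eq_close x y m : x != 0 -> nu x < m -> m <=v y - x -> y != 0 /\ nu y = nu x.
Proof. by move=> x0 lt h; apply: nu_close => //; apply: vgeW h; rewrite lezD1. Qed.

Local Notation red := (@red K).

Lemma red0 : red 0 = 0.
Proof. by have := @redD K 0 0 (vge0 0) (vge0 0); rewrite addr0 => /esym/eqP; rewrite -subr_eq0 addrK => /eqP. Qed.

Lemma redN x : 0 <=v x -> red (- x) = - red x.
Proof.
move=> hx; have := @redD K x (- x) hx; rewrite vgeN => /(_ hx).
by rewrite subrr red0 => /esym/eqP; rewrite addrC addr_eq0 => /eqP.
Qed.

Lemma redB x y : 0 <=v x -> 0 <=v y -> red (x - y) = red x - red y.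
Proof. by move=> hx hy; rewrite redD ?vgeN // redN. Qed.

Lemma red_eq x y : 0 <=v x -> 0 <=v y -> (red x == red y) = (1 <=v x - y).
Proof. by move=> hx hy; rewrite -subr_eq0 -redB // red_ker // vgeB. Qed.

Lemma red_sum (I : Type) (r : seq I) (P : pred I) (F : I -> K) :
  (forall i, P i -> 0 <=v F i) ->
  red (\sum_(i <- r | P i) F i) = \sum_(i <- r | P i) red (F i).
Proof.
move=> h; apply: (@proj2 (0 <=v \sum_(i <- r | P i) F i)).
elim/big_rec2: _ => [|i y x Pi [hx IH]]; first by rewrite red0 vge0.
by rewrite redD ?IH ?h //; split => //; apply: vgeD; rewrite ?h.
Qed.

Lemma redX x k : 0 <=v x -> red (x ^+ k) = red x ^+ k.
Proof.
move=> hx; elim: k => [|k IH]; first by rewrite !expr0 red1.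
by rewrite !exprS redM ?IH // vge_exp.
Qed.

Lemma red_prod (I : Type) (r : seq I) (P : pred I) (F : I -> K) :
  (forall i, P i -> 0 <=v F i) ->
  red (\prod_(i <- r | P i) F i) = \prod_(i <- r | P i) red (F i).
Proof.
move=> h; apply: (@proj2 (0 <=v \prod_(i <- r | P i) F i)).
elim/big_rec2: _ => [|i y x Pi [hx IH]]; first by rewrite red1 vge1.
by rewrite redM ?IH ?h //; split => //; apply: vgeMl; rewrite ?h.
Qed.

Lemma vgeMn m x k : m <=v x -> m <=v x *+ k.
Proof. by move=> h; elim: k => [|k IH]; rewrite ?mulr0n ?vge0 // mulrS vgeD. Qed.

Lemma redMn x k : 0 <=v x -> red (x *+ k) = red x *+ k.
Proof.
move=> h; elim: k => [|k IH]; first by rewrite !mulr0n red0.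
by rewrite !mulrS redD ?IH // vgeMn.
Qed.

(** A set-theoretic section of the residue map; it is neither additive nor multiplicative. *)
Definition lift_residue (c : residue K) : K :=
  xget 0 [set x | 0 <=v x /\ red x = c].

Lemma lift_residueP c : 0 <=v lift_residue c /\ red (lift_residue c) = c.
Proof.
have [x hx xc] := red_onto c.
exact: (@xgetPex _ 0 [set x | 0 <=v x /\ red x = c] (ex_intro _ x (conj hx xc))).
Qed.

Lemma vge_lift c : 0 <=v lift_residue c. Proof. by have [] := lift_residueP c. Qed.
Lemma red_lift c : red (lift_residue c) = c. Proof. by have [] := lift_residueP c. Qed.

Lemma unitsO_nu x : (x \in unitsO K) = (x != 0) && (nu x == 0).
Proof. by []. Qed.

Lemma unitsO_vge x : x \in unitsO K -> 0 <=v x.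
Proof. by rewrite unitsO_nu => /andP[x0 /eqP h]; rewrite vge_nu // h. Qed.

Lemma unitsO_red x : 0 <=v x -> (x \in unitsO K) = (red x != 0).
Proof.
move=> hx; rewrite red_ker // unitsO_nu.
have [->|x0] := eqVneq x 0; first by rewrite vge0.
by move: hx; rewrite !vge_nu // => hx /=; rewrite -ltNge eq_le hx andbT -[1]add0r ltzD1.
Qed.

Lemma unitsOM x y : x \in unitsO K -> y \in unitsO K -> x * y \in unitsO K.
Proof.
rewrite !unitsO_nu => /andP[x0 /eqP hx] /andP[y0 /eqP hy].
by rewrite mulf_neq0 // nuM // hx hy.
Qed.

Lemma unitsO1 : 1 \in unitsO K.
Proof. by rewrite unitsO_nu oner_eq0 nu1. Qed.

Lemma resq_gt1 : (1 < resq K)%N.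
Proof.
rewrite /resq; apply/card_gt1P; exists 0, 1; split => //.
by rewrite eq_sym oner_eq0.
Qed.

Section Uniformizer.
Variable p : K.
Hypothesis hp : uniformizer p.

Lemma unif_neq0 : p != 0. Proof. by have [] := hp. Qed.
Lemma nu_unif : nu p = 1. Proof. by have [] := hp. Qed.

Lemma nu_unifX k : nu (p ^+ k) = k.
Proof. by rewrite nuX ?unif_neq0 // nu_unif mulr1. Qed.

Lemma vge_unifX k : k%:Z <=v p ^+ k.
Proof. by rewrite vge_nu ?expf_neq0 ?unif_neq0 // nu_unifX. Qed.

Lemma vge_unif0 k : 0 <=v p ^+ k.
Proof. by apply: vgeW (vge_unifX k). Qed.

Lemma vge_mulX k m x : (k%:Z + m <=v p ^+ k * x) = (m <=v x).
Proof.
have [->|x0] := eqVneq x 0; first by rewrite mulr0 !vge0.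
by rewrite !vge_nu ?mulf_neq0 ?expf_neq0 ?unif_neq0 // nuM ?expf_neq0 ?unif_neq0 // nu_unifX lerD2l.
Qed.

Lemma vge_mulX0 k x : (k%:Z <=v p ^+ k * x) = (0 <=v x).
Proof. by rewrite -[RHS](vge_mulX k) addr0. Qed.

Lemma vge_factor k x : k%:Z <=v x -> exists2 y, 0 <=v y & x = p ^+ k * y.
Proof.
move=> h; exists (p ^- k * x); last by rewrite mulrA mulfV ?mul1r // expf_neq0 ?unif_neq0.
by rewrite -(vge_mulX0 k) mulrA mulfV ?mul1r // expf_neq0 ?unif_neq0.
Qed.

Lemma next_digit k x : k%:Z <=v x ->
  exists c, k.+1%:Z <=v x - p ^+ k * lift_residue c.
Proof.
move=> /vge_factor[y hy ->]; exists (red y).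
by rewrite -mulrBr -[k.+1]addn1 PoszD vge_mulX -red_eq ?vge_lift // red_lift.
Qed.

Lemma digit_uniq k c c' :
  k.+1%:Z <=v p ^+ k * lift_residue c - p ^+ k * lift_residue c' -> c = c'.
Proof.
rewrite -mulrBr -[k.+1]addn1 PoszD vge_mulX -red_eq ?vge_lift // !red_lift.
by move/eqP.
Qed.

Lemma ac_unit z : z != 0 -> ac p z \in unitsO K.
Proof.
move=> z0; have h : p ^ (- nu z) != 0 by rewrite expfz_eq0 negb_and unif_neq0 orbT.
by rewrite unitsO_nu mulf_neq0 //= /ac nuM // nuXz ?unif_neq0 // nu_unif mulr1 subrr.
Qed.

Lemma ac_unitE z : z \in unitsO K -> ac p z = z.
Proof. by rewrite unitsO_nu => /andP[_ /eqP h]; rewrite /ac h oppr0 expr0z mulr1. Qed.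

Lemma acM x y : x != 0 -> y != 0 -> ac p (x * y) = ac p x * ac p y.
Proof.
move=> x0 y0; rewrite /ac nuM // opprD expfzDr ?unif_neq0 //.
by rewrite mulrACA.
Qed.

Lemma ac_unifX k : ac p (p ^+ k) = 1.
Proof. by rewrite /ac nu_unifX -exprnN mulfV // expf_neq0 ?unif_neq0. Qed.

End Uniformizer.
End Valuation.

(** * Complex moduli, polydiscs and tori *)

Section ComplexNorm.
Variable R : realType.
Local Notation C := (complex R).
Implicit Types z w : C.

Lemma normcRe z : `|complex.Re z| <= normc z.
Proof. by rewrite -lecR; exact: normc_ge_Re. Qed.

Lemma normc_ge0 z : 0 <= normc z.
Proof. by case: z => a b; rewrite /= sqrtr_ge0. Qed.

Lemma normc_leD z : normc z <= `|complex.Re z| + `|complex.Im z|.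
Proof.
case: z => a b /=; rewrite -[X in _ <= X]ger0_norm ?addr_ge0 // -sqrtr_sqr.
rewrite ler_sqrt ?sqr_ge0 // sqrrD !real_normK ?num_real //.
by rewrite lerD2r lerDl mulrn_wge0 // mulr_ge0.
Qed.

Lemma normcIm z : `|complex.Im z| <= normc z.
Proof.
by case: z => a b /=; rewrite -sqrtr_sqr ler_sqrt ?addr_ge0 ?sqr_ge0 // lerDr sqr_ge0.
Qed.

Lemma normcB z w : normc (z - w) = normc (w - z).
Proof. by rewrite -normcN opprB. Qed.

Lemma normc_triangle z w y : normc (z - w) <= normc (z - y) + normc (y - w).
Proof. by have -> : z - w = (z - y) + (y - w); [rewrite addrA subrK | exact: le_normcD]. Qed.

Lemma normc_real (x : R) : normc (x%:C)%C = `|x|.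
Proof. by rewrite /= expr0n addr0 sqrtr_sqr. Qed.

Lemma normc_sum (I : Type) (r : seq I) (P : pred I) (F : I -> C) :
  normc (\sum_(i <- r | P i) F i) <= \sum_(i <- r | P i) normc (F i).
Proof.
elim/big_ind2: _ => //; first by rewrite normc0.
by move=> x1 x2 y1 y2 h1 h2; apply: le_trans (le_normcD _ _) _; apply: lerD.
Qed.

Lemma normcX z k : normc (z ^+ k) = normc z ^+ k.
Proof. by elim: k => [|k IH]; rewrite ?expr0 ?normc1 // !exprS normcM IH. Qed.

Lemma normc_small z : (forall e : R, 0 < e -> normc z <= e) -> z = 0.
Proof.
move=> h; apply: eq0_normc; apply/eqP; rewrite eq_le normc_ge0 andbT.
by apply/ler_addgt0Pr => e /h; rewrite add0r.
Qed.

End ComplexNorm.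

Section Boxes.
Variables (K : localField) (n : nat) (p : K).
Hypothesis hp : uniformizer p.
Local Notation "m <=v x" := (vge (@nu K) m x) (at level 70).
Implicit Types (x y a : affineK K n) (k : 'I_n -> nat).

Definition mkK (c : 'I_n -> K) : affineK K n := \row_i c i.

Lemma coord_mkK c i : coordK (mkK c) i = c i.
Proof. by rewrite /coordK mxE. Qed.

Lemma coordKD x y i : coordK (x + y) i = coordK x i + coordK y i.
Proof. by rewrite /coordK mxE. Qed.

Lemma coordKB x y i : coordK (x - y) i = coordK x i - coordK y i.
Proof. by rewrite /coordK !mxE. Qed.

Lemma coordK0 i : coordK (0 : affineK K n) i = 0.
Proof. by rewrite /coordK mxE. Qed.

Definition box a k : set (borelK K n) :=
  [set x | forall i, (k i)%:Z <=v coordK (x : affineK K n) i - coordK a i].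

Lemma box_open a k : openK (box a k).
Proof.
move=> x hx; exists (\sum_i (k i)%:Z) => y hy i.
rewrite -[coordK y i](subrK (coordK x i)) -addrA; apply: vgeD => //.
rewrite -coordKB; apply: vgeW (hy i).
by rewrite (bigD1 i) //= lerDl sumr_ge0.
Qed.

Lemma open_meas (A : set (borelK K n)) : openK A -> measurable A.
Proof. exact: sub_sigma_algebra. Qed.

Lemma box_meas a k : measurable (box a k).
Proof. by apply: open_meas; exact: box_open. Qed.

Lemma integral_box : @integralK K n = box 0 (fun=> 0%N).
Proof.
by apply/seteqP; split=> x hx i; have := hx i; rewrite coordK0 subr0.
Qed.

Lemma box_sub_integral a k : integralK a -> box a k `<=` @integralK K n.
Proof.
move=> ha x hx i; change (0 <=v coordK x i); rewrite -[coordK x i](subrK (coordK a i)).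
by apply: vgeD; [apply: vgeW (hx i) | exact: ha].
Qed.

Lemma box_disj a b k x : box a k x -> box b k x ->
  forall i, (k i)%:Z <=v coordK a i - coordK b i.
Proof.
move=> h1 h2 i; apply: vge_trans (h2 i).
by rewrite vgeBC; exact: h1.
Qed.

Definition addu k (j : 'I_n) : 'I_n -> nat := fun i => (k i + (i == j))%N.

Lemma box_split1 k j :
  box 0 k = \big[setU/set0]_(c : residue K)
     box (mkK (fun i => if i == j then p ^+ k j * lift_residue c else 0)) (addu k j).
Proof.
rewrite -bigcup_seq; apply/seteqP; split=> x.
  move=> hx; have := hx j; rewrite coordK0 subr0 => /(next_digit hp)[c hc].
  exists c; first by rewrite /= mem_index_enum.
  move=> i; rewrite coord_mkK /addu; case: eqVneq => [->|ne].
    by rewrite addn1.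
  by rewrite addn0; have := hx i; rewrite coordK0.
case=> c _ hx i; have := hx i; rewrite coord_mkK coordK0 subr0 /addu.
case: eqVneq => [->|ne]; last by rewrite addn0 subr0.
rewrite addn1 => h; rewrite -[coordK x j](subrK (p ^+ k j * lift_residue c)).
apply: vgeD; last by rewrite vge_mulX0 // vge_lift.
by apply: vgeW h; rewrite lez_nat.
Qed.

Definition addn_all k m : 'I_n -> nat := fun i => (k i + m)%N.

Definition digits (m : nat) (c : {ffun 'I_n -> residue K}) (i : 'I_n) : K :=
  p ^+ m * lift_residue (c i).

(** Polydiscs are written with centre [pi ^ k u] and radii [q ^- (k i + m)]: the integrand behaves
    uniformly in [k] in terms of the coordinate [u]. *)
Definition scaleK k (u : affineK K n) : affineK K n :=
  mkK (fun i => p ^+ k i * coordK u i).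

Lemma coord_scale k u i : coordK (scaleK k u) i = p ^+ k i * coordK u i.
Proof. exact: coord_mkK. Qed.

Lemma box_split u k m :
  box (scaleK k u) (addn_all k m) = \big[setU/set0]_(c : {ffun 'I_n -> residue K})
     box (scaleK k (u + mkK (digits m c))) (addn_all k m.+1).
Proof.
have E c i : coordK (scaleK k (u + mkK (digits m c))) i =
  coordK (scaleK k u) i + p ^+ (k i + m) * lift_residue (c i).
  by rewrite !coord_scale coordKD coord_mkK /digits mulrDr mulrA exprD.
rewrite -bigcup_seq; apply/seteqP; split=> x.
  move=> hx; have /choice[c hc] : forall i, exists c,
    (k i + m).+1%:Z <=v coordK x i - coordK (scaleK k u) i - p ^+ (k i + m) * lift_residue c.
    by move=> i; apply: next_digit => //; exact: hx.
  exists [ffun i => c i]; first by rewrite /= mem_index_enum.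
  by move=> i; rewrite E ffunE opprD addrA /addn_all addnS.
case=> c _ hx i; have := hx i; rewrite E opprD addrA /addn_all addnS => h.
rewrite -[_ - _](subrK (p ^+ (k i + m) * lift_residue (c i))).
apply: vgeD; last by rewrite vge_mulX0 // vge_lift.
by apply: vgeW h; rewrite lez_nat.
Qed.

Lemma box_split_disj u k m (c c' : {ffun 'I_n -> residue K}) x :
  box (scaleK k (u + mkK (digits m c))) (addn_all k m.+1) x ->
  box (scaleK k (u + mkK (digits m c'))) (addn_all k m.+1) x -> c = c'.
Proof.
move=> h1 h2; apply/ffunP => i; have := box_disj h1 h2 i.
rewrite !coord_scale !coordKD !coord_mkK /digits !mulrDr.
rewrite opprD addrACA subrr add0r !mulrA -!exprD /addn_all addnS.
exact: digit_uniq.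
Qed.

Definition torus k : set (borelK K n) :=
  [set x | forall i, coordK (x : affineK K n) i != 0 /\ @nu K (coordK (x : affineK K n) i) = k i].

Lemma torus_split k :
  torus k = \big[setU/set0]_(c : {ffun 'I_n -> residue K} | [forall i, c i != 0])
     box (scaleK k (mkK (fun i => lift_residue (c i)))) (addn_all k 1).
Proof.
rewrite -bigcup_seq_cond; apply/seteqP; split=> x.
  move=> hx; have /choice[c hc] : forall i, exists c,
    (k i).+1%:Z <=v coordK x i - p ^+ (k i) * lift_residue c.
    by move=> i; apply: next_digit => //; have [x0 hi] := hx i; rewrite vge_nu // hi.
  exists [ffun i => c i].
    rewrite /= mem_index_enum /=; apply/forallP => i; rewrite ffunE.
    apply/eqP => c0; have := hc i; rewrite c0.
    have [x0 hi] := hx i.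
    have l0 : (k i).+1%:Z <=v p ^+ (k i) * lift_residue (0 : residue K).
      by rewrite -addn1 PoszD vge_mulX // -red_ker ?vge_lift // red_lift.
    move=> /vgeD/(_ l0); rewrite subrK vge_nu // hi lez_nat ltnn //.
  by move=> i; rewrite coord_scale coord_mkK ffunE /addn_all addn1.
case=> c /andP[_ /forallP c0] hx i; have := hx i.
rewrite coord_scale coord_mkK /addn_all addn1 => h.
have cu : lift_residue (c i) \in unitsO K by rewrite unitsO_red ?vge_lift // red_lift.
have [cn /eqP cv] := andP cu.
have y0 : p ^+ k i * lift_residue (c i) != 0 by rewrite mulf_neq0 // expf_neq0 // unif_neq0.
have ny : @nu K (p ^+ k i * lift_residue (c i)) = k i.
  by rewrite nuM ?(expf_neq0 _ (unif_neq0 hp)) // nu_unifX // cv addr0.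
by have := @nu_close K _ (coordK x i) y0; rewrite ny -PoszD addn1; apply.
Qed.

Lemma torus_split_disj k (c c' : {ffun 'I_n -> residue K}) x :
  box (scaleK k (mkK (fun i => lift_residue (c i)))) (addn_all k 1) x ->
  box (scaleK k (mkK (fun i => lift_residue (c' i)))) (addn_all k 1) x -> c = c'.
Proof.
move=> h1 h2; apply/ffunP => i; have := box_disj h1 h2 i.
by rewrite !coord_scale !coord_mkK /addn_all addn1; exact: digit_uniq.
Qed.

End Boxes.

(** * Haar measure and integration of uniformly continuous functions *)

Section Haar.
Variables (R : realType) (K : localField) (n : nat).
Variable mu : {measure set (borelK K n) -> \bar R}.
Hypothesis hmu : is_haar mu.
Variable p : K.
Hypothesis hp : uniformizer p.
Local Notation "m <=v x" := (vge (@nu K) m x) (at level 70).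
Local Notation C := (complex R).
Local Notation OKn := (@integralK K n : set (borelK K n)).
Local Notation q := ((resq K)%:R : R).

Lemma q_gt1 : 1 < q. Proof. by rewrite ltr1n; exact: resq_gt1. Qed.
Lemma q_gt0 : 0 < q. Proof. by apply: lt_trans q_gt1. Qed.
Lemma q_neq0 : q != 0. Proof. by rewrite gt_eqF // q_gt0. Qed.

Lemma bigsetU_mem (T : Type) (I : eqType) (r : seq I) (P : pred I) (A : I -> set T) x :
  (\big[setU/set0]_(i <- r | P i) A i) x -> exists i, [/\ i \in r, P i & A i x].
Proof.
elim: r => [|i r IH]; first by rewrite big_nil.
rewrite big_cons; case: ifP => [Pi [Ax|/IH[j [jr Pj Aj]]]|_ /IH[j [jr Pj Aj]]].
- by exists i; rewrite mem_head.
- by exists j; rewrite in_cons jr orbT.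
- by exists j; rewrite in_cons jr orbT.
Qed.

(** Stated for an arbitrary set functional, so that it serves both the measure and the integral. *)
Lemma additive_bigsetU (V : nmodType) (Phi : set (borelK K n) -> V)
    (I : eqType) (r : seq I) (P : pred I) (A : I -> set (borelK K n)) :
  Phi set0 = 0 ->
  (forall X Y : set (borelK K n), measurable X -> measurable Y -> X `<=` OKn -> Y `<=` OKn ->
     X `&` Y = set0 -> Phi (X `|` Y) = Phi X + Phi Y) ->
  uniq r -> (forall i, P i -> measurable (A i)) -> (forall i, P i -> A i `<=` OKn) ->
  (forall i j x, P i -> P j -> A i x -> A j x -> i = j) ->
  Phi (\big[setU/set0]_(i <- r | P i) A i) = \sum_(i <- r | P i) Phi (A i).
Proof.
move=> P0 PU + mA sA dA; elim: r => [|i r IH] /=; first by rewrite !big_nil.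
case/andP=> ir /IH{}IH; rewrite !big_cons; case: ifP => // Pi.
rewrite PU ?IH //; first exact: mA.
- exact: bigsetU_measurable.
- exact: sA.
- by move=> x hx; have [j [_ Pj]] := bigsetU_mem hx; exact: sA.
- apply/seteqP; split=> // x [Aix hx]; have [j [jr Pj Ajx]] := bigsetU_mem hx.
  by move: ir; rewrite (dA _ _ _ Pi Pj Aix Ajx) jr.
Qed.

Lemma OKn_meas : measurable OKn.
Proof. by rewrite integral_box; exact: box_meas. Qed.

Lemma mu_fin A : measurable A -> A `<=` OKn -> mu A \is a fin_num.
Proof.
move=> mA sA; rewrite ge0_fin_numE //; apply: le_lt_trans (_ : 1%E < +oo)%E; last exact: ltry.
case: hmu => _ <-; apply: le_measure => //; rewrite inE //; exact: OKn_meas.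
Qed.

Lemma box_translate (a : affineK K n) k : box a k = [set a + x | x in (box 0 k : set (affineK K n))].
Proof.
apply/seteqP; split=> x.
  move=> hx; exists (x - a); last by rewrite addrC subrK.
  by move=> i; rewrite coordKB coordK0 subr0; exact: hx.
case=> y hy <- i; rewrite coordKD addrAC subrr add0r.
by have := hy i; rewrite coordK0 subr0.
Qed.

Lemma mu_box_center a k : mu (box a k) = mu (box 0 k).
Proof. by rewrite box_translate; case: hmu => h _; apply: h; exact: box_meas. Qed.

Lemma integral0 : integralK (0 : affineK K n).
Proof. by move=> i; rewrite coordK0; exact: vge0. Qed.

(** Translation invariance and the normalization determine the volumes of polydiscs. *)
Lemma mu_box a k : mu (box a k) = ((q^-1) ^+ (\sum_i k i))%:E.
Proof.
rewrite mu_box_center; move: {2}(\sum_i k i)%N (erefl (\sum_i k i)%N) => m.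
elim: m k => [|m IH] k hk.
  have -> : k = fun=> 0%N.
    apply/funext => i; apply/eqP; rewrite -leqn0 -[X in (_ <= X)%N]hk.
    by rewrite (bigD1 i) //= leq_addr.
  by rewrite -integral_box big1 // expr0; case: hmu.
have [j hj] : exists j, k j != 0%N.
  apply: contrapT => /forallNP h; move: hk; rewrite big1 // => i _.
  by apply/eqP; apply: contrapT => /negP; exact: h.
pose k' i := (k i - (i == j))%N.
have kE : k = addu k' j.
  apply/funext => i; rewrite /addu /k'; case: eqVneq => [->|_]; last by rewrite subn0 addn0.
  by rewrite subnK // lt0n.
have sk : (\sum_i k i = (\sum_i k' i).+1)%N.
  rewrite kE /addu big_split /= -[RHS]addn1; congr addn.
  by rewrite (bigD1 j) //= eqxx big1 // => i /negbTE ->.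
have := IH k'; have -> : (\sum_i k' i)%N = m by move: sk; rewrite hk => -[].
move=> /(_ erefl); rewrite (box_split1 hp k' j).
rewrite (@additive_bigsetU _ mu _ _ xpredT) //; last first.
- move=> c c' x _ _ h1 h2; have := box_disj h1 h2 j.
  by rewrite !coord_mkK eqxx /addu eqxx addn1; exact: digit_uniq.
- move=> c _; apply: box_sub_integral => i; rewrite coord_mkK.
  case: eqP => _; last exact: vge0.
  by apply: vgeMl; [exact: vge_unif0 | exact: vge_lift].
- by move=> c _; exact: box_meas.
- exact: index_enum_uniq.
by move=> X Y mX mY _ _; exact: measureU.
rewrite (eq_bigr (fun=> mu (box 0 k))); last by move=> c _; rewrite -kE; exact: mu_box_center.
have : mu (box 0 k) \is a fin_num.
  by apply: mu_fin; [exact: box_meas | exact/box_sub_integral/integral0].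
move=> /fineK <-; rewrite sumEFin => -[]; rewrite sumr_const => h.
have km : (\sum_i k' i)%N = m by move: sk; rewrite hk => -[].
congr EFin; rewrite sk exprS km -h.
by rewrite -[_ *+ #|_|]mulr_natl mulrA mulVf ?mul1r // q_neq0.
Qed.

(** A continuous function is Borel: sets [g > c] are open. *)
Lemma cont_meas (g : borelK K n -> R) :
  (forall x, OKn x -> forall e, 0 < e -> exists N : nat, forall y, OKn y ->
     (forall i, N%:Z <=v coordK (y : affineK K n) i - coordK (x : affineK K n) i) ->
     `|g y - g x| <= e) ->
  measurable_fun OKn g.
Proof.
move=> hg _; apply: (measurability _ (measurable_realfun.RGenOInfty.measurableE R)) => //; last exact: OKn_meas.
move=> _ [_ [c ->] <-]; apply: open_meas => x [Ox /=]; rewrite in_itv /= andbT => cx.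
have [N hN] := hg x Ox ((g x - c) / 2) ltac:(by rewrite divr_gt0 // subr_gt0).
exists N%:Z => y hy.
have hy' i : N%:Z <=v coordK (y : affineK K n) i - coordK (x : affineK K n) i.
  by rewrite -coordKB; exact: hy.
have Oy : OKn y.
  move=> i; change (0 <=v coordK y i); rewrite -[coordK y i](subrK (coordK x i)).
  by apply: vgeD; [apply: vgeW (hy' i) | exact: Ox].
split=> //=; rewrite in_itv /= andbT.
have := hN y Oy hy'; rewrite ler_norml => /andP[h _].
by lra.
Qed.

(** Uniform continuity in the [pi]-adic topology.  The integrands extend continuously by 0 across
    the zeros of [f] and [g], so this single notion gives measurability, integrability and the
    approximation of integrals over polydiscs by values at their centres. *)
Definition ucont (F : borelK K n -> C) := forall e : R, 0 < e ->
  exists N : nat, forall x y, OKn x -> OKn y ->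
    (forall i, N%:Z <=v coordK (y : affineK K n) i - coordK (x : affineK K n) i) ->
    normc (F y - F x) <= e.

Definition ubounded (F : borelK K n -> C) := exists M : R, forall x, OKn x -> normc (F x) <= M.

Section Integrand.
Variable F : borelK K n -> C.
Hypotheses (Fc : ucont F) (Fb : ubounded F).

Lemma int_Re A : measurable A -> A `<=` OKn ->
  mu.-integrable A (EFin \o (fun x => complex.Re (F x))).
Proof.
move=> mA sA; apply: integrableS sA _ => //; first exact: OKn_meas.
apply: measurable_bounded_integrable; first exact: OKn_meas.
- by rewrite -ge0_fin_numE //; apply: mu_fin => //; exact: OKn_meas.
- apply: cont_meas => x Ox e /Fc[N hN]; exists N => y Oy hy.
  by apply: le_trans (hN x y Ox Oy hy); rewrite -raddfB; exact: normcRe.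
- have [M hM] := Fb; exists M; split; first exact: num_real.
  move=> z Mz x Ox; apply: le_trans (normcRe _) _; exact: le_trans (hM x Ox) (ltW Mz).
Qed.

Lemma int_Im A : measurable A -> A `<=` OKn ->
  mu.-integrable A (EFin \o (fun x => complex.Im (F x))).
Proof.
move=> mA sA; apply: integrableS sA _ => //; first exact: OKn_meas.
apply: measurable_bounded_integrable; first exact: OKn_meas.
- by rewrite -ge0_fin_numE //; apply: mu_fin => //; exact: OKn_meas.
- apply: cont_meas => x Ox e /Fc[N hN]; exists N => y Oy hy.
  by apply: le_trans (hN x y Ox Oy hy); rewrite -raddfB; exact: normcIm.
- have [M hM] := Fb; exists M; split; first exact: num_real.
  move=> z Mz x Ox; apply: le_trans (normcIm _) _; exact: le_trans (hM x Ox) (ltW Mz).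
Qed.

Lemma Cint_set0 : Cintegral mu set0 F = 0.
Proof. by rewrite /Cintegral !Rintegral_set0. Qed.

Lemma Cint_setU X Y : measurable X -> measurable Y -> X `<=` OKn -> Y `<=` OKn ->
  X `&` Y = set0 -> Cintegral mu (X `|` Y) F = Cintegral mu X F + Cintegral mu Y F.
Proof.
move=> mX mY sX sY d.
have mU := measurableU _ _ mX mY; have sU : X `|` Y `<=` OKn by rewrite subUset.
have iR := int_Re mU sU; have iI := int_Im mU sU.
by rewrite /Cintegral !Rintegral_setU //; apply/disj_setPS; rewrite d.
Qed.

Lemma Cint_bigsetU (I : finType) (P : pred I) (A : I -> set (borelK K n)) :
  (forall i, P i -> measurable (A i)) -> (forall i, P i -> A i `<=` OKn) ->
  (forall i j x, P i -> P j -> A i x -> A j x -> i = j) ->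
  Cintegral mu (\big[setU/set0]_(i | P i) A i) F = \sum_(i | P i) Cintegral mu (A i) F.
Proof.
move=> mA sA dA; apply: (@additive_bigsetU _ (fun A => Cintegral mu A F)) => //.
- exact: Cint_set0.
- exact: Cint_setU.
- exact: index_enum_uniq.
Qed.

Lemma Rint_close A (g : borelK K n -> R) (c e : R) : measurable A -> A `<=` OKn ->
  mu.-integrable A (EFin \o g) -> (forall x, A x -> `|g x - c| <= e) ->
  `|Rintegral mu A g - c * fine (mu A)| <= e * fine (mu A).
Proof.
move=> mA sA ig h.
have ic (d : R) : mu.-integrable A (EFin \o (fun=> d)).
  apply: measurable_bounded_integrable => //.
    by rewrite -ge0_fin_numE //; apply: mu_fin.
  by exists `|d|; split; [exact: num_real | move=> z hz x _; exact: ltW].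
rewrite ler_norml; apply/andP; split.
  have : Rintegral mu A (fun=> c - e) <= Rintegral mu A g.
    apply: le_Rintegral => // x Ax; have := h x Ax; rewrite ler_norml => /andP[h1 _]; lra.
  by rewrite Rintegral_cst //; lra.
have : Rintegral mu A g <= Rintegral mu A (fun=> c + e).
  apply: le_Rintegral => // x Ax; have := h x Ax; rewrite ler_norml => /andP[_ h1]; lra.
by rewrite Rintegral_cst //; lra.
Qed.

(** The factor 2 comes from treating the real and imaginary parts separately. *)
Lemma Cint_close A (c : C) (e : R) : measurable A -> A `<=` OKn ->
  (forall x, A x -> normc (F x - c) <= e) ->
  normc (Cintegral mu A F - c * ((fine (mu A))%:C)%C) <= 2 * e * fine (mu A).
Proof.
move=> mA sA h; apply: le_trans (normc_leD _) _.
rewrite -mulrA mulr_natl mulr2n /Cintegral; case: c h => a b h; apply: lerD => /=.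
  rewrite mulr0 subr0; apply: Rint_close => //; first exact: int_Re.
  by move=> x Ax; apply: le_trans (h x Ax); apply: le_trans (normcRe _); case: (F x).
rewrite mulr0 add0r; apply: Rint_close => //; first exact: int_Im.
by move=> x Ax; apply: le_trans (h x Ax); apply: le_trans (normcIm _); case: (F x).
Qed.

End Integrand.
End Haar.

(** * Characters of the unit group and their means over discs *)

Section Characters.
Variables (R : realType) (K : localField) (p : K).
Hypothesis hp : uniformizer p.
Local Notation "m <=v x" := (vge (@nu K) m x) (at level 70).
Local Notation nu := (@nu K).
Local Notation C := (complex R).
Local Notation q := ((resq K)%:R : C).
Implicit Types (chi : K -> C) (t : C).

(** The function [chi(ac y) |y|^s], with [t = q^-s]. *)
Definition qchar chi t (y : K) : C := chi (ac p y) * t ^+ absz (nu y).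

Definition trivial_on chi (m : nat) :=
  forall x, x \in unitsO K -> m%:Z <=v x - 1 -> chi x = 1.

Lemma char1 chi : is_character chi -> chi 1 = 1.
Proof.
move=> hc; have h1 := unitsO1 K; have := charM hc h1 h1.
rewrite mulr1 => h; have n0 : chi 1 != 0.
  by apply/eqP => c0; have := char_circle hc h1; rewrite c0 normr0 => /eqP; rewrite eq_sym oner_eq0.
by apply: (mulfI n0); rewrite -h mulr1.
Qed.

Lemma char_unit_neq0 chi x : is_character chi -> x \in unitsO K -> chi x != 0.
Proof.
move=> hc hx; apply/eqP => c0; have := char_circle hc hx.
by rewrite c0 normr0 => /eqP; rewrite eq_sym oner_eq0.
Qed.

Lemma char0 chi : is_character chi -> chi 0 = 0.
Proof. by move=> hc; apply: (char_out hc); rewrite unitsO_nu eqxx. Qed.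

Lemma qchar0 chi t : is_character chi -> qchar chi t 0 = 0.
Proof. by move=> hc; rewrite /qchar /ac mul0r char0 // mul0r. Qed.

Lemma char_normc chi x : is_character chi -> normc (chi x) <= 1.
Proof.
move=> hc; have [hx|hx] := boolP (x \in unitsO K).
  by have := char_circle hc hx; rewrite /Num.norm /= => -[->].
by rewrite (char_out hc hx) normc0 ler01.
Qed.

Lemma qchar_le chi t y m : is_character chi -> normc t <= 1 -> (0 <=v y) ->
  m%:Z <=v y -> normc (qchar chi t y) <= normc t ^+ m.
Proof.
move=> hc ht hy hm; have [->|y0] := eqVneq y 0.
  by rewrite qchar0 // normc0 exprn_ge0 // normc_ge0.
move: hm hy; rewrite !vge_nu // /qchar normcM normcX => hm hy.
apply: (@le_trans _ _ (1 * normc t ^+ absz (nu y))).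
  by apply: ler_wpM2r; [exact/exprn_ge0/normc_ge0 | exact: char_normc].
by rewrite mul1r; apply: ler_wiXn2l; rewrite ?normc_ge0 //; move: hm hy; lia.
Qed.

Lemma expr_small (x : R) : 0 <= x -> x < 1 ->
  forall e, 0 < e -> exists N, forall m, (N <= m)%N -> x ^+ m <= e.
Proof.
move=> x0 x1 e e0; have : x ^+ n @[n --> \oo] --> 0 by apply: cvg_expr; rewrite ger0_norm.
move=> /cvgrPdist_le/(_ e e0)[N _ hN]; exists N => m Nm.
by have := hN m Nm; rewrite sub0r normrN ger0_norm // exprn_ge0.
Qed.

(** The circle has no small subgroups: squaring expands distances to [1] near [1]. *)
Lemma no_small_subgroup (z : C) :
  (forall j, normc (z ^+ (2 ^ j) - 1) <= 2^-1) -> z = 1.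
Proof.
move=> h; have grow j : (3 / 2) ^+ j * normc (z - 1) <= normc (z ^+ (2 ^ j) - 1).
  elim: j => [|j IH]; first by rewrite expr0 mul1r expn0 expr1.
  rewrite expnSr exprM; set w := z ^+ _; rewrite -/w in IH.
  have -> : w ^+ 2 - 1 = (w - 1) * (w + 1) by ring.
  rewrite normcM exprS -mulrA; apply: (@le_trans _ _ (3 / 2 * normc (w - 1))).
    by apply: ler_wpM2l => //; rewrite divr_ge0.
  rewrite mulrC; apply: ler_wpM2l; first exact: normc_ge0.
  have := le_normcD (w + 1) (- (w - 1)); rewrite normcN.
  have -> : w + 1 - (w - 1) = ((2 : R)%:C)%C by rewrite (rmorph_nat (real_complex R) 2); ring.
  rewrite normc_real ger0_norm //; have := h j; rewrite -/w; lra.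
apply/eqP; rewrite -subr_eq0; apply/eqP; apply: eq0_normc; apply/eqP.
have n0 := normc_ge0 (z - 1); case: eqVneq => // nn.
have npos : 0 < normc (z - 1) by rewrite lt_def nn.
have [N hN] := @expr_small (2 / 3) ltac:(lra) ltac:(lra) (normc (z - 1)) npos.
have := le_trans (grow N) (h N); have := hN N (leqnn N).
have -> : (2 / 3 : R) ^+ N = ((3 / 2) ^+ N)^-1 by rewrite -exprVn invf_div.
have e0 : 0 < (3 / 2 : R) ^+ N by rewrite exprn_gt0 // divr_gt0.
rewrite -(ler_pM2l e0) mulfV ?gt_eqF // => h1 h2.
by have := le_trans h1 h2; lra.
Qed.

(** By continuity [chi] is close to 1 on a subgroup [1 + pi^m O]; its image is then a subgroup of
    the circle close to 1, hence trivial. *)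
Lemma conductor_exists chi : is_character chi -> exists m, trivial_on chi m.
Proof.
move=> hc; have [m hm] := char_cont hc (unitsO1 K) (e := 2^-1) ltac:(by rewrite invr_gt0).
have {}hm y : y \in unitsO K -> m <=v y - 1 -> normc (chi y - 1) <= 2^-1.
  by move=> hy /(hm y hy); rewrite (char1 hc) /Num.norm /= ltcR => /ltW.
exists (absz m) => x hx h1; apply: no_small_subgroup => j.
have hX i : (x ^+ i \in unitsO K) /\ chi (x ^+ i) = chi x ^+ i.
  elim: i => [|i [IH1 IH2]]; first by rewrite !expr0 unitsO1 char1.
  by rewrite !exprS unitsOM // (charM hc) // IH2.
have [u1 <-] := hX (2 ^ j)%N; apply: hm => //.
apply: (@vgeW _ (absz m)%:Z); first by lia.
elim: (2 ^ j)%N => [|i IH]; first by rewrite expr0 subrr vge0.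
rewrite exprS (_ : _ - 1 = x * (x ^+ i - 1) + (x - 1)); last by ring.
by apply: vgeD => //; apply: vgeMl => //; exact: unitsO_vge.
Qed.

Lemma qchar_unitM chi t x z : is_character chi -> z \in unitsO K ->
  qchar chi t (x * z) = chi z * qchar chi t x.
Proof.
move=> hc hz; have [->|x0] := eqVneq x 0; first by rewrite mul0r qchar0 // mulr0.
have /andP[z0 /eqP nz] := hz.
by rewrite /qchar acM // (charM hc) ?ac_unit // [ac p z]ac_unitE // nuM // nz addr0 mulrA [chi _ * chi z]mulrC.
Qed.

Lemma qchar_unif chi t d y : (0 <=v y) -> is_character chi ->
  qchar chi t (p ^+ d * y) = t ^+ d * qchar chi t y.
Proof.
move=> hy hc; have [->|y0] := eqVneq y 0; first by rewrite mulr0 qchar0 // mulr0.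
have pn := unif_neq0 hp.
rewrite /qchar acM // ?expf_neq0 // ac_unifX // mul1r nuM ?expf_neq0 // nu_unifX //.
rewrite vge_nu // in hy; rewrite (_ : absz _ = d + absz (nu y))%N; last by lia.
by rewrite exprD mulrCA.
Qed.

(** On a disc of radius at most [|a| q^-e] around [a] the quotients [a' / a] lie in [1 + pi^e O],
    where a character of conductor at most [e] is trivial. *)
Lemma qchar_close chi t e a a' : is_character chi -> trivial_on chi e.+1 -> a != 0 ->
  (nu a + e.+1%:Z <=v a' - a) -> [/\ a' != 0, nu a' = nu a & qchar chi t a' = qchar chi t a].
Proof.
move=> hc tr a0 h; have lt : nu a < nu a + e.+1%:Z by rewrite ltrDl.
have [a'0 na] := nu_eq_close a0 lt h.
split=> //; have u : a' / a \in unitsO K.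
  rewrite unitsO_nu mulf_neq0 ?invr_eq0 //= nuM ?invr_eq0 // nuV // na; apply/eqP; exact: subrr.
have E : a' = a * (a' / a) by rewrite mulrC divfK.
rewrite E qchar_unitM // (tr _ u) ?mul1r //.
have -> : a' / a - 1 = (a' - a) * a^-1 by rewrite mulrBl mulfV.
have -> : e.+1%:Z = nu a + e.+1%:Z + nu a^-1 by rewrite nuV // addrC addrA addNr add0r.
by apply: vgeM => //; rewrite vge_nu ?invr_eq0.
Qed.

(** [h e a] stands for the mean value of [qchar chi t] over the disc [a + pi ^ e O].  The averaging
    relation and the limit determine it, so that no integration in one variable is required. *)
Record means chi t (e0 : nat) (h : nat -> K -> C) : Prop := Means {
  means_inv : forall e a a', (e0 <= e)%N -> (0 <=v a) -> (0 <=v a') ->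
    e%:Z <=v a' - a -> h e a' = h e a;
  means_avg : forall e a, (e0 <= e)%N -> (0 <=v a) ->
    h e a = q^-1 * \sum_(b : residue K) h e.+1 (a + p ^+ e * lift_residue b);
  means_lim : forall eps : R, 0 < eps -> exists N, forall e a, (N <= e)%N -> (0 <=v a) ->
    normc (h e a - qchar chi t a) <= eps;
  means_unit : forall e a, (e0 <= e)%N -> a \in unitsO K -> h e a = qchar chi t a
}.

Lemma qC_neq0 : q != 0.
Proof. by rewrite pnatr_eq0 -lt0n; apply: ltn_trans (resq_gt1 K). Qed.

Lemma means_weaken chi t e0 e1 h : (e0 <= e1)%N -> means chi t e0 h -> means chi t e1 h.
Proof.
move=> le [h1 h2 h3 h4]; split => //.
- by move=> e a a' he; apply: h1; apply: leq_trans he.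
- by move=> e a he; apply: h2; apply: leq_trans he.
- by move=> e a he; apply: h4; apply: leq_trans he.
Qed.

(** For a nontrivial character of exact conductor [e0], the mean over a disc on which
    the angular component is not constant modulo [pi ^ e0] vanishes, by orthogonality. *)
Lemma means_nontrivial chi : is_character chi -> chi <> chi_triv R K ->
  exists e0 (h : C -> nat -> K -> C),
    [/\ (0 < e0)%N, forall t, normc t < 1 -> means chi t e0 (h t) &
        forall e a, exists P : {poly C}, forall t, h t e a = P.[t]].
Proof.
move=> hc nt.
have [m0 hm0] := conductor_exists hc.
have ex : exists m, `[< trivial_on chi m >] by exists m0; apply/asboolP.
case: (ex_minnP ex) => -[|e1] /asboolP tr hmin.
  case: nt; apply/funext => x; rewrite /chi_triv; case: (boolP (x \in _)) => hx.
    by rewrite tr // vgeB ?vge1 // unitsO_vge.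
  by rewrite (char_out hc).
(* minimality of the conductor gives a unit close to 1 on which [chi] is not 1 *)
have [z [zu z1 zn]] : exists z, [/\ z \in unitsO K, e1%:Z <=v z - 1 & chi z != 1].
  apply: contrapT => hn; have : ~ trivial_on chi e1.
    by move=> /asboolP/hmin; rewrite ltnn.
  apply=> x xu x1; apply/eqP; apply: contrapT => /negP xn.
  by apply: hn; exists x.
pose e0 := e1.+1; pose ok e a := (a != 0) && (nu a + e0%:Z <= e%:Z).
pose h (t : C) e a := if ok e a then qchar chi t a else 0.
have okE e a a' : (e%:Z <=v a' - a) -> ok e a -> ok e a'.
  move=> ha /andP[a0 la]; have lt : nu a < e%:Z by apply: lt_le_trans la; rewrite ltrDl.
  by have [a'0 na] := nu_eq_close a0 lt ha; rewrite /ok a'0 na.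
exists e0, h; split=> //; last first.
  move=> e a; rewrite /h; case: (ok e a).
    by exists (chi (ac p a) *: 'X^(absz (nu a))) => t; rewrite hornerZ hornerXn.
  by exists 0 => t; rewrite horner0.
move=> t t1; have t1' := ltW t1.
have hinv e a a' : (e%:Z <=v a' - a) -> h t e a' = h t e a.
  move=> ha; rewrite /h; case: (boolP (ok e a)) => oka.
    rewrite (okE _ _ _ ha oka).
    have /andP[a0 la] := oka; have [//|_ _ ->//] := @qchar_close chi t e1 a a' hc tr a0 _.
    exact: vgeW la ha.
  case: ifP => // oka'; move: oka; rewrite (okE e a' a) //.
  by rewrite vgeBC.
split => //.
- by move=> e a a' _ _ _; exact: hinv.
- move=> e a he ha; rewrite {1}/h; case: ifP => oka.
    have /andP[a0 la] := oka.
    rewrite (eq_bigr (fun=> qchar chi t a)); last first.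
      move=> b _.
      have hb : e%:Z <=v a + p ^+ e * lift_residue b - a.
        by rewrite addrAC subrr add0r vge_mulX0 // vge_lift.
      have := okE _ _ _ hb oka; have [_ na qa] := @qchar_close chi t e1 a _ hc tr a0 (vgeW la hb).
      rewrite /h; case/andP=> b0 lb; rewrite /ok b0 (le_trans lb) ?qa //.
      by rewrite lez_nat.
    by rewrite sumr_const -/(resq K) -[qchar chi t a *+ _]mulr_natl mulrA mulVf ?mul1r // qC_neq0.
  have hr : e%:Z <=v a * (z - 1).
    have [->|a0] := eqVneq a 0; first by rewrite mul0r vge0.
    apply: (@vgeW _ (nu a + e1%:Z)); last by apply: vgeM => //; rewrite vge_nu.
    by move: oka; rewrite /ok a0 /= => /negbT; rewrite -ltNge /e0; lia.
  have [r hr0 ar] := vge_factor hp hr.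
  have zO := unitsO_vge zu.
  have zred : red z != 0 by rewrite -unitsO_red.
  pose s b := red r + b * red z.
  have sinj : injective s by move=> b b' /addrI/(mulIf zred).
  pose S := \sum_(b : residue K) h t e.+1 (a + p ^+ e * lift_residue b).
  have hz x : h t e.+1 (x * z) = chi z * h t e.+1 x.
    rewrite /h /ok mulf_eq0 negb_or; have /andP[z0 /eqP nz] := zu.
    rewrite z0 andbT; case: (eqVneq x 0) => [->|x0] /=; first by rewrite mulr0.
    rewrite nuM // nz addr0; case: ifP => _; last by rewrite mulr0.
    exact: qchar_unitM.
  (* multiplication by [z] permutes the classes of the disc modulo [pi ^ e.+1] *)
  have : S = chi z * S.
    rewrite {1}/S (reindex_inj sinj) /= mulr_sumr; apply: eq_bigr => b _.
    rewrite -hz; apply: hinv; rewrite vgeBC.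
    have -> : (a + p ^+ e * lift_residue b) * z - (a + p ^+ e * lift_residue (s b)) =
      p ^+ e * (r + lift_residue b * z - lift_residue (s b)).
      by rewrite mulrBr mulrDr -ar; ring.
    rewrite -[e.+1]addn1 PoszD vge_mulX //.
    rewrite -red_eq ?vge_lift //; last by apply: vgeD => //; apply: vgeMl; rewrite // vge_lift.
    by rewrite red_lift redD ?redM ?red_lift ?vge_lift // vgeMl // vge_lift.
  move/eqP; rewrite -subr_eq0 -{1}[S]mul1r -mulrBl mulf_eq0 subr_eq0 eq_sym (negbTE zn) /=.
  by rewrite -/S => /eqP ->; rewrite mulr0.
- move=> eps /(expr_small (normc_ge0 t) t1)[N hN]; exists (N + e0)%N => e a he ha.
  rewrite /h; case: ifP => oka; first by rewrite subrr normc0 (le_trans _ (hN N (leqnn _))) // exprn_ge0 // normc_ge0.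
  rewrite sub0r normcN; apply: le_trans (hN N (leqnn _)); apply: qchar_le => //.
  have [->|a0] := eqVneq a 0; first exact: vge0.
  by rewrite vge_nu //; move: oka; rewrite /ok a0 /= => /negbT; rewrite -ltNge; lia.
- move=> e a he /andP[a0 /eqP na]; rewrite /h /ok a0 na add0r /=.
  by rewrite lez_nat he.
Qed.

Lemma qchar_triv t a : a != 0 -> qchar (chi_triv R K) t a = t ^+ absz (nu a).
Proof. by move=> a0; rewrite /qchar /chi_triv ac_unit // mul1r. Qed.

Lemma chi_triv_character : is_character (chi_triv R K).
Proof.
split.
- by move=> x /negbTE hx; rewrite /chi_triv hx.
- by move=> x y hx hy; rewrite /chi_triv hx hy unitsOM // mulr1.
- by move=> x hx; rewrite /chi_triv hx normr1.
- by move=> x hx e e0; exists 0 => y hy _; rewrite /chi_triv hx hy subrr normr0 ltcR.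
Qed.

(** For the trivial character the mean over [pi ^ e O] is the geometric series
    [sum_(m >= e) (1 - 1/q) q^(e - m) t^m]. *)
Lemma means_trivial :
  exists (h : C -> nat -> K -> C),
    (forall t, normc t < 1 -> means (chi_triv R K) t 1 (h t)) /\
    (forall e a, exists P : {poly C}, forall t, normc t < 1 ->
        (1 - q^-1 * t) * h t e a = P.[t]).
Proof.
(* [t ^ e * kap t] is the mean of [|y|^s] over [pi ^ e O] *)
pose kap t : C := (1 - q^-1) / (1 - q^-1 * t).
pose ok (e : nat) a := (a != 0) && (nu a < e%:Z).
pose h (t : C) (e : nat) a := if ok e a then t ^+ absz (nu a) else t ^+ e * kap t.
have q1 := resq_gt1 K.
have den t : normc t < 1 -> 1 - q^-1 * t != 0.
  move=> t1; apply/eqP => /eqP; rewrite subr_eq0 => /eqP e1.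
  have := congr1 (@normc R) e1; rewrite normc1 normcM normcV.
  have -> : normc q = (resq K)%:R by rewrite -[q](rmorph_nat (real_complex R)) normc_real ger0_norm.
  move/eqP; apply/negP; rewrite eq_sym lt_eqF //.
  rewrite -[X in _ < X]mulr1; apply: (@le_lt_trans _ _ (1 * normc t)); last by rewrite !mul1r.
  by apply: ler_wpM2r; rewrite ?normc_ge0 // invf_le1 ?ler1n ?ltr0n; lia.
exists h; split; last first.
  move=> e a; rewrite /h; case: (ok e a).
    exists ((1 - q^-1 *: 'X) * 'X^(absz (nu a))) => t _.
    by rewrite !hornerE.
  exists ((1 - q^-1) *: 'X^e) => t t1.
  rewrite hornerZ hornerXn /kap; move: (den t t1).
  by move: (1 - q^-1 * t) (1 - q^-1) (t ^+ e) => D c T D0; field.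
have okE e a a' : (e%:Z <=v a' - a) -> ok e a -> ok e a' /\ nu a' = nu a.
  by move=> ha /andP[a0 la]; have [a'0 na] := nu_eq_close a0 la ha; rewrite /ok a'0 na.
move=> t t1; split.
- move=> e a a' _ _ _ ha; rewrite /h; case: (boolP (ok e a)) => oka.
    by have [-> ->] := okE _ _ _ ha oka.
  case: ifP => // oka'; move: oka; have [|->//] := okE e a' a _ oka'.
  by rewrite vgeBC.
- move=> e a he ha; rewrite {1}/h; case: ifP => oka.
    rewrite (eq_bigr (fun=> t ^+ absz (nu a))); last first.
      move=> b _; have hb : e%:Z <=v a + p ^+ e * lift_residue b - a.
        by rewrite addrAC subrr add0r vge_mulX0 // vge_lift.
      have [/andP[b0 lb] nb] := okE _ _ _ hb oka.
      by rewrite /h /ok b0 (lt_trans lb) ?nb // ltz_nat.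
    by rewrite sumr_const -/(resq K) -[(t ^+ _) *+ _]mulr_natl mulrA mulVf ?mul1r // qC_neq0.
  have hr : e%:Z <=v a.
    have [->|a0] := eqVneq a 0; first by rewrite vge0.
    by rewrite vge_nu //; move: oka; rewrite /ok a0 /= => /negbT; rewrite -leNgt.
  have [r hr0 ar] := vge_factor hp hr.
  rewrite (bigD1 (- red r)) //=.
  rewrite (eq_bigr (fun=> t ^+ e)); last first.
    move=> b nb; rewrite ar -mulrDr.
    have u : r + lift_residue b \in unitsO K.
      rewrite unitsO_red; last by apply: vgeD; rewrite // vge_lift.
      by rewrite redD ?vge_lift // red_lift addrC addr_eq0.
    have /andP[u0 /eqP un] := u; have pn := unif_neq0 hp.
    by rewrite /h /ok mulf_neq0 ?expf_neq0 //= nuM ?expf_neq0 // nu_unifX // un addr0 ltz_nat ltnSn.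
  have -> : h t e.+1 (a + p ^+ e * lift_residue (- red r)) = t ^+ e.+1 * kap t.
    rewrite /h /ok; case: eqVneq => //= x0; rewrite ltNge -vge_nu //.
    rewrite ar -mulrDr -addn1 PoszD vge_mulX // -red_ker; last by apply: vgeD; rewrite // vge_lift.
    by rewrite redD ?vge_lift // red_lift subrr eqxx.
  rewrite sumr_const cardC1 -/(resq K) -[(t ^+ e) *+ _]mulr_natl /kap.
  have -> : (resq K).-1%:R = q - 1 by rewrite -subn1 natrB // ltnW.
  rewrite exprS; have := den t t1; have := qC_neq0.
  move: (q) (t ^+ e) => Q T Q0 d0.
  have d1 : Q - t != 0.
    by move: d0; apply: contraNneq => /eqP; rewrite subr_eq0 => /eqP <-; rewrite mulVf // subrr.
  by field; rewrite Q0 d1.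
- move=> eps e0; have M0 : 0 < eps / (normc (kap t) + 1).
    by rewrite divr_gt0 // ltr_wpDl // normc_ge0.
  have [N hN] := expr_small (normc_ge0 t) t1 M0; exists N => e a he ha.
  rewrite /h; case: ifP => oka.
    have /andP[a0 _] := oka; rewrite qchar_triv // subrr normc0; exact: ltW.
  apply: le_trans (le_normcD _ _) _; rewrite normcN normcM normcX.
  have hr : e%:Z <=v a.
    have [->|a0] := eqVneq a 0; first by rewrite vge0.
    by rewrite vge_nu //; move: oka; rewrite /ok a0 /= => /negbT; rewrite -leNgt.
  have := qchar_le chi_triv_character (ltW t1) ha hr; have := hN e he.
  rewrite ler_pdivlMr; last by rewrite ltr_wpDl // normc_ge0.
  by rewrite mulrDr mulr1; lra.
- move=> e a he /andP[a0 /eqP na]; rewrite /h /ok a0 na /= qchar_triv // na.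
  by rewrite ltz_nat he.
Qed.

End Characters.

(** * Equidistribution of linear maps and Taylor expansion *)

Section Equidistribution.
Variables (F : finFieldType) (n m : nat) (C : comNzRingType).

(** A surjective linear map between finite vector spaces has fibres of equal size:
    translating the argument along a section averages over the target. *)
Lemma equidistribution (M : 'M[F]_(m, n)) (G : 'I_m -> F -> C) : \rank M = m ->
  #|{: F}|%:R ^+ m * (\sum_(c : {ffun 'I_n -> F}) \prod_r G r (\sum_j M r j * c j)) =
  #|{: F}|%:R ^+ n * \prod_r \sum_b G r b.
Proof.
move=> rM; have /row_freeP[B MB] : row_free M by rewrite /row_free rM.
pose H (b : {ffun 'I_m -> F}) := \prod_r G r (b r).
pose L (c : {ffun 'I_n -> F}) : {ffun 'I_m -> F} := [ffun r => \sum_j M r j * c j].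
have E (c : {ffun 'I_n -> F}) : \prod_r G r (\sum_j M r j * c j) = H (L c).
  by apply: eq_bigr => r _; rewrite ffunE.
rewrite (eq_bigr _ (fun c _ => E c)).
pose S (b : {ffun 'I_m -> F}) : {ffun 'I_n -> F} := [ffun j => \sum_r B j r * b r].
have LS b : L (S b) = b.
  apply/ffunP => r; rewrite !ffunE.
  have /matrixP/(_ r) h := MB.
  rewrite (eq_bigr (fun j => \sum_s M r j * B j s * b s)); last first.
    by move=> j _; rewrite ffunE mulr_sumr; apply: eq_bigr => s _; rewrite mulrA.
  rewrite exchange_big /= (bigD1 r) //= -mulr_suml.
  have := h r; rewrite !mxE eqxx => ->; rewrite mul1r big1 ?addr0 // => s sr.
  by rewrite -mulr_suml; have := h s; rewrite !mxE eq_sym (negbTE sr) => ->; rewrite mul0r.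
have LD c c' : L (c + c') = L c + L c'.
  apply/ffunP => r; rewrite !ffunE -big_split /=; apply: eq_bigr => j _.
  by rewrite ffunE mulrDr.
have sh b : \sum_(c : {ffun 'I_n -> F}) H (L c) = \sum_(c : {ffun 'I_n -> F}) H (L c + b).
  rewrite (reindex_inj (addIr (S b))) /=; apply: eq_bigr => c _.
  by rewrite LD LS.
have -> : \prod_r \sum_b G r b = \sum_(b : {ffun 'I_m -> F}) H b.
  by rewrite bigA_distr_bigA.
have cf k : (#|{: F}|%:R : C) ^+ k = #|{: {ffun 'I_k -> F}}|%:R.
  by rewrite card_ffun card_ord natrX.
rewrite !cf [LHS]mulr_natl [RHS]mulr_natl -[LHS]sumr_const -[RHS]sumr_const.
rewrite (eq_bigr _ (fun b _ => sh b)) exchange_big /=.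
apply: eq_bigr => c _.
by rewrite [RHS](reindex_inj (addrI (L c))).
Qed.

End Equidistribution.

Section Taylor.
Variables (K : localField) (n : nat).
Local Notation "m <=v x" := (vge (@nu K) m x) (at level 70).
Implicit Types (f : {mpoly K[n]}) (u v : 'I_n -> K).

Definition intcoef f := forall m, 0 <=v f@_m.

(** First-order Taylor expansion: the remainder is quadratic in the increment.  The first two
    clauses make the property stable under products. *)
Definition taylor f := forall e u v, (forall i, 0 <=v u i) -> (forall i, e%:Z <=v v i) ->
  [/\ 0 <=v f.@[u], forall j, 0 <=v (f^`M(j)).@[u] &
      (e + e)%:Z <=v f.@[fun i => u i + v i] - f.@[u] - \sum_j (f^`M(j)).@[u] * v j].

Lemma taylorC c : 0 <=v c -> taylor (mpolyC n c).
Proof.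
move=> hc e u v hu hv; rewrite !mevalC; split => //.
  by move=> j; rewrite mderivC meval0 vge0.
by rewrite subrr add0r big1 ?oppr0 ?vge0 // => j _; rewrite mderivC meval0 mul0r.
Qed.

Lemma taylorXi i : taylor (mpolyX K (mnm1 i)).
Proof.
move=> e u v hu hv.
have D j : ((mpolyX K (mnm1 i))^`M(j)).@[u] = (i == j)%:R.
  rewrite mderivX mevalZ mnm1E; case: eqVneq => [->|_]; last by rewrite mul0r.
  rewrite mul1r (_ : mnm_sub _ _ = mnm0) ?mpolyX0 ?meval1 //.
  by apply/mnmP => l; rewrite mnmBE subnn mnm0E.
rewrite !mevalXU; split; first exact: hu.
  by move=> j; rewrite D; case: eqP => _; rewrite ?vge0 ?vge1.
rewrite (bigD1 i) //= D eqxx mul1r big1 ?addr0; last first.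
  by move=> j ji; rewrite D eq_sym (negbTE ji) mul0r.
by rewrite [u i + v i]addrC addrK subrr vge0.
Qed.

Lemma taylorD f g : taylor f -> taylor g -> taylor (f + g).
Proof.
move=> hf hg e u v hu hv.
have [f1 f2 f3] := hf e u v hu hv; have [g1 g2 g3] := hg e u v hu hv.
split; first by rewrite mevalD vgeD.
  by move=> j; rewrite mderivD mevalD vgeD.
have -> : \sum_j ((f + g)^`M(j)).@[u] * v j =
    \sum_j (f^`M(j)).@[u] * v j + \sum_j (g^`M(j)).@[u] * v j.
  by rewrite -big_split /=; apply: eq_bigr => j _; rewrite mderivD mevalD mulrDl.
by have := vgeD f3 g3; congr (_ <=v _); rewrite !mevalD; ring.
Qed.

Lemma taylorM f g : taylor f -> taylor g -> taylor (f * g).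
Proof.
move=> hf hg e u v hu hv.
have [f1 f2 f3] := hf e u v hu hv; have [g1 g2 g3] := hg e u v hu hv.
have sumv h : (forall j, 0 <=v (h^`M(j)).@[u]) -> e%:Z <=v \sum_j (h^`M(j)).@[u] * v j.
  by move=> hh; apply: vge_sum => j _; apply: vgeMl.
have uv i : 0 <=v u i + v i by apply: vgeD => //; apply: vgeW (hv i).
have [_ _ _] := hf e u v hu hv; have [gv _ _] := hg e _ _ uv hv.
split; first by rewrite mevalM vgeMl.
  by move=> j; rewrite mderivM mevalD !mevalM vgeD // vgeMl.
rewrite !mevalM.
pose Df := \sum_j (f^`M(j)).@[u] * v j; pose Dg := \sum_j (g^`M(j)).@[u] * v j.
have -> : \sum_j ((f * g)^`M(j)).@[u] * v j = Df * g.@[u] + f.@[u] * Dg.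
  rewrite /Df /Dg mulr_suml mulr_sumr -big_split /=; apply: eq_bigr => j _.
  by rewrite mderivM mevalD !mevalM; ring.
pose f' := f.@[fun i => u i + v i]; pose g' := g.@[fun i => u i + v i]; rewrite -/f' -/g'.
have -> : f' * g' - f.@[u] * g.@[u] - (Df * g.@[u] + f.@[u] * Dg) =
  g' * (f' - f.@[u] - Df) + f.@[u] * (g' - g.@[u] - Dg) + Df * (g' - g.@[u] - Dg) + Df * Dg.
  by ring.
apply: vgeD; last by rewrite PoszD; apply: vgeM; exact: sumv.
apply: vgeD; last by apply: vgeMl => //; apply: vgeW (sumv _ f2).
by apply: vgeD; apply: vgeMl.
Qed.

Lemma taylor_intcoef f : intcoef f -> taylor f.
Proof.
move=> hf; rewrite [f]mpolyE; elim/big_ind: _ => //.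
- by rewrite -(mpolyC0 n); exact/taylorC/vge0.
- exact: taylorD.
move=> m _; rewrite -mul_mpolyC; apply: taylorM; first exact: taylorC.
rewrite mpolyXE_id; elim/big_ind: _ => //.
- by rewrite -(mpolyC1 n); exact/taylorC/vge1.
- exact: taylorM.
move=> i _; elim: (m i) => [|l IH]; first by rewrite expr0 -(mpolyC1 n); exact/taylorC/vge1.
by rewrite exprS; apply: taylorM => //; exact: taylorXi.
Qed.

Lemma intcoef_eval f u : intcoef f -> (forall i, 0 <=v u i) -> 0 <=v f.@[u].
Proof.
by move=> /taylor_intcoef hf hu; have [] := hf 0%N u (fun=> 0) hu (fun=> vge0 _ _).
Qed.

Lemma intcoef_deriv f j : intcoef f -> intcoef (f^`M(j)).
Proof. by move=> hf m; rewrite mcoeff_deriv; apply: vgeMn. Qed.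

Lemma intcoef_close f e u v : intcoef f -> (forall i, 0 <=v u i) -> (forall i, 0 <=v v i) ->
  (forall i, e%:Z <=v v i - u i) -> e%:Z <=v f.@[v] - f.@[u].
Proof.
move=> hf hu hv huv.
have [_ h2] := taylor_intcoef hf hu huv.
rewrite (@meval_eq _ _ _ v); last by move=> i; rewrite addrC subrK.
move=> h; rewrite -[_ - _](subrK (\sum_j (f^`M(j)).@[u] * (v j - u j))).
apply: vgeD; first by apply: vgeW h; rewrite lez_nat leq_addr.
by apply: vge_sum => j _; apply: vgeMl.
Qed.

Lemma mcoeff_reduction f m : (reduction f)@_m = red (f@_m).
Proof.
rewrite /reduction /map_mpoly /mmap raddf_sum /=.
rewrite (eq_bigr (fun m' => red (f@_m') * (m' == m)%:R)); last first.
  by move=> m' _; rewrite mcoeffCM mmap1_id mcoeffX.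
have [hm|hm] := boolP (m \in msupp f).
  rewrite (bigD1_seq m) ?msupp_uniq //= eqxx mulr1 big1 ?addr0 // => m' /negbTE ->.
  by rewrite mulr0.
rewrite big_seq big1; last first.
  by move=> m' hm'; case: eqVneq => [e|_]; rewrite ?mulr0 //; rewrite e (negbTE hm) in hm'.
by move: hm; rewrite -mcoeff_eq0 => /eqP ->; rewrite red0.
Qed.

Lemma reduction_eval f u : intcoef f -> (forall i, 0 <=v u i) ->
  (reduction f).@[fun i => red (u i)] = red f.@[u].
Proof.
move=> hf hu; rewrite /reduction /map_mpoly /mmap raddf_sum /= mevalE red_sum; last first.
  by move=> m _; apply: vgeMl => //; apply: vge_prod => i _; exact: vge_exp.
apply: eq_bigr => m _; rewrite mmap1_id mul_mpolyC mevalZ mevalX.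
rewrite redM //; last by apply: vge_prod => i _; exact: vge_exp.
rewrite red_prod //; last by move=> i _; exact: vge_exp.
by congr (_ * _); apply: eq_bigr => i _; rewrite redX.
Qed.

Lemma reduction_deriv f j : intcoef f -> (reduction f)^`M(j) = reduction (f^`M(j)).
Proof.
move=> hf; apply/mpolyP => m.
by rewrite mcoeff_deriv !mcoeff_reduction mcoeff_deriv redMn.
Qed.

End Taylor.

(** * Integrals over small polydiscs *)

Section Shift.
Variables (K : localField) (n : nat) (p : K).
Hypothesis hp : uniformizer p.
Local Notation "m <=v x" := (vge (@nu K) m x) (at level 70).
Implicit Types (u : affineK K n) (c : {ffun 'I_n -> residue K}).

Lemma integral_digits u e c : integralK u -> integralK (u + mkK (digits p e c)).
Proof.
move=> Ou i; rewrite coordKD coord_mkK; apply: vgeD; first exact: Ou.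
by apply: vgeMl; [exact: vge_unif0 | exact: vge_lift].
Qed.

Lemma red_digits u e c : integralK u -> (0 < e)%N ->
  (fun i => red (coordK (u + mkK (digits p e c)) i)) = (fun i => red (coordK u i)).
Proof.
move=> Ou e1; apply/funext => i; apply/eqP; rewrite coordKD coord_mkK.
have l0 : e%:Z <=v digits p e c i by rewrite vge_mulX0 // vge_lift.
have l1 : 0 <=v digits p e c i by apply: vgeW l0.
rewrite red_eq //; last exact: Ou; last by apply: vgeD => //; exact: Ou.
by rewrite addrAC subrr add0r; apply: vgeW l0; rewrite lez_nat.
Qed.

End Shift.

Section LocalIntegral.
Variables (R : realType) (K : localField) (n : nat).
Variable mu : {measure set (borelK K n) -> \bar R}.
Hypothesis hmu : is_haar mu.
Variable p : K.
Hypothesis hp : uniformizer p.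
Local Notation "m <=v x" := (vge (@nu K) m x) (at level 70).
Local Notation C := (complex R).
Local Notation OKn := (@integralK K n : set (borelK K n)).
Local Notation q := ((resq K)%:R : R).
Local Notation qC := ((resq K)%:R : C).

(** The rank condition of the non-degeneracy hypothesis at one point [z], for polynomials whose
    reductions are already the face polynomials under consideration. *)
Definition nondeg_at (phi : 'I_2 -> {mpoly K[n]}) (z : 'I_n -> residue K) :=
  let I := [set i | (reduction (phi i)).@[z] == 0]%SET in
  \rank (\matrix_(r < #|I|, j < n) ((reduction (phi (enum_val r)))^`M(j)).@[z]) = #|I|.

Variables (chi : 'I_2 -> K -> C) (t : 'I_2 -> C) (h : 'I_2 -> nat -> K -> C) (e0 : nat).
Hypotheses (e0_gt0 : (0 < e0)%N) (hchi : forall i, is_character (chi i)).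
Hypotheses (ht : forall i, normc (t i) < 1) (hm : forall i, means p (chi i) (t i) e0 (h i)).
Variable phi : 'I_2 -> {mpoly K[n]}.
Hypothesis phi_int : forall i, intcoef (phi i).

(** Near a non-degenerate point those [phi i] that vanish modulo [pi] behave as
    independent coordinates, while the others have constant angular component. *)
Lemma means_prod u e : integralK u -> nondeg_at phi (fun i => red (coordK u i)) -> (e0 <= e)%N ->
  \prod_i h i e (phi i).@[coordK u] =
  qC^-1 ^+ n * \sum_(c : {ffun 'I_n -> residue K})
     \prod_i h i e.+1 (phi i).@[coordK (u + mkK (digits p e c))].
Proof.
move=> Ou; rewrite /nondeg_at; set I := [set i | _]%SET => nd he.
have q0 := qC_neq0 R K.
have phiO i : 0 <=v (phi i).@[coordK u] by apply: intcoef_eval => //; exact: Ou.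
have Oc (c : {ffun 'I_n -> residue K}) : integralK (u + mkK (digits p e c)).
  exact: integral_digits.
have phiOc i (c : {ffun 'I_n -> residue K}) : 0 <=v (phi i).@[coordK (u + mkK (digits p e c))].
  by apply: intcoef_eval => //; exact: Oc.
have cl i (c : {ffun 'I_n -> residue K}) : e%:Z <=v coordK (u + mkK (digits p e c)) i - coordK u i.
  by rewrite coordKD coord_mkK addrAC subrr add0r vge_mulX0 // vge_lift.
have phicl i (c : {ffun 'I_n -> residue K}) : e%:Z <=v (phi i).@[coordK (u + mkK (digits p e c))] - (phi i).@[coordK u].
  apply: intcoef_close; [exact: phi_int | exact: Ou | exact: Oc | move=> j; exact: cl].
have inI i : (i \in I) = (red (phi i).@[coordK u] == 0).
  by rewrite inE reduction_eval.
have e1 : (0 < e)%N by apply: leq_trans he.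
pose M := \matrix_(r < #|I|, j < n) ((reduction (phi (enum_val r)))^`M(j)).@[fun i => red (coordK u i)].
pose G (r : 'I_#|I|) (b : residue K) :=
  h (enum_val r) e.+1 ((phi (enum_val r)).@[coordK u] + p ^+ e * lift_residue b).
have Hout i (c : {ffun 'I_n -> residue K}) : i \notin I -> h i e.+1 (phi i).@[coordK (u + mkK (digits p e c))] = h i e (phi i).@[coordK u].
  rewrite inI => hi; have un : (phi i).@[coordK u] \in unitsO K by rewrite unitsO_red.
  have un' : (phi i).@[coordK (u + mkK (digits p e c))] \in unitsO K.
    rewrite unitsO_red //; have : 1 <=v (phi i).@[coordK (u + mkK (digits p e c))] - (phi i).@[coordK u].
      by apply: vgeW (phicl i c); rewrite lez_nat.
    by rewrite -red_eq // => /eqP ->.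
  rewrite (means_unit (hm i) (leqW he) un') -(means_unit (hm i) he un').
  exact: (means_inv (hm i)).
have Hin r (c : {ffun 'I_n -> residue K}) : h (enum_val r) e.+1 (phi (enum_val r)).@[coordK (u + mkK (digits p e c))] =
    G r (\sum_j M r j * c j).
  set i := enum_val r; rewrite /G -/i; apply: (means_inv (hm i)) => //; first exact: leqW.
    by apply: vgeD => //; apply: vgeMl; [exact: vge_unif0 | exact: vge_lift].
  have dv j : e%:Z <=v digits p e c j by rewrite vge_mulX0 // vge_lift.
  have [_ d1 T] := taylor_intcoef (phi_int i) (Ou : forall j, 0 <=v coordK u j) dv.
  have T' : e.+1%:Z <=v (phi i).@[coordK (u + mkK (digits p e c))] - (phi i).@[coordK u]
      - \sum_j ((phi i)^`M(j)).@[coordK u] * digits p e c j.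
    rewrite (@meval_eq _ _ _ (fun j => coordK u j + digits p e c j)); last first.
      by move=> j; rewrite coordKD coord_mkK.
    by apply: vgeW T; rewrite lez_nat; lia.
  rewrite opprD addrA; apply: vge_trans T' _.
  rewrite (eq_bigr (fun j => p ^+ e * (((phi i)^`M(j)).@[coordK u] * lift_residue (c j)))); last first.
    by move=> j _; rewrite mulrCA.
  have d2 j : 0 <=v ((phi i)^`M(j)).@[coordK u] * lift_residue (c j).
    by apply: vgeMl; rewrite // vge_lift.
  rewrite -mulr_sumr -mulrBr -addn1 PoszD vge_mulX // -red_eq ?vge_lift //; last exact: vge_sum.
  rewrite red_lift red_sum //; apply/eqP; apply: eq_bigr => j _.
  rewrite redM ?vge_lift // red_lift mxE reduction_deriv // reduction_eval //.
  exact: intcoef_deriv.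
pose Pout := \prod_(i | i \notin I) h i e (phi i).@[coordK u].
have -> : \sum_c \prod_i h i e.+1 (phi i).@[coordK (u + mkK (digits p e c))] =
    Pout * \sum_(c : {ffun 'I_n -> residue K}) \prod_r G r (\sum_j M r j * c j).
  rewrite mulr_sumr; apply: eq_bigr => c _.
  rewrite (bigID (mem I)) /= mulrC; congr (_ * _).
    by apply: eq_bigr => i; exact: Hout.
  by rewrite big_enum_val /=; apply: eq_bigr => r _; exact: Hin.
rewrite (bigID (mem I)) /= mulrC -/Pout mulrCA; congr (_ * _).
have := @equidistribution _ _ _ C M G nd; rewrite -/(resq K) => E.
apply: (mulfI (expf_neq0 #|I| q0)).
rewrite [RHS]mulrCA E [RHS]mulrA -exprMn mulVf // expr1n mul1r big_enum_val /=.
have -> : qC ^+ #|I| = \prod_(r < #|I|) qC by rewrite prodr_const card_ord.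
rewrite -big_split /=; apply: eq_bigr => r _.
by rewrite (means_avg (hm _) he (phiO _)) mulrA mulfV // mul1r.
Qed.

Variable k : 'I_n -> nat.
Variable F : borelK K n -> C.
Hypotheses (Fc : ucont F) (Fb : ubounded F).
Variable cst : C.
Hypothesis FE : forall u, integralK u ->
  F (scaleK p k u) = cst * \prod_i qchar p (chi i) (t i) (phi i).@[coordK u].

Definition vol e : C := qC^-1 ^+ (\sum_i addn_all k e i)%N.

Lemma vol_neq0 e : vol e != 0.
Proof. by rewrite expf_neq0 // invr_neq0 // qC_neq0. Qed.

Lemma volS e : vol e.+1 = qC^-1 ^+ n * vol e.
Proof.
rewrite /vol -exprD; congr (_ ^+ _); rewrite /addn_all.
rewrite (eq_bigr (fun i => 1 + (k i + e))%N) => [|i _]; last by rewrite addnS add1n.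
by rewrite big_split /= sum1_card card_ord.
Qed.

Lemma volE e : vol e = ((q^-1 ^+ (\sum_i addn_all k e i))%:C)%C.
Proof. by rewrite rmorphXn fmorphV rmorph_nat. Qed.

Lemma scaleK_int u : integralK u -> integralK (scaleK p k u).
Proof. by move=> Ou i; rewrite coord_scale; apply: vgeMl; [exact: vge_unif0 | exact: Ou]. Qed.

(** The difference between the normalized integral over a polydisc and its expected value. *)
Definition defect e u := (vol e)^-1 * Cintegral mu (box (scaleK p k u) (addn_all k e)) F -
  cst * \prod_i h i e (phi i).@[coordK u].

Lemma defect_avg e u : integralK u -> nondeg_at phi (fun i => red (coordK u i)) -> (e0 <= e)%N ->
  defect e u = qC^-1 ^+ n * \sum_(c : {ffun 'I_n -> residue K}) defect e.+1 (u + mkK (digits p e c)).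
Proof.
move=> Ou nd he; rewrite /defect sumrB mulrBr -!mulr_sumr [_ * (cst * _)]mulrCA -means_prod //.
congr (_ - _); rewrite mulrA; congr (_ * _).
  by rewrite volS invfM mulrA mulfV ?mul1r // expf_neq0 // invr_neq0 // qC_neq0.
have Oc (c : {ffun 'I_n -> residue K}) : integralK (u + mkK (digits p e c)).
  exact: integral_digits.
rewrite box_split // Cint_bigsetU //.
- by move=> c _; exact: box_meas.
- by move=> c _; apply: box_sub_integral; apply: scaleK_int.
- by move=> c c' x _ _; exact: box_split_disj.
Qed.

Lemma defect_small (eps : R) : 0 < eps -> exists N, forall e u, (N <= e)%N -> integralK u ->
  normc (defect e u) <= eps.
Proof.
move=> eps0; pose cn := normc cst + 1.
have cn0 : 0 < cn by rewrite ltr_wpDl // normc_ge0.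
pose d := Num.min 1 (eps / (6 * cn)).
have d0 : 0 < d by rewrite lt_min ltr01 divr_gt0 // mulr_gt0.
have [N1 hN1] := Fc (e := eps / 4) ltac:(by rewrite divr_gt0).
have [N2 hN2] := means_lim (hm ord0) d0.
have [N3 hN3] := means_lim (hm ord_max) d0.
exists (N1 + N2 + N3)%N => e u he Ou.
pose B := box (scaleK p k u) (addn_all k e); have mB : measurable B by exact: box_meas.
have sB : B `<=` OKn by apply: box_sub_integral; apply: scaleK_int.
have cl : normc (Cintegral mu B F - F (scaleK p k u) * vol e) <= 2 * (eps / 4) * normc (vol e).
  rewrite volE normc_real ger0_norm; last by rewrite exprn_ge0 // invr_ge0.
  have -> : q^-1 ^+ (\sum_i addn_all k e i) = fine (mu B) by rewrite /B (mu_box hmu hp).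
  apply: Cint_close => // x Bx; apply: hN1; [exact: scaleK_int | exact: sB |].
  by move=> i; apply: vgeW (Bx i); rewrite lez_nat /addn_all; lia.
have A1 : normc ((vol e)^-1 * Cintegral mu B F - F (scaleK p k u)) <= eps / 2.
  have -> : (vol e)^-1 * Cintegral mu B F - F (scaleK p k u) =
    (vol e)^-1 * (Cintegral mu B F - F (scaleK p k u) * vol e).
    by rewrite mulrBr mulrCA mulVf ?mulr1 // vol_neq0.
  rewrite normcM normcV mulrC ler_pdivrMr; last first.
    by rewrite lt_def normc_ge0 andbT; apply: contra_neq (vol_neq0 e) => /eq0_normc.
  by apply: le_trans cl _; apply: ler_wpM2r; [exact: normc_ge0 | lra].
have phiO i : 0 <=v (phi i).@[coordK u] by apply: intcoef_eval => //; exact: Ou.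
have A2 : normc (F (scaleK p k u) - cst * \prod_i h i e (phi i).@[coordK u]) <= eps / 2.
  rewrite FE // -mulrBr normcM !big_ord_recl !big_ord0 !mulr1.
  have E : lift ord0 ord0 = ord_max :> 'I_2 by apply: val_inj.
  rewrite !E; set a := qchar _ _ _ _; set b := qchar _ _ _ _.
  set a' := h _ _ _; set b' := h _ _ _.
  have ha : normc (a' - a) <= d by apply: hN2 => //; lia.
  have hb : normc (b' - b) <= d by apply: hN3 => //; lia.
  have a1 : normc a <= 1.
    by rewrite -[X in _ <= X](expr0 (normc (t ord0))); apply: qchar_le => //; exact: ltW.
  have b1 : normc b <= 1.
    by rewrite -[X in _ <= X](expr0 (normc (t ord_max))); apply: qchar_le => //; exact: ltW.
  have d1 : d <= 1 by rewrite ge_min lexx.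
  have b2 : normc b' <= 2.
    have := le_normcD (b' - b) b; rewrite subrK => /le_trans; apply; lra.
  clearbody a b a' b'.
  have E2 : a * b - a' * b' = a * (b - b') + (a - a') * b' by ring.
  have : normc (a * b - a' * b') <= 3 * d.
    rewrite E2; apply: le_trans (le_normcD _ _) _; rewrite !normcM [normc (b - b')]normcB [normc (a - a')]normcB.
    have x1 : normc a * normc (b' - b) <= 1 * d by apply: ler_pM; rewrite ?normc_ge0.
    have x2 : normc (a' - a) * normc b' <= d * 2 by apply: ler_pM; rewrite ?normc_ge0.
    lra.
  move=> h3; apply: (@le_trans _ _ (cn * (3 * d))).
    by apply: ler_pM; rewrite ?normc_ge0 // /cn lerDl.
  have d2 : d <= eps / (6 * cn) by rewrite ge_min lexx orbT.
  have : 6 * cn * d <= eps by move: d2; rewrite ler_pdivlMr ?mulr_gt0 // mulrC.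
  have -> : cn * (3 * d) = 6 * cn * d / 2 by field.
  by move=> d3; lra.
have := normc_triangle ((vol e)^-1 * Cintegral mu B F) (cst * \prod_i h i e (phi i).@[coordK u]) (F (scaleK p k u)).
rewrite /defect -/B => /le_trans; apply; lra.
Qed.

(** The integral over a polydisc on which the face polynomials are non-degenerate: both
    sides are averages of their values over the smaller polydiscs, and they agree in the limit. *)
Lemma local_integral e u : integralK u -> nondeg_at phi (fun i => red (coordK u i)) ->
  (e0 <= e)%N ->
  Cintegral mu (box (scaleK p k u) (addn_all k e)) F =
  vol e * cst * \prod_i h i e (phi i).@[coordK u].
Proof.
move=> Ou nd he.
suff : defect e u = 0.
  by rewrite /defect => /eqP; rewrite subr_eq0 -mulrA => /eqP <-; rewrite mulVKf // vol_neq0.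
apply: normc_small => eps eps0; have [N hN] := defect_small eps0.
(* the mean value property bounds the defect at level [e] by its supremum at level [e + m] *)
have [m hNe] : exists m, (N <= e + m)%N by exists N; rewrite leq_addl.
elim: m e u Ou nd he hNe => [|m IH] e u Ou nd he hNe.
  by apply: hN => //; rewrite addn0 in hNe.
rewrite defect_avg // normcM.
have q0 : 0 < q by exact: q_gt0.
have -> : normc (qC^-1 ^+ n) = (q ^+ n)^-1.
  rewrite normcX normcV exprVn; congr (_ ^+ _)^-1.
  by rewrite -(rmorph_nat (real_complex R)) normc_real ger0_norm.
rewrite mulrC ler_pdivrMr ?exprn_gt0 //; apply: le_trans (normc_sum _ _ _) _.
apply: (@le_trans _ _ (\sum_(c : {ffun 'I_n -> residue K}) eps)); last first.
  by rewrite sumr_const card_ffun card_ord -/(resq K) -[eps *+ _]mulr_natr natrX.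
apply: ler_sum => c _; apply: IH.
- exact: integral_digits.
- by rewrite red_digits //; apply: leq_trans he.
- exact: leqW.
- by rewrite addSnnS.
Qed.

End LocalIntegral.

(** * Newton polyhedra, initial forms and scaled polynomials *)

Section NewtonPolyhedron.
Variables (R : realType) (A : fieldType) (n : nat).
Implicit Types (k m w : multinom n) (f g h : {mpoly A[n]}).

Definition ndot k m : nat := (\sum_i k i * m i)%N.

Lemma ndotDl k k' m : ndot (mnm_add k k') m = (ndot k m + ndot k' m)%N.
Proof. by rewrite /ndot -big_split /=; apply: eq_bigr => i _; rewrite mnmDE mulnDl. Qed.

Lemma ndotDr k m m' : ndot k (mnm_add m m') = (ndot k m + ndot k m')%N.
Proof. by rewrite /ndot -big_split /=; apply: eq_bigr => i _; rewrite mnmDE mulnDr. Qed.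

(** The supporting function of the Newton polyhedron at integral points.  The initial value of the
    minimum is one of the terms, since 0 would be wrong. *)
Definition support_min k f : nat :=
  \big[minn/ndot k (head mnm0 (msupp f))]_(m <- msupp f) ndot k m.

Lemma support_min_le k f m : m \in msupp f -> (support_min k f <= ndot k m)%N.
Proof.
rewrite /support_min; elim: (msupp f) (ndot k (head _ _)) => // m' s IH x0.
rewrite in_cons big_cons geq_min => /predU1P[->|/IH ->]; first by rewrite leqnn.
by rewrite orbT.
Qed.

Lemma support_min_ex k f : f != 0 -> exists2 m, m \in msupp f & support_min k f = ndot k m.
Proof.
rewrite -msupp_eq0 /support_min; case E : (msupp f) => [//|m0 s] _ /=; rewrite -E.
have h0 : m0 \in msupp f by rewrite E mem_head.
have : {subset msupp f <= msupp f} by [].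
elim: {1 4}(msupp f) => [|m s' IH] hs; first by rewrite big_nil; exists m0.
rewrite big_cons; have [|m1 h1 ->] := IH; first by move=> x hx; apply: hs; rewrite in_cons hx orbT.
rewrite /minn; case: ifP => _; last by exists m1.
by exists m => //; apply: hs; rewrite mem_head.
Qed.

Local Notation mv := (@mvec R n).

Lemma dotv_mvec k m : dotv (mv k) (mv m) = (ndot k m)%:R.
Proof. by rewrite /dotv /ndot natr_sum; apply: eq_bigr => i _; rewrite !mxE natrM. Qed.

Lemma dotvD (x y z : 'rV[R]_n) : dotv x (y + z) = dotv x y + dotv x z.
Proof. by rewrite /dotv -big_split /=; apply: eq_bigr => i _; rewrite mxE mulrDr. Qed.

Lemma dotvZ (x y : 'rV[R]_n) c : dotv x (c *: y) = c * dotv x y.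
Proof. by rewrite /dotv mulr_sumr; apply: eq_bigr => i _; rewrite mxE mulrCA. Qed.

Lemma dotv_ge0 (x y : 'rV[R]_n) : orthant x -> orthant y -> 0 <= dotv x y.
Proof. by move=> hx hy; apply: sumr_ge0 => i _; apply: mulr_ge0. Qed.

Lemma newton_halfspace (x : 'rV[R]_n) h b : orthant x ->
  (forall m, m \in msupp h -> b <= dotv x (mv m)) ->
  newton h `<=` [set y | b <= dotv x y].
Proof.
move=> hx hb; apply: smallest_sub.
  apply/convex_setW => y z hy hz k k0 k1; move: (set_mem hy) (set_mem hz) => /= {}hy {}hz.
  apply: mem_set => /=.
  change (b <= dotv x (k%:num *: (y : 'rV[R]_n) + (1 - k%:num) *: (z : 'rV[R]_n))).
  rewrite dotvD !dotvZ.
  have k1' : 0 <= 1 - k%:num by rewrite subr_ge0 ltW.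
  apply: (@le_trans _ _ (k%:num * b + (1 - k%:num) * b)); first by lra.
  by apply: lerD; [apply: ler_wpM2l hy; exact: ltW | apply: ler_wpM2l hz].
move=> _ [m /= hm [y hy <-]] /=; rewrite dotvD; apply: le_trans (hb m hm) _.
by rewrite lerDl dotv_ge0.
Qed.

Lemma newton_mem h m (x : 'rV[R]_n) : m \in msupp h -> orthant x -> newton h (mv m + x).
Proof. by move=> hm hx B [_ hB]; apply: hB; exists m => //; exists x. Qed.

Lemma orthant0 : orthant (0 : 'rV[R]_n).
Proof. by move=> i; rewrite mxE. Qed.

Lemma newton_mvec h m : m \in msupp h -> @newton R n A h (mv m).
Proof. by move=> hm; rewrite -[mv m]addr0; apply: newton_mem => //; exact: orthant0. Qed.

Lemma orthant_mvec k : orthant (mv k).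
Proof. by move=> i; rewrite mxE ler0n. Qed.

Lemma dmin_newton k h : h != 0 -> dmin (mv k) (newton h) = (support_min k h)%:R.
Proof.
move=> h0; have [m hm e] := support_min_ex k h0.
have lb : lbound [set dotv (mv k) y | y in newton h] (support_min k h)%:R.
  move=> _ [y hy <-]; apply: (@newton_halfspace (mv k) h) hy; first exact: orthant_mvec.
  by move=> m' hm'; rewrite dotv_mvec ler_nat support_min_le.
apply/eqP; rewrite eq_le; apply/andP; split.
  rewrite e -dotv_mvec; apply: ge_inf; first by exists (support_min k h)%:R.
  by exists (mv m) => //; exact: newton_mvec.
apply: lb_le_inf => //; exists (dotv (mv k) (mv m)), (mv m) => //; exact: newton_mvec.
Qed.

Lemma face_mvec k h m : m \in msupp h ->
  `[< face (mv k) (newton h) (mv m) >] = (ndot k m == support_min k h).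
Proof.
move=> hm; have h0 : h != 0 by apply: contraTneq hm => ->; rewrite msupp0.
apply/asboolP/eqP => [[_]|e].
  by rewrite dotv_mvec dmin_newton // => /eqP; rewrite eqr_nat => /eqP.
by split; [exact: newton_mvec | rewrite dotv_mvec dmin_newton // e].
Qed.

Lemma mcoeff_face_poly k h m : (face_poly (mv k) h)@_m =
  if ndot k m == support_min k h then h@_m else 0.
Proof.
rewrite /face_poly raddf_sum /=.
rewrite (eq_bigr (fun m' => h@_m' * (m' == m)%:R)); last first.
  by move=> m' _; rewrite mcoeffZ mcoeffX.
have [hm|hm] := boolP (m \in msupp h).
  rewrite big_mkcond (bigD1_seq m) ?msupp_uniq //= face_mvec // eqxx mulr1.
  rewrite big1 ?addr0 // => m' /negbTE ->; by rewrite mulr0; case: ifP.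
rewrite big_seq_cond big1; last first.
  by move=> m' /andP[hm' _]; case: eqVneq => [e|_]; rewrite ?mulr0 //; rewrite e (negbTE hm) in hm'.
by move: hm; rewrite -mcoeff_eq0 => /eqP ->; case: ifP.
Qed.

Lemma face_poly_neq0 k h : h != 0 -> face_poly (mv k) h != 0.
Proof.
move=> h0; have [m hm e] := support_min_ex k h0.
apply/eqP => /(congr1 (fun f => f@_m)); rewrite mcoeff_face_poly e eqxx mcoeff0.
by apply/eqP; rewrite -mcoeff_msupp.
Qed.

(** The initial form of a product is the product of the initial forms, so the supporting
    function of a product is the sum of the supporting functions. *)
Lemma support_minM k f g : f != 0 -> g != 0 ->
  support_min k (f * g) = (support_min k f + support_min k g)%N.
Proof.
move=> f0 g0; have fg0 : f * g != 0 by rewrite mulf_neq0.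
apply/eqP; rewrite eqn_leq; apply/andP; split; last first.
  have [m hm ->] := support_min_ex k fg0.
  have /allpairsP[[m1 m2] /= [h1 h2 ->]] := msuppM_le hm.
  by rewrite ndotDr leq_add // support_min_le.
pose f1 := face_poly (mv k) f; pose g1 := face_poly (mv k) g.
have : f1 * g1 != 0 by rewrite mulf_neq0 // face_poly_neq0.
rewrite -msupp_eq0; case E : (msupp (f1 * g1)) => [//|m s] _.
have hm : m \in msupp (f1 * g1) by rewrite E mem_head.
have wt h x : x \in msupp (face_poly (mv k) h) -> ndot k x = support_min k h.
  by rewrite mcoeff_msupp mcoeff_face_poly; case: (eqVneq (ndot k x)) => // _; rewrite eqxx.
have wt' h x : x \in msupp (h - face_poly (mv k) h) -> (support_min k h < ndot k x)%N.
  rewrite mcoeff_msupp mcoeffB mcoeff_face_poly; case: (eqVneq (ndot k x)) => [_|ne]; first by rewrite subrr eqxx.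
  by rewrite subr0 -mcoeff_msupp => hx; rewrite ltn_neqAle eq_sym ne support_min_le.
have e : ndot k m = (support_min k f + support_min k g)%N.
  have /allpairsP[[m1 m2] /= [h1 h2 ->]] := msuppM_le hm.
  by rewrite ndotDr (wt f) // (wt g).
rewrite -e; apply: support_min_le.
(* all terms other than [f1 * g1] have weight larger than that of [m] *)
have dec : f * g = f1 * g1 + (f1 * (g - g1) + (f - f1) * g) by ring.
rewrite mcoeff_msupp dec mcoeffD [X in _ + X](_ : _ = 0) ?addr0 -?mcoeff_msupp //.
apply/eqP; rewrite mcoeff_eq0; apply/negP => /msuppD_le; rewrite mem_cat => /orP[] /msuppM_le
  /allpairsP[[m1 m2] /= [h1 h2 em]]; move: e; rewrite em ndotDr.
  by rewrite (wt f) //; have := wt' g _ h2; lia.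
by have := wt' f _ h1; have := support_min_le k h2; lia.
Qed.

End NewtonPolyhedron.

Section ScaledPolynomial.
Variables (R : realType) (K : localField) (n : nat) (p : K).
Hypothesis hp : uniformizer p.
Local Notation "m <=v x" := (vge (@nu K) m x) (at level 70).
Implicit Types (k m : multinom n) (f : {mpoly K[n]}).

(** [pi ^ - d(k) f(pi ^ k x)]; modulo [pi] it is the face polynomial of [f] at [k]. *)
Definition scaled_poly k f : {mpoly K[n]} :=
  \sum_(m <- msupp f) (f@_m * p ^+ (ndot k m - support_min k f)) *: mpolyX K m.

Lemma mcoeff_scaled k f m :
  (scaled_poly k f)@_m = f@_m * p ^+ (ndot k m - support_min k f).
Proof.
rewrite /scaled_poly raddf_sum /=.
rewrite (eq_bigr (fun m' => f@_m' * p ^+ (ndot k m' - support_min k f) * (m' == m)%:R)); last first.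
  by move=> m' _; rewrite mcoeffZ mcoeffX.
have [hm|hm] := boolP (m \in msupp f).
  by rewrite (bigD1_seq m) ?msupp_uniq //= eqxx mulr1 big1 ?addr0 // => m' /negbTE ->; rewrite mulr0.
rewrite big_seq big1; last first.
  by move=> m' hm'; case: eqVneq => [e|_]; rewrite ?mulr0 //; rewrite e (negbTE hm) in hm'.
by move: hm; rewrite -mcoeff_eq0 => /eqP ->; rewrite mul0r.
Qed.

Lemma scaled_intcoef k f : intcoef f -> intcoef (scaled_poly k f).
Proof. by move=> hf m; rewrite mcoeff_scaled; apply: vgeMl => //; exact: vge_unif0. Qed.

Lemma scaled_eval k f u :
  f.@[coordK (scaleK p k u)] = p ^+ support_min k f * (scaled_poly k f).@[coordK u].
Proof.
rewrite mevalE /scaled_poly raddf_sum /= mulr_sumr [LHS]big_seq [RHS]big_seq.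
apply: eq_bigr => m hm; rewrite mevalZ mevalX.
rewrite (eq_bigr (fun i => p ^+ (k i * m i) * coordK u i ^+ m i)); last first.
  by move=> i _; rewrite coord_scale exprMn exprM.
rewrite big_split /= -expr_sum -/(ndot k m) !mulrA; congr (_ * _).
by rewrite mulrAC -exprD subnKC ?support_min_le // mulrC.
Qed.

Lemma reduction_scaled k f : intcoef f ->
  reduction (scaled_poly k f) = reduction (face_poly (mvec R k) f).
Proof.
move=> hf; apply/mpolyP => m; rewrite !mcoeff_reduction mcoeff_scaled mcoeff_face_poly.
have [hm|] := boolP (m \in msupp f); last first.
  by rewrite -mcoeff_eq0 => /eqP ->; rewrite mul0r; case: ifP.
have := support_min_le k hm; case: (eqVneq (ndot k m)) => [-> _|ne le].
  by rewrite subnn mulr1.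
rewrite redM //; last exact: vge_unif0.
have -> : red (p ^+ (ndot k m - support_min k f)) = 0.
  apply/eqP; rewrite red_ker ?vge_unif0 //; apply: vgeW (vge_unifX hp _).
  by rewrite lez_nat subn_gt0 ltn_neqAle eq_sym ne.
by rewrite mulr0 red0.
Qed.

End ScaledPolynomial.

(** * Generators of the cones of the normal fan *)

Section ConeGeneration.
Variables (R : realType) (n : nat).
Implicit Types (x y u a : 'rV[R]_n) (cs : seq 'rV[R]_n).

Lemma dotvC x y : dotv x y = dotv y x.
Proof. by apply: eq_bigr => i _; rewrite mulrC. Qed.

Lemma dotvZl x y c : dotv (c *: x) y = c * dotv x y.
Proof. by rewrite dotvC dotvZ (dotvC y). Qed.

Lemma dotvBr x y a : dotv x (y - a) = dotv x y - dotv x a.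
Proof. by rewrite dotvD -scaleN1r dotvZ mulN1r. Qed.

Lemma dotv_delta (j : 'I_n) x : dotv (delta_mx 0 j) x = x 0 j.
Proof.
rewrite /dotv (bigD1 j) //= mxE !eqxx mul1r big1 ?addr0 // => i ij.
by rewrite mxE eqxx (negbTE ij) mul0r.
Qed.

Lemma dotv_mx x y : (x *m y^T) 0 0 = dotv x y.
Proof. by rewrite mxE; apply: eq_bigr => i _; rewrite mxE. Qed.

Definition in_cone cs x := forall a, a \in cs -> 0 <= dotv a x.
Definition tight_orth cs x u := forall a, a \in cs -> dotv a x = 0 -> dotv a u = 0.
(** [x] spans an extremal ray: the constraints tight at [x] determine it up to scaling. *)
Definition extremal cs x := forall u, tight_orth cs x u -> exists c, u = c *: x.

Lemma count_lt (T : eqType) (P Q : pred T) (s : seq T) : {in s, subpred P Q} ->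
  (exists z, [/\ z \in s, Q z & ~~ P z]) -> (count P s < count Q s)%N.
Proof.
have le r : {in r, subpred P Q} -> (count P r <= count Q r)%N.
  elim: r => // b r IH hr /=; apply: leq_add.
    by have := hr b (mem_head _ _); case: (P b) => // ->.
  by apply: IH => c cr; apply: hr; rewrite in_cons cr orbT.
elim: s => [|b s IH] hs [z [zs Qz Pz]] //=.
have hs' : {in s, subpred P Q} by move=> c cs; apply: hs; rewrite in_cons cs orbT.
move: zs; rewrite in_cons => /predU1P[zb|zs].
  by rewrite -zb Qz (negbTE Pz) add0n add1n ltnS le.
rewrite -addnS; apply: leq_add; last by apply: IH => //; exists z.
by have := hs b (mem_head _ _); case: (P b) => // ->.
Qed.

Lemma seq_argmin (T : eqType) (r : T -> R) (s : seq T) : s != [::] ->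
  exists2 z, z \in s & forall z', z' \in s -> r z <= r z'.
Proof.
elim: s => // b [|b' s] IH _; first by exists b; rewrite ?mem_head // => z'; rewrite inE => /eqP ->.
have [//|z zs hz] := IH; case: (leP (r b) (r z)) => h.
  exists b; rewrite ?mem_head // => z'; rewrite in_cons => /predU1P[->//|/hz]; exact: le_trans.
exists z; first by rewrite in_cons zs orbT.
by move=> z'; rewrite in_cons => /predU1P[->|/hz//]; exact: ltW.
Qed.

(** The step [t] is the least of the finitely many ratios at which another constraint vanishes;
    the tight ones do not vary along [u]. *)
Lemma hit_constraint cs x u : in_cone cs x -> tight_orth cs x u ->
  (exists2 a, a \in cs & dotv a u < 0) ->
  exists t, [/\ 0 < t, in_cone cs (x + t *: u) &
    (count (fun a => dotv a (x + t *: u) != 0%R) cs < count (fun a => dotv a x != 0%R) cs)%N].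
Proof.
move=> hx hu [a0 a0c a0n].
have ne : [seq a <- cs | dotv a u < 0] != [::].
  apply/eqP => e; suff : a0 \in [seq a <- cs | dotv a u < 0] by rewrite e.
  by rewrite mem_filter a0n.
have [a1] := seq_argmin (fun a => dotv a x / - dotv a u) ne.
rewrite mem_filter => /andP[a1n a1c] hmin; pose t := dotv a1 x / - dotv a1 u.
have a1x : 0 < dotv a1 x.
  rewrite lt_def hx // andbT; apply: contraTneq a1n => /(hu _ a1c) ->.
  by rewrite ltxx.
exists t; split; first by rewrite divr_gt0 // oppr_gt0.
  move=> a ac; rewrite dotvD dotvZ; case: (ltP (dotv a u) 0) => an.
    have := hmin a; rewrite mem_filter an ac => /(_ isT).
    by rewrite -/t ler_pdivlMr ?oppr_gt0 // mulrN; lra.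
  rewrite addr_ge0 ?hx // mulr_ge0 // /t; apply: divr_ge0; first exact: ltW.
  by rewrite oppr_ge0 ltW.
apply: count_lt.
  move=> a ac /=; apply: contra_neq => e; rewrite dotvD dotvZ e (hu _ ac e).
  by rewrite mulr0 addr0.
exists a1; split=> //; first by rewrite gt_eqF.
rewrite negbK dotvD dotvZ /t; apply/eqP.
have : dotv a1 u != 0 by rewrite lt_eqF.
by move=> z; field.
Qed.

(** If [x] is not extremal, it can be moved in two opposite directions orthogonal to its tight
    constraints until further constraints become tight, and [x] is a combination of the two end
    points.  Both motions stop because the direction has coordinate sum 0, hence leaves the orthant
    on either side. *)
Lemma cone_induction cs (Q : 'rV[R]_n -> Prop) :
  (forall j, delta_mx 0 j \in cs) -> Q 0 ->
  (forall x y, Q x -> Q y -> Q (x + y)) -> (forall c x, 0 <= c -> Q x -> Q (c *: x)) ->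
  (forall x, x != 0 -> in_cone cs x -> extremal cs x -> Q x) ->
  forall x, in_cone cs x -> Q x.
Proof.
move=> csd Q0 QD QZ Qe x.
have [N] := ubnP (count (fun a => dotv a x != 0) cs).
elim: N x => // N IH x; rewrite ltnS => hN hx.
have [->//|x0] := eqVneq x 0.
have [he|he] := pselect (extremal cs x); first exact: Qe.
(* [v] is [u] corrected by a multiple of [x] to have coordinate sum 0 *)
have [u hu un] : exists2 u, tight_orth cs x u & forall c, u <> c *: x.
  apply: contrapT => h; apply: he => u hu; apply: contrapT => hn; apply: h.
  by exists u => // c e; apply: hn; exists c.
have xge i : 0 <= x 0 i by rewrite -dotv_delta; apply: hx.
have sx : 0 < \sum_i x 0 i.
  rewrite lt_def sumr_ge0 // andbT; apply: contra_neq x0 => /eqP.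
  rewrite psumr_eq0 // => /allP h; apply/rowP => i; rewrite mxE.
  by apply/eqP; apply: h; rewrite mem_index_enum.
pose v := u - ((\sum_i u 0 i) / (\sum_i x 0 i)) *: x.
have hv : tight_orth cs x v.
  by move=> a ac e; rewrite dotvBr dotvZ e mulr0 (hu _ ac e) subr0.
have sv : \sum_i v 0 i = 0.
  rewrite (eq_bigr (fun i => u 0 i - (\sum_i u 0 i) / (\sum_i x 0 i) * x 0 i)); last first.
    by move=> i _; rewrite !mxE.
  by rewrite sumrB -mulr_sumr divfK ?subrr // gt_eqF.
have v0 : v != 0 by apply/eqP => /eqP; rewrite subr_eq0 => /eqP; exact: un.
have neg (z : 'rV[R]_n) : z != 0 -> \sum_i z 0 i = 0 -> exists2 a, a \in cs & dotv a z < 0.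
  move=> z0 sz; apply: contrapT => h.
  have zge i : 0 <= z 0 i.
    rewrite leNgt; apply/negP => zi; apply: h; exists (delta_mx 0 i) => //.
    by rewrite dotv_delta.
  move/negP: z0; apply; apply/eqP/rowP => i; rewrite mxE; apply/eqP.
  by move/eqP: sz; rewrite psumr_eq0 // => /allP; apply; rewrite mem_index_enum.
have [t1 [t10 c1 n1]] := hit_constraint hx hv (neg v v0 sv).
have hv' : tight_orth cs x (- v).
  by move=> a ac e; rewrite -scaleN1r dotvZ (hv _ ac e) mulr0.
have sv' : \sum_i (- v) 0 i = 0.
  by rewrite (eq_bigr (fun i => - v 0 i)) => [|i _]; rewrite ?mxE // sumrN sv oppr0.
have [t2 [t20 c2 n2]] := hit_constraint hx hv' (neg (- v) ltac:(by rewrite oppr_eq0) sv').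
have Q1 := IH _ (leq_trans n1 hN) c1; have Q2 := IH _ (leq_trans n2 hN) c2.
have -> : x = (t2 / (t1 + t2)) *: (x + t1 *: v) + (t1 / (t1 + t2)) *: (x + t2 *: - v).
  clearbody v; apply/rowP => i; rewrite !mxE.
  have tn : t1 + t2 != 0 by rewrite gt_eqF // addr_gt0.
  by field; exact: tn.
by apply: QD; apply: QZ => //; rewrite divr_ge0 // ltW // addr_gt0.
Qed.

Lemma mem_row_span (V : {vspace 'rV[R]_n}) y :
  (y \in V) = (y <= \matrix_(i < \dim V) (vbasis V)`_i)%MS.
Proof.
apply/idP/submxP => [yV|[D ->]].
  exists (\row_i coord (vbasis V) i y); rewrite {1}(coord_vbasis yV) mulmx_sum_row.
  by apply: eq_bigr => i _; rewrite rowK mxE.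
rewrite mulmx_sum_row memv_suml // => i _; rewrite rowK memvZ //.
by apply: vbasis_mem; rewrite mem_nth // size_tuple.
Qed.

Lemma hyperplane_dim x : x != 0 ->
  exists U : {vspace 'rV[R]_n}, \dim U = n.-1 /\ forall y, (y \in U) = (dotv x y == 0).
Proof.
move=> x0; pose f : 'rV[R]_n -> 'rV[R]_1 := mulmxr x^T.
have fE y : f y = (dotv x y)%:M.
  by apply/rowP => i; rewrite /f /= !ord1 dotv_mx dotvC mxE eqxx.
pose L := linfun (mulmxr x^T : {linear 'rV[R]_n -> 'rV[R]_1}).
have LE z : L z = (dotv x z)%:M by rewrite lfunE; exact: fE.
exists (lker L); split; last first.
  move=> y; rewrite memv_ker LE.
  apply/eqP/eqP => [/rowP/(_ 0)|->]; last by rewrite raddf0.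
  by rewrite !mxE eqxx.
have := limg_ker_dim L fullv; rewrite capfv dimvf /dim /= mul1n.
suff -> : \dim (limg L) = 1%N by rewrite addn1 => /(congr1 predn).
apply/eqP; rewrite eqn_leq; apply/andP; split.
  by apply: leq_trans (dimvS (subvf _)) _; rewrite dimvf /dim /= muln1.
rewrite lt0n dimv_eq0; apply/eqP => h.
have : L x \in limg L by apply: memv_img; exact: memvf.
rewrite h memv0 LE => /eqP /rowP/(_ 0); rewrite !mxE eqxx mulr1n => /eqP.
rewrite /dotv psumr_eq0 => [|i _]; last by rewrite -expr2 sqr_ge0.
move=> /allP hx; move/negP: x0; apply; apply/eqP/rowP => i; rewrite mxE.
by have := hx i (mem_index_enum i); rewrite /= mulf_eq0 orbb => /eqP.
Qed.

End ConeGeneration.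

Section NormalFan.
Variables (R : realType) (A : fieldType) (n : nat) (h : {mpoly A[n]}).
Variables (l : nat) (gamma : 'I_l -> set 'rV[R]_n) (w : 'I_l -> multinom n).
Hypothesis gammaE : range gamma = [set t | is_facet (newton h) t].
Hypothesis wP : forall i, primitive (w i) /\ perpendicular (mvec R (w i)) (gamma i).
Local Notation mv := (@mvec R n).

Lemma primitive_neq0 (v : multinom n) : primitive v -> exists j, v j != 0%N.
Proof.
move=> pv; apply: contrapT => /forallNP hn; move: pv; rewrite /primitive big1 // => i _.
by apply/eqP; apply: contrapT => /negP; exact: hn.
Qed.

(** Inequalities defining the cone of the normal fan attached to the exponent [m0]. *)
Definition fan_constraints (m0 : multinom n) : seq 'rV[R]_n :=
  [seq delta_mx 0 j | j <- index_enum 'I_n] ++ [seq mv m - mv m0 | m <- msupp h].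

(** The face of the polyhedron cut out by an extremal [x] contains, up to translation, all tight
    constraints.  Their orthogonal is the line of [x], so the face is a facet, and the normal vector
    of that facet is proportional to [x]. *)
Lemma extremal_normal m0 x : m0 \in msupp h -> x != 0 ->
  in_cone (fan_constraints m0) x -> extremal (fan_constraints m0) x ->
  exists i c, [/\ 0 < c, x = c *: mv (w i) & support_min (w i) h = ndot (w i) m0].
Proof.
move=> hm0 x0 hx ex.
have xge j : 0 <= x 0 j.
  by rewrite -dotv_delta; apply: hx; rewrite mem_cat map_f ?mem_index_enum.
have mge m : m \in msupp h -> dotv x (mv m0) <= dotv x (mv m).
  move=> hm; rewrite -subr_ge0 -dotvBr dotvC; apply: hx.
  by rewrite mem_cat orbC; apply/orP; left; exact: map_f.
pose t := newton h `&` [set y | dotv x y = dotv x (mv m0)].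
have m0t : t (mv m0) by split => //; exact: newton_mvec.
(* differences of points of the face contain the tight constraints *)
have tightd a : a \in fan_constraints m0 -> dotv a x = 0 -> exists2 y, t y & a = y - mv m0.
  rewrite mem_cat => /orP[/mapP[j _ ->]|/mapP[m hm ->]] e.
    exists (mv m0 + delta_mx 0 j); last by rewrite addrAC subrr add0r.
    split; first by apply: newton_mem => // i; rewrite mxE ler0n.
    by rewrite /= dotvD [dotv x (delta_mx _ _)]dotvC e addr0.
  exists (mv m) => //; split; first exact: newton_mvec.
  by apply/eqP; rewrite -subr_eq0 -dotvBr dotvC e.
have ft : is_facet (newton h) t.
  split.
    exists x, (dotv x (mv m0)); split => //; last by exists (mv m0).
    exact: newton_halfspace.
  have [U [dU hU]] := hyperplane_dim x0; exists U; split => //.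
    by move=> y z [_ /= ey] [_ /= ez]; rewrite hU dotvBr ey ez subrr.
  move=> V hV; apply/subvP => y; rewrite hU mem_row_span => /eqP xy.
  set M := \matrix_i _; rewrite submxE; apply/eqP/rowP => j.
  pose v := (col j (cokermx M))^T.
  have vE z : (z *m cokermx M) 0 j = dotv z v.
    by rewrite mxE; apply: eq_bigr => i _; rewrite !mxE.
  have [c vc] : exists c, v = c *: x.
    apply: ex => a ac /(tightd _ ac)[z tz ->]; rewrite -vE.
    have := hV _ _ m0t tz; rewrite mem_row_span submxE => /eqP ->.
    by rewrite mxE.
  by rewrite vE vc dotvZ [dotv y x]dotvC xy mulr0 mxE.
have : range gamma t by rewrite gammaE.
case=> i _ gi; have [pi perp] := wP i; rewrite gi in perp.
have [c wc] : exists c, mv (w i) = c *: x.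
  by apply: ex => a ac /(tightd _ ac)[z tz ->]; rewrite dotvC; exact: perp.
have [j wj] := primitive_neq0 pi.
have wjE : (w i j)%:R = c * x 0 j :> R by have /rowP/(_ j) := wc; rewrite !mxE.
have cp : 0 < c * x 0 j by rewrite -wjE ltr0n lt0n.
have xj : 0 < x 0 j by rewrite lt_def xge andbT; apply: contraTneq cp => ->; rewrite mulr0 ltxx.
have c0 : 0 < c by rewrite -(pmulr_lgt0 _ xj).
exists i, c^-1; split; first by rewrite invr_gt0.
  by rewrite wc scalerA mulVf ?scale1r // gt_eqF.
apply/eqP; rewrite eqn_leq support_min_le //=.
have h0 : h != 0 by apply: contraTneq hm0 => ->; rewrite msupp0.
have [m hm ->] := support_min_ex (w i) h0.
by rewrite -(ler_nat R) -!(dotv_mvec R) wc !dotvZl ler_pM2l // mge.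
Qed.

(** Combines [cone_induction] with [extremal_normal]; no triangulation of the cone is involved. *)
Lemma fan_cone_generated m0 (k : multinom n) : m0 \in msupp h ->
  support_min k h = ndot k m0 ->
  exists c : 'I_l -> R, [/\ forall i, 0 <= c i,
     forall i, c i != 0 -> support_min (w i) h = ndot (w i) m0 &
     mv k = \sum_i c i *: mv (w i)].
Proof.
move=> hm0 hk.
pose Q (x : 'rV[R]_n) := exists c : 'I_l -> R, [/\ forall i, 0 <= c i,
     forall i, c i != 0 -> support_min (w i) h = ndot (w i) m0 &
     x = \sum_i c i *: mv (w i)].
suff : forall x, in_cone (fan_constraints m0) x -> Q x.
  apply=> a; rewrite mem_cat => /orP[/mapP[j _ ->]|/mapP[m hm ->]].
    by rewrite dotv_delta mxE ler0n.
  by rewrite dotvC dotvBr !dotv_mvec subr_ge0 ler_nat -hk support_min_le.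
apply: cone_induction.
- by move=> j; rewrite mem_cat map_f ?mem_index_enum.
- exists (fun=> 0); split => //; first by move=> i; rewrite eqxx.
  by rewrite big1 // => i _; rewrite scale0r.
- move=> _ _ [c [c0 c1 ->]] [d [d0 d1 ->]]; exists (fun i => c i + d i); split.
  + by move=> i; rewrite addr_ge0.
  + move=> i; have [ci|] := eqVneq (c i) 0; last by move=> /c1.
    by rewrite ci add0r => /d1.
  + by rewrite -big_split /=; apply: eq_bigr => i _; rewrite scalerDl.
- move=> a _ a0 [c [c0 c1 ->]]; exists (fun i => a * c i); split.
  + by move=> i; rewrite mulr_ge0.
  + by move=> i; rewrite mulf_eq0 negb_or => /andP[_ /c1].
  + by rewrite scaler_sumr; apply: eq_bigr => i _; rewrite scalerA.
move=> x x0 hx ex; have [i [c [c0 -> wi]]] := extremal_normal hm0 x0 hx ex.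
exists (fun j => if j == i then c else 0); split.
- by move=> j; case: ifP => // _; exact: ltW.
- by move=> j; case: (eqVneq j i) => [-> _|_]; [exact: wi | rewrite eqxx].
- by rewrite (bigD1 i) //= eqxx big1 ?addr0 // => j /negbTE ->; rewrite scale0r.
Qed.

End NormalFan.

(** * Dickson's lemma and truncated geometric sums *)

Section Dickson.

(** Induction on the number of coordinates.  The slices of [U] at a fixed last coordinate [c]
    increase with [c]; their union is decided by truncations at [Ti], which are finite in number, so
    the slices are constant for [c >= c0]. *)
Lemma dickson_fun (l : nat) (U : (nat -> nat) -> Prop) :
  (forall v v', (forall i, v i <= v' i)%N -> U v -> U v') ->
  exists T, forall v, (forall i, (l <= i)%N -> v i = 0%N) -> U v ->
    U (fun i => minn (v i) T).
Proof.
elim: l U => [|l IH] U up.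
  exists 0%N => v v0; apply: up => i; by rewrite v0.
pose set v c : nat -> nat := fun i => if i == l then c else v i.
have upc c v v' : (forall i, v i <= v' i)%N -> U (set v c) -> U (set v' c).
  by move=> le; apply: up => i; rewrite /set; case: ifP.
have [Tc hTc] := choice (fun c => IH (fun v => U (set v c)) (@upc c)).
have [Ti hTi] := IH (fun v => exists c, U (set v c))
  (fun v v' le => fun '(ex_intro c h) => ex_intro _ c (upc c v v' le h)).
pose tau (f : {ffun 'I_l -> 'I_Ti.+1}) : nat -> nat :=
  fun i => if insub i is Some j then nat_of_ord (f j) else 0%N.
have hex (f : {ffun 'I_l -> 'I_Ti.+1}) : exists c,
    (exists c', U (set (tau f) c')) -> U (set (tau f) c).
  have [[c hc]|hn] := pselect (exists c, U (set (tau f) c)); first by exists c.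
  by exists 0%N => /hn.
have [cf hcf] := choice hex.
pose c0 := (\max_f cf f)%N.
pose T := maxn (maxn Ti c0) (\max_(c < c0) Tc c).
exists T => v v0 Uv; pose v' := set v 0%N.
have v'0 i : (l <= i)%N -> v' i = 0%N.
  by rewrite /v' /set; case: eqVneq => // ne li; apply: v0; rewrite ltn_neqAle eq_sym ne.
have vE : U (set v' (v l)) by apply: up Uv => i; rewrite /v' /set; case: eqVneq => [->|].
case: (ltnP (v l) c0) => lc.
  apply: up (hTc _ _ v'0 vE) => i; rewrite /set /v' /set; case: eqVneq => [->|_].
    by rewrite leq_min leqnn /T !leq_max (ltnW lc) orbT.
  rewrite leq_min geq_minl /=; apply: leq_trans (geq_minr _ _) _.
  by rewrite /T leq_max; apply/orP; right; rewrite (@leq_bigmax _ (fun c : 'I_c0 => Tc c) (Ordinal lc)).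
have := hTi _ v'0 (ex_intro _ _ vE).
pose f : {ffun 'I_l -> 'I_Ti.+1} := [ffun i : 'I_l => inord (minn (v' i) Ti)].
have tE : (fun i => minn (v' i) Ti) = tau f.
  apply/funext => i; rewrite /tau; case: insubP => [j _ <-|].
    by rewrite ffunE inordK // ltnS geq_minr.
  by rewrite -leqNgt => /v'0 ->; rewrite min0n.
rewrite tE => /hcf; apply: up => i; rewrite /set -tE; case: eqVneq => [->|ne].
  rewrite leq_min; have : (cf f <= c0)%N by rewrite /c0 (@leq_bigmax _ cf f).
  by rewrite /T; move: lc; lia.
rewrite /v' /set (negbTE ne) leq_min geq_minl /=; apply: leq_trans (geq_minr _ _) _.
by rewrite /T !leq_max leqnn.
Qed.

Definition mkmnm l (E : 'I_l -> nat) : multinom l := Multinom [tuple E i | i < l].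

Lemma mkmnmE l (E : 'I_l -> nat) i : mkmnm E i = E i.
Proof. exact: mnmE. Qed.

Definition truncm l (T : nat) (v : multinom l) : multinom l := mkmnm (fun i => minn (v i) T).

Lemma truncmE l T (v : multinom l) i : truncm T v i = minn (v i) T.
Proof. exact: mkmnmE. Qed.

(** An upward closed set has finitely many minimal elements; a level exceeding their coordinates
    decides membership. *)
Lemma dickson l (U : multinom l -> Prop) :
  (forall v u, U v -> U (mnm_add v u)) ->
  exists T0, forall T v, (T0 <= T)%N -> (U v <-> U (truncm T v)).
Proof.
move=> up.
pose V (x : nat -> nat) := U (mkmnm (fun i : 'I_l => x i)).
have up' (v v' : multinom l) : (forall i, v i <= v' i)%N -> U v -> U v'.
  move=> le /(@up _ (mnm_sub v' v)); congr U; apply/mnmP => i.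
  by rewrite mnmDE mnmBE subnKC.
have [|T hT] := @dickson_fun l V.
  by move=> v v' le; apply: up' => i; rewrite !mkmnmE.
exists T => T' v le; split; last by apply: up' => i; rewrite truncmE geq_minl.
pose x i := if insub i is Some j then v (j : 'I_l) else 0%N.
have xE (i : 'I_l) : x i = v i by rewrite /x valK.
move=> Uv; have := hT x; have x0 i : (l <= i)%N -> x i = 0%N.
  by rewrite /x; case: insubP => // j; rewrite ltnNge => /negbTE ->.
move=> /(_ x0); have Vx : V x by rewrite /V; congr U: Uv; apply/mnmP => i; rewrite mkmnmE xE.
move=> /(_ Vx); apply: up' => i; rewrite mkmnmE truncmE xE leq_min geq_minl /=.
by apply: leq_trans (geq_minr _ _) _.
Qed.

End Dickson.

Section TruncatedSums.
Variables (R : realType) (l : nat) (T : nat).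
Local Notation C := (complex R).
Variables (X : 'I_l -> C) (b : multinom l -> C).
Hypothesis X1 : forall i, normc (X i) < 1.
Hypothesis bT : forall v, b v = b (truncm T v) * \prod_i X i ^+ (v i - T).

Definition mnm_ord N (f : {ffun 'I_l -> 'I_N}) : multinom l := mkmnm (fun i => f i).

(** The factors [1 - X i] that are not consumed by a geometric series in the direction [i]. *)
Definition corner (f : {ffun 'I_l -> 'I_T.+1}) i : C := if (f i < T)%N then 1 - X i else 1.

Lemma one_dim_sum (x : C) (N : nat) (j : 'I_T.+1) : (T <= N)%N ->
  (1 - x) * \sum_(c < N | minn c T == j) x ^+ (c - T) =
  if (j < T)%N then 1 - x else 1 - x ^+ (N - T).
Proof.
move=> TN; case: ltnP => jT.
  rewrite (big_pred1 (Ordinal (leq_trans jT TN))) /=.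
    by rewrite (_ : (j - T = 0)%N) ?expr0 ?mulr1 //; lia.
  by move=> c; rewrite [RHS]inE -[RHS]val_eqE /=; apply/eqP/eqP; lia.
have -> : \sum_(c < N | minn c T == j) x ^+ (c - T) = \sum_(c < N - T) x ^+ c.
  rewrite -(big_mkord (fun c => minn c T == j) (fun c => x ^+ (c - T))).
  rewrite (big_cat_nat (leq0n T) TN) /= [X in X + _]big_nat_cond big1 ?add0r; last first.
    by move=> c /andP[/andP[_ cT] /eqP]; lia.
  rewrite -{1}[T]add0n big_addn big_mkord; apply: eq_big => c; first by apply/eqP; have := ltn_ord j; lia.
  by rewrite addnK.
by rewrite -[1 - x]opprB mulNr -subrX1 opprB.
Qed.

(** Summing over the fibres of the truncation splits the sum into products of one-dimensional
    geometric sums. *)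
Lemma truncated_sum_exact N : (T <= N)%N ->
  \prod_i (1 - X i) * \sum_(f : {ffun 'I_l -> 'I_N}) b (mnm_ord f) =
  \sum_(f : {ffun 'I_l -> 'I_T.+1}) b (mnm_ord f) *
     \prod_i (if (f i < T)%N then 1 - X i else 1 - X i ^+ (N - T)).
Proof.
move=> TN.
pose tr (f : {ffun 'I_l -> 'I_N}) : {ffun 'I_l -> 'I_T.+1} := [ffun i => inord (minn (f i) T)].
have trE f i : tr f i = minn (f i) T :> nat by rewrite ffunE inordK // ltnS geq_minr.
rewrite (partition_big tr xpredT) //= mulr_sumr; apply: eq_bigr => g _.
rewrite (eq_bigr (fun f : {ffun 'I_l -> 'I_N} => b (mnm_ord g) * \prod_i X i ^+ (f i - T))); last first.
  move=> f /eqP e; rewrite bT; congr (b _ * _).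
    by apply/mnmP => i; rewrite truncmE !mkmnmE -e trE.
  by apply: eq_bigr => i _; rewrite mkmnmE.
rewrite -mulr_sumr mulrCA; congr (_ * _).
rewrite (eq_bigl (fun f : {ffun 'I_l -> 'I_N} => f \in family (fun i => [pred c : 'I_N | minn c T == g i]))); last first.
  move=> f; apply/eqP/familyP => [<- i|h].
    by rewrite inE /= trE.
  by apply/ffunP => i; apply: val_inj; rewrite /= trE; have := h i; rewrite inE /= => /eqP.
rewrite -(bigA_distr_big_dep (fun i => [pred c : 'I_N | minn c T == g i]) (fun i (c : 'I_N) => X i ^+ (c - T))) /=.
rewrite -big_split /=; apply: eq_bigr => i _; exact: one_dim_sum.
Qed.

Lemma prod_close (y z : 'I_l -> C) (d : R) : (forall i, normc (y i) <= 2) ->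
  (forall i, normc (z i) <= 2) -> (forall i, normc (y i - z i) <= d) ->
  forall r : seq 'I_l, normc (\prod_(i <- r) y i) <= 2 ^+ size r /\
     normc (\prod_(i <- r) y i - \prod_(i <- r) z i) <= (size r)%:R * 2 ^+ size r * d.
Proof.
move=> hy hz hd; elim=> [|i r [IH1 IH2]].
  by rewrite !big_nil subrr normc0 normc1 expr0 !mul0r.
rewrite !big_cons /=; set Y := \prod_(j <- r) y j in IH1 IH2 *; set Z := \prod_(j <- r) z j in IH2 *.
have d0 : 0 <= d by apply: le_trans (hd i); exact: normc_ge0.
split; first by rewrite normcM exprS; apply: ler_pM; rewrite ?normc_ge0.
have -> : y i * Y - z i * Z = (y i - z i) * Y + z i * (Y - Z) by ring.
apply: le_trans (le_normcD _ _) _; rewrite !normcM.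
have x1 : normc (y i - z i) * normc Y <= d * 2 ^+ size r by apply: ler_pM; rewrite ?normc_ge0.
have x2 : normc (z i) * normc (Y - Z) <= 2 * ((size r)%:R * 2 ^+ size r * d).
  by apply: ler_pM; rewrite ?normc_ge0.
rewrite exprS -natr1; have p0 : 0 <= (2 : R) ^+ size r * d by rewrite mulr_ge0 // exprn_ge0.
by move: x1 x2 p0; move: (2 ^+ size r) => W; nra.
Qed.

(** Multiplied by [prod (1 - X i)], the multiple geometric series converges to a finite sum
    over the truncated exponents. *)
Lemma truncated_sum_lim (eps : R) : 0 < eps -> exists N0, forall N, (N0 <= N)%N ->
  normc (\prod_i (1 - X i) * \sum_(f : {ffun 'I_l -> 'I_N}) b (mnm_ord f) -
    \sum_(f : {ffun 'I_l -> 'I_T.+1}) b (mnm_ord f) * \prod_i corner f i) <= eps.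
Proof.
move=> eps0.
pose S := \sum_(f : {ffun 'I_l -> 'I_T.+1}) normc (b (mnm_ord f)).
have S0 : 0 <= S by apply: sumr_ge0 => f _; exact: normc_ge0.
pose D : R := (S + 1) * (l%:R * 2 ^+ l + 1).
have D0 : 0 < D.
  by apply: mulr_gt0; rewrite ltr_wpDl // mulr_ge0 // exprn_ge0.
have [N1 hN1] : exists N1, forall i m, (N1 <= m)%N -> normc (X i) ^+ m <= eps / D.
  have ed : 0 < eps / D by rewrite divr_gt0.
  have [Ni hNi] := choice (fun i => expr_small (normc_ge0 (X i)) (X1 i) ed).
  exists (\max_i Ni i)%N => i m hm; apply: hNi; apply: leq_trans hm.
  exact: (@leq_bigmax _ Ni i).
exists (N1 + T)%N => N hN; rewrite truncated_sum_exact; last by lia.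
rewrite -sumrB; apply: le_trans (normc_sum _ _ _) _.
have one (x : C) m : normc x < 1 -> normc (1 - x ^+ m) <= 2.
  move=> x1; apply: le_trans (le_normcD _ _) _; rewrite normc1 normcN normcX.
  have : normc x ^+ m <= 1 by apply: exprn_ile1; [exact: normc_ge0 | exact: ltW].
  lra.
apply: (@le_trans _ _ (\sum_(f : {ffun 'I_l -> 'I_T.+1})
   normc (b (mnm_ord f)) * (l%:R * 2 ^+ l * (eps / D)))).
  apply: ler_sum => f _; rewrite -mulrBr normcM; apply: ler_wpM2l; first exact: normc_ge0.
  have [||| _] := @prod_close (fun i => if (f i < T)%N then 1 - X i else 1 - X i ^+ (N - T))
    (fun i => corner f i) (eps / D) _ _ _ (index_enum 'I_l).
  - by move=> i; case: ifP => _; [rewrite -[X i]expr1; apply: one | apply: one].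
  - move=> i; rewrite /corner; case: ifP => _; first by rewrite -[X i]expr1; apply: one.
    by rewrite normc1; lra.
  - move=> i; rewrite /corner; case: ifP => _; first by rewrite subrr normc0 divr_ge0 // ltW.
    by rewrite addrAC subrr add0r normcN normcX; apply: hN1; lia.
  have -> : size (index_enum 'I_l) = l by rewrite -[RHS]card_ord cardT enumT.
  by [].
rewrite -mulr_suml -/S; apply: (@le_trans _ _ (D * (eps / D))); last first.
  by rewrite mulrC divfK // gt_eqF.
rewrite [leLHS]mulrA; apply: ler_wpM2r; first by rewrite divr_ge0 // ltW.
by rewrite /D; apply: ler_pM => //; rewrite ?mulr_ge0 ?exprn_ge0 // lerDl.
Qed.

End TruncatedSums.

(** * Lattice points of the normal fan *)

Section LatticePoints.
Variables (R : realType) (A : fieldType) (n : nat) (h : {mpoly A[n]}).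
Variables (l : nat) (w : 'I_l -> multinom n).
Hypothesis h0 : h != 0.
Implicit Types (k m r : multinom n) (v u : multinom l) (phi : {mpoly A[n]}).

(** Membership in the cone of the normal fan dual to [m]. *)
Definition in_fan m k : bool := support_min k h == ndot k m.

Hypothesis fan_gen : forall m0 k, m0 \in msupp h -> in_fan m0 k ->
  exists c : 'I_l -> R, [/\ forall i, 0 <= c i,
     forall i, c i != 0 -> in_fan m0 (w i) &
     mvec R k = \sum_i c i *: mvec R (w i)].

Lemma mnm_addA k k' k'' : mnm_add k (mnm_add k' k'') = mnm_add (mnm_add k k') k''.
Proof. by apply/mnmP => i; rewrite !mnmDE addnA. Qed.

Lemma support_min_super k k' phi : phi != 0 ->
  (support_min k phi + support_min k' phi <= support_min (mnm_add k k') phi)%N.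
Proof.
move=> p0; have [m hm ->] := support_min_ex (mnm_add k k') p0.
by rewrite ndotDl leq_add // support_min_le.
Qed.

Lemma in_fanD m k k' : m \in msupp h -> in_fan m k -> in_fan m k' -> in_fan m (mnm_add k k').
Proof.
move=> hm /eqP e /eqP e'; rewrite /in_fan eqn_leq support_min_le //= ndotDl -e -e'.
exact: support_min_super.
Qed.

Lemma ndot0 m : ndot (mnm0 : multinom n) m = 0%N.
Proof. by rewrite /ndot big1 // => i _; rewrite mnm0E. Qed.

Lemma support_min0 phi : phi != 0 -> support_min (mnm0 : multinom n) phi = 0%N.
Proof. by move=> p0; have [m _ ->] := support_min_ex mnm0 p0; rewrite ndot0. Qed.

Lemma in_fan0 m : in_fan m mnm0.
Proof. by rewrite /in_fan support_min0 // ndot0. Qed.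

(** The supporting functions of both factors of [h] are linear on the cones of the fan of [h]. *)
Lemma support_minD phi psi m k k' : phi != 0 -> psi != 0 -> h = phi * psi ->
  m \in msupp h -> in_fan m k -> in_fan m k' ->
  support_min (mnm_add k k') phi = (support_min k phi + support_min k' phi)%N.
Proof.
move=> p0 q0 hE hm e e'; have /eqP := in_fanD hm e e'; move/eqP: e; move/eqP: e'.
rewrite ndotDl hE !support_minM //.
have := support_min_super k k' p0; have := support_min_super k k' q0.
lia.
Qed.

Section Cone.
Variable m0 : multinom n.
Hypothesis hm0 : m0 \in msupp h.

(** Vectors outside the cone are replaced by 0 rather than removed, so that all cones are
    parametrized by exponents with the same index set. *)
Definition gens i : multinom n := if in_fan m0 (w i) then w i else mnm0.

Definition comb v : multinom n := mkmnm (fun j => \sum_i v i * gens i j)%N.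

Lemma in_fan_gens i : in_fan m0 (gens i).
Proof. by rewrite /gens; case: ifP => // _; exact: in_fan0. Qed.

Lemma combD v u : comb (mnm_add v u) = mnm_add (comb v) (comb u).
Proof.
apply/mnmP => j; rewrite mnmDE !mkmnmE -big_split /=; apply: eq_bigr => i _.
by rewrite mnmDE mulnDl.
Qed.

Lemma additive_comb (D : multinom n -> nat) v r : D mnm0 = 0%N ->
  (forall k k', in_fan m0 k -> in_fan m0 k' -> D (mnm_add k k') = (D k + D k')%N) ->
  in_fan m0 r ->
  in_fan m0 (mnm_add r (comb v)) /\
  D (mnm_add r (comb v)) = (D r + \sum_i v i * D (gens i))%N.
Proof.
move=> D0 DD hr.
have mul i a : in_fan m0 (mkmnm (fun j => a * gens i j)%N) /\
    D (mkmnm (fun j => a * gens i j)%N) = (a * D (gens i))%N.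
  elim: a => [|a [IH1 IH2]].
    rewrite (_ : mkmnm _ = mnm0); first by rewrite in_fan0 D0 mul0n.
    by apply/mnmP => j; rewrite [LHS]mkmnmE [RHS]mnm0E.
  rewrite (_ : mkmnm _ = mnm_add (gens i) (mkmnm (fun j => a * gens i j)%N)).
    split; first by apply: in_fanD => //; exact: in_fan_gens.
    by rewrite DD ?IH2 ?mulSn //; exact: in_fan_gens.
  by apply/mnmP => j; rewrite mnmDE !mkmnmE mulSn.
have sum (s : seq 'I_l) : in_fan m0 (mkmnm (fun j => \sum_(i <- s) v i * gens i j)%N) /\
    D (mkmnm (fun j => \sum_(i <- s) v i * gens i j)%N) = (\sum_(i <- s) v i * D (gens i))%N.
  elim: s => [|i s [IH1 IH2]].
    rewrite big_nil (_ : mkmnm _ = mnm0); first by rewrite in_fan0 D0.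
    by apply/mnmP => j; rewrite [LHS]mkmnmE [RHS]mnm0E big_nil.
  rewrite (_ : mkmnm _ = mnm_add (mkmnm (fun j => v i * gens i j)%N)
     (mkmnm (fun j => \sum_(i <- s) v i * gens i j)%N)); last first.
    by apply/mnmP => j; rewrite mnmDE !mkmnmE big_cons.
  have [m1 m2] := mul i (v i); rewrite big_cons DD // m2 IH2; split => //.
  exact: in_fanD.
have [s1 s2] := sum (index_enum 'I_l); rewrite DD // s2; split => //.
exact: in_fanD.
Qed.

Lemma ndot_comb v r m : in_fan m0 r ->
  ndot (mnm_add r (comb v)) m = (ndot r m + \sum_i v i * ndot (gens i) m)%N.
Proof.
move=> hr; apply: (proj2 (@additive_comb (fun k => ndot k m) v r (ndot0 m) _ hr)).
by move=> *; exact: ndotDl.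
Qed.

Lemma support_min_comb phi psi v r : phi != 0 -> psi != 0 -> h = phi * psi -> in_fan m0 r ->
  support_min (mnm_add r (comb v)) phi =
  (support_min r phi + \sum_i v i * support_min (gens i) phi)%N.
Proof.
move=> p0 q0 hE hr.
apply: (proj2 (@additive_comb (fun k => support_min k phi) v r (support_min0 p0) _ hr)).
by move=> k k'; exact: (support_minD p0 q0 hE hm0).
Qed.

(** The weight of the monomial [m] at [k] relative to the initial form. *)
Definition excess phi k m : nat := (ndot k m - support_min k phi)%N.

Lemma excess_comb phi psi v r m : phi != 0 -> psi != 0 -> h = phi * psi -> in_fan m0 r ->
  m \in msupp phi ->
  excess phi (mnm_add r (comb v)) m = (excess phi r m + \sum_i v i * excess phi (gens i) m)%N.
Proof.
move=> p0 q0 hE hr hm; rewrite /excess ndot_comb // (support_min_comb _ p0 q0) //.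
rewrite subnDA addnC -addnBA ?support_min_le // addnC.
have -> : (\sum_i v i * (ndot (gens i) m - support_min (gens i) phi) =
  \sum_i v i * ndot (gens i) m - \sum_i v i * support_min (gens i) phi)%N.
  rewrite -sumnB; last by move=> i _; rewrite leq_mul2l support_min_le // orbT.
  by apply: eq_bigr => i _; rewrite mulnBr.
rewrite addnBA //; apply: leq_sum => i _; rewrite leq_mul2l support_min_le ?orbT //.
Qed.

(** A direction along which [v] exceeds [T] either does not contribute to the sum or makes it reach
    [e] before and after the truncation. *)
Lemma minn_trunc_sum (e T x : nat) v (a : 'I_l -> nat) : (e <= T)%N ->
  minn (x + \sum_i truncm T v i * a i) e = minn (x + \sum_i v i * a i) e.
Proof.
move=> eT; have [h1|] := boolP [forall i, (v i * a i == truncm T v i * a i)%N].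
  by congr (minn (_ + _) _); apply: eq_bigr => i _; have /forallP/(_ i)/eqP := h1.
rewrite negb_forall => /existsP[i hi].
have ai : (0 < a i)%N by rewrite lt0n; apply: contra hi => /eqP ->; rewrite !muln0.
have vi : (T < v i)%N.
  by rewrite ltnNge; apply: contra hi => le; rewrite truncmE (minn_idPl le).
have b1 : (e <= \sum_i truncm T v i * a i)%N.
  rewrite (bigD1 i) //= truncmE (minn_idPr (ltnW vi)).
  by apply: leq_trans (leq_addr _ _); apply: leq_trans eT _; rewrite leq_pmulr.
have b2 : (e <= \sum_i v i * a i)%N.
  rewrite (bigD1 i) //=; apply: leq_trans (leq_addr _ _).
  by apply: leq_trans eT _; apply: leq_trans (ltnW vi) _; rewrite leq_pmulr.
by rewrite !(minn_idPr _) // (leq_trans _ (leq_addl _ _)).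
Qed.

Definition bound : nat := (\sum_i \sum_j w i j)%N.
Definition bounded r : bool := [forall j, r j <= bound]%N.

(** Rounding down the coefficients of a real combination of the generators leaves a
    remainder in a bounded part of the cone. *)
Lemma fan_repr k : in_fan m0 k ->
  exists r v, [/\ in_fan m0 r, bounded r & k = mnm_add r (comb v)].
Proof.
move=> hk; have [c [c0 c1 kE]] := fan_gen hm0 hk.
have cg i : c i *: mvec R (w i) = c i *: mvec R (gens i).
  have [->|/c1 hi] := eqVneq (c i) 0; first by rewrite !scale0r.
  by rewrite /gens hi.
pose v : multinom l := mkmnm (fun i => Num.truncn (c i)).
have vE i : (v i)%:R <= c i /\ c i < (v i)%:R + 1 by rewrite mkmnmE; have /andP[] := truncn_itv (c0 i); rewrite -natr1.
pose d i := c i - (v i)%:R.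
have d0 i : 0 <= d i by have [] := vE i; rewrite /d; lra.
have d1 i : d i <= 1 by have [] := vE i; rewrite /d; lra.
have kj j : (k j)%:R = \sum_i d i * (gens i j)%:R + (comb v j)%:R :> R.
  have /rowP/(_ j) := kE; rewrite (eq_bigr _ (fun i _ => cg i)) !mxE summxE => ->.
  rewrite mkmnmE natr_sum -big_split /=; apply: eq_bigr => i _.
  by rewrite !mxE natrM /d; ring.
have le j : (comb v j <= k j)%N.
  rewrite -(ler_nat R) kj lerDr; apply: sumr_ge0 => i _.
  by rewrite mulr_ge0.
pose r : multinom n := mkmnm (fun j => k j - comb v j)%N.
have rE j : (r j)%:R = \sum_i d i * (gens i j)%:R :> R.
  by rewrite mkmnmE natrB // kj addrK.
have kr : k = mnm_add r (comb v) by apply/mnmP => j; rewrite mnmDE mkmnmE subnK.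
have rd m : (ndot r m)%:R = \sum_i d i * (ndot (gens i) m)%:R :> R.
  rewrite /ndot natr_sum (eq_bigr (fun j => \sum_i d i * ((gens i j)%:R * (m j)%:R))).
    rewrite exchange_big /=; apply: eq_bigr => i _; rewrite -mulr_sumr natr_sum.
    by congr (_ * _); apply: eq_bigr => j _; rewrite natrM.
  by move=> j _; rewrite natrM rE mulr_suml; apply: eq_bigr => i _; rewrite mulrA.
exists r, v; split => //.
  rewrite /in_fan eqn_leq support_min_le //=.
  have [m hm ->] := support_min_ex r h0.
  rewrite -(ler_nat R) !rd; apply: ler_sum => i _; apply: ler_wpM2l => //.
  by rewrite ler_nat -(eqP (in_fan_gens i)) support_min_le.
apply/forallP => j; rewrite -(ler_nat R) rE /bound natr_sum; apply: ler_sum => i _.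
apply: (@le_trans _ _ (1 * (gens i j)%:R)); first exact: ler_wpM2r.
rewrite mul1r ler_nat /gens; case: ifP => _; last by rewrite mnm0E.
by rewrite (bigD1 j) //= leq_addr.
Qed.

(** The representation [r + comb v] of a lattice point is not minimal for the monomial order.
    Keeping only minimal representations makes them unique. *)
Definition reducible r v : Prop := exists v' r',
  [/\ (v' < v)%O, in_fan m0 r', bounded r' & mnm_add r' (comb v') = mnm_add r (comb v)].

(** The reducible exponents form an upward closed set because the monomial order is compatible
    with addition; hence Dickson's lemma applies to them. *)
Lemma reducibleD r v u : reducible r v -> reducible r (mnm_add v u).
Proof.
case=> v' [r' [lt hr br e]]; exists (mnm_add v' u), r'; split => //.
  by rewrite ltmc_add2l.
by rewrite !combD !mnm_addA e.
Qed.

(** A generator that was replaced by 0 cannot occur in a minimal representation. *)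
Lemma irreducible_supp r v i : in_fan m0 r -> bounded r -> ~ reducible r v ->
  ~~ in_fan m0 (w i) -> v i = 0%N.
Proof.
move=> hr br irr wi; apply/eqP; apply: contrapT => /negP vi; apply: irr.
pose v' : multinom l := mkmnm (fun j => if j == i then 0%N else v j).
exists v', r; split => //.
  have -> : v = mnm_add v' (mkmnm (fun j => if j == i then v i else 0%N)).
    by apply/mnmP => j; rewrite mnmDE !mkmnmE; case: eqVneq => [->|]; rewrite ?addn0.
  rewrite lt_neqAle lemc_addr andbT; apply/eqP => /mnmP/(_ i).
  by rewrite mnmDE !mkmnmE eqxx add0n => /esym/eqP; apply/negP.
congr (mnm_add _ _); apply/mnmP => j; rewrite !mkmnmE; apply: eq_bigr => i' _.
rewrite mkmnmE; case: eqVneq => [->|//].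
by rewrite /gens (negbTE wi) mnm0E !muln0.
Qed.

End Cone.

(** The first exponent of [h] at which [k] attains its minimum: this makes the cones disjoint. *)
Definition vertex k : multinom n :=
  nth mnm0 (msupp h) (find (fun m => in_fan m k) (msupp h)).

Lemma vertexP k : vertex k \in msupp h /\ in_fan (vertex k) k.
Proof.
have hs : has (fun m => in_fan m k) (msupp h).
  by have [m hm e] := support_min_ex k h0; apply/hasP; exists m => //; exact/eqP.
by rewrite /vertex; split; [rewrite mem_nth // -has_find | exact: (nth_find mnm0 hs)].
Qed.

(** Minimal representations, in the cone of the first vertex available: each lattice point has
    exactly one. *)
Definition good m0 r v : Prop :=
  [/\ in_fan m0 r, bounded r, vertex (mnm_add r (comb m0 v)) = m0 & ~ reducible m0 r v].

Lemma good_inj m0 r v m1 r' v' : good m0 r v -> good m1 r' v' ->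
  mnm_add r (comb m0 v) = mnm_add r' (comb m1 v') -> [/\ m0 = m1, r = r' & v = v'].
Proof.
case=> f0 b0 e0 i0 [f1 b1 e1 i1] e.
have em : m0 = m1 by rewrite -e0 -e1 e.
rewrite -em in f1 e1 i1 e *.
have ev : v = v'.
  case: (ltgtP v v') => // lt.
    by case: i1; exists v, r.
  by case: i0; exists v', r'; split.
split => //; apply/mnmP => j; move/mnmP/(_ j): e; rewrite !mnmDE ev => /eqP.
by rewrite eqn_add2r => /eqP.
Qed.

Lemma good_ex k : exists m0 r v, [/\ m0 \in msupp h, good m0 r v & k = mnm_add r (comb m0 v)].
Proof.
have [hm fk] := vertexP k; exists (vertex k); set m0 := vertex k in hm fk *.
have [r [v [hr br kE]]] := fan_repr hm fk.
move: v r hr br kE; apply: (@ltmwf l) => v IH r hr br kE.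
have [[v' [r' [lt hr' br' e]]]|irr] := pselect (reducible m0 r v).
  by apply: (IH v' lt r' hr' br'); rewrite kE e.
by exists r, v; split => //; split => //; rewrite -kE.
Qed.

(** Whether [k] attains its minimum at [m] is whether an excess vanishes, which is seen on the
    truncation at any positive level. *)
Lemma vertex_trunc m0 r v T : m0 \in msupp h -> in_fan m0 r -> (0 < T)%N ->
  vertex (mnm_add r (comb m0 (truncm T v))) = vertex (mnm_add r (comb m0 v)).
Proof.
move=> hm hr T0; rewrite /vertex; congr nth; apply: eq_in_find => m hm'.
have E x : in_fan m (mnm_add r (comb m0 x)) =
    (minn (excess h r m + \sum_i x i * excess h (gens m0 i) m) 1 == 0)%N.
  rewrite -(@excess_comb m0 hm h 1) ?oner_eq0 ?mulr1 //.
  rewrite /in_fan /excess; have := support_min_le (mnm_add r (comb m0 x)) hm'.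
  by move: (support_min _ _) (ndot _ _) => a b ab; apply/eqP/eqP; lia.
by rewrite !E minn_trunc_sum.
Qed.

Lemma good_trunc m0 r : m0 \in msupp h -> exists T0, forall T v, (T0 <= T)%N -> (0 < T)%N ->
  (good m0 r v <-> good m0 r (truncm T v)).
Proof.
move=> hm; have [T0 hT] := dickson (fun v u => @reducibleD m0 r v u).
exists T0 => T v le T1; split; case=> f0 b0 e0 i0; split => //.
- by rewrite vertex_trunc.
- by move/(hT T v le).
- by move: e0; rewrite vertex_trunc.
- by move=> hr; apply: i0; apply/(hT T v le).
Qed.

End LatticePoints.

(** * Integrals over tori *)

Section TorusIntegral.
Variables (R : realType) (K : localField) (n : nat).
Variable mu : {measure set (borelK K n) -> \bar R}.
Hypothesis hmu : is_haar mu.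
Variable p : K.
Hypothesis hp : uniformizer p.
Local Notation "m <=v x" := (vge (@nu K) m x) (at level 70).
Local Notation C := (complex R).
Local Notation OKn := (@integralK K n : set (borelK K n)).
Local Notation q := ((resq K)%:R : R).
Local Notation qC := ((resq K)%:R : C).

(** The mean of [G] over the representatives of [u + pi ^ e O^n] modulo [pi ^ (e + m)]. *)
Fixpoint iter_mean (m : nat) (G : affineK K n -> C) (e : nat) (u : affineK K n) : C :=
  if m is m'.+1 then
    qC^-1 ^+ n * \sum_(c : {ffun 'I_n -> residue K}) iter_mean m' G e.+1 (u + mkK (digits p e c))
  else G u.

Lemma eq_iter_mean m G G' e u : (forall u, integralK u -> G u = G' u) -> integralK u ->
  iter_mean m G e u = iter_mean m G' e u.
Proof.
move=> h; elim: m e u => [|m IH] e u Ou /=; first exact: h.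
congr (_ * _); apply: eq_bigr => c _; apply: IH; exact: integral_digits.
Qed.

Variables (chi : 'I_2 -> K -> C) (t : 'I_2 -> C) (h : 'I_2 -> nat -> K -> C) (e0 : nat).
Hypotheses (e0_gt0 : (0 < e0)%N) (hchi : forall i, is_character (chi i)).
Hypotheses (ht : forall i, normc (t i) < 1) (hm : forall i, means p (chi i) (t i) e0 (h i)).
Variable fs : 'I_2 -> {mpoly K[n]}.
Hypothesis fs_int : forall i, intcoef (fs i).

Definition integrand (x : borelK K n) : C := \prod_i qchar p (chi i) (t i) (fs i).@[coordK x].

Lemma qchar_ucont i (eps : R) : 0 < eps -> exists N : nat, forall y z, (0 <=v y) -> (0 <=v z) ->
  N%:Z <=v z - y -> normc (qchar p (chi i) (t i) z - qchar p (chi i) (t i) y) <= eps.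
Proof.
move=> eps0; have e2 : 0 < eps / 2 by rewrite divr_gt0.
have [N hN] := means_lim (hm i) e2; exists (N + e0)%N => y z hy hz yz.
have h1 := hN (N + e0)%N z (leq_addr _ _) hz; have h2 := hN (N + e0)%N y (leq_addr _ _) hy.
rewrite -(means_inv (hm i) (leq_addl N e0) hy hz yz) in h2.
apply: le_trans (normc_triangle _ _ (h i (N + e0)%N z)) _.
by rewrite normcB; lra.
Qed.

Lemma qchar_le1 i y : (0 <=v y) -> normc (qchar p (chi i) (t i) y) <= 1.
Proof.
by move=> hy; rewrite -[X in _ <= X](expr0 (normc (t i))); apply: qchar_le => //; exact: ltW.
Qed.

Lemma prod_ord2 (F : 'I_2 -> C) : \prod_i F i = F ord0 * F ord_max.
Proof.
rewrite !big_ord_recl big_ord0 mulr1; congr (_ * F _); exact: val_inj.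
Qed.

Lemma integrand_bounded x : OKn x -> normc (integrand x) <= 1.
Proof.
move=> Ox; rewrite /integrand prod_ord2 normcM -[X in _ <= X]mulr1.
by apply: ler_pM; rewrite ?normc_ge0 //; apply: qchar_le1; apply: intcoef_eval.
Qed.

Lemma integrand_ubounded : ubounded integrand.
Proof. by exists 1 => x; exact: integrand_bounded. Qed.

Lemma integrand_ucont : ucont integrand.
Proof.
move=> eps eps0; have e2 : 0 < eps / 2 by rewrite divr_gt0.
have [N1 h1] := qchar_ucont ord0 e2; have [N2 h2] := qchar_ucont ord_max e2.
exists (N1 + N2)%N => x y Ox Oy xy; rewrite /integrand !prod_ord2.
have cl i N : (N <= N1 + N2)%N -> N%:Z <=v (fs i).@[coordK y] - (fs i).@[coordK x].
  by move=> le; apply: intcoef_close => // j; apply: vgeW (xy j); rewrite lez_nat.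
have ev i z : OKn z -> 0 <=v (fs i).@[coordK z] by move=> Oz; apply: intcoef_eval.
have a1 := h1 _ _ (ev ord0 x Ox) (ev ord0 y Oy) (cl ord0 N1 (leq_addr _ _)).
have a2 := h2 _ _ (ev ord_max x Ox) (ev ord_max y Oy) (cl ord_max N2 (leq_addl _ _)).
have b1 := qchar_le1 ord_max (ev ord_max y Oy); have b2 := qchar_le1 ord0 (ev ord0 x Ox).
move: a1 a2 b1 b2.
move: (qchar p _ _ (fs ord0).@[coordK y]) (qchar p _ _ (fs ord0).@[coordK x]) => A a.
move: (qchar p _ _ (fs ord_max).@[coordK y]) (qchar p _ _ (fs ord_max).@[coordK x]) => B b.
move=> a1 a2 b1 b2; have -> : A * B - a * b = (A - a) * B + a * (B - b) by ring.
apply: le_trans (le_normcD _ _) _; rewrite !normcM.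
have x1 : normc (A - a) * normc B <= eps / 2 * 1 by apply: ler_pM; rewrite ?normc_ge0.
have x2 : normc a * normc (B - b) <= 1 * (eps / 2) by apply: ler_pM; rewrite ?normc_ge0.
lra.
Qed.

Section FixedValuation.
Variable k : multinom n.

Definition phik i := scaled_poly p k (fs i).

Lemma phik_int i : intcoef (phik i).
Proof. exact: scaled_intcoef. Qed.

Definition tk : C := \prod_i t i ^+ support_min k (fs i).

Lemma integrand_scale u : integralK u ->
  integrand (scaleK p k u) = tk * \prod_i qchar p (chi i) (t i) (phik i).@[coordK u].
Proof.
move=> Ou; rewrite /integrand /tk -big_split /=; apply: eq_bigr => i _.
rewrite scaled_eval qchar_unif //; apply: intcoef_eval => //; exact: phik_int.
Qed.

Lemma polydisc_integral m e u : integralK u -> (0 < e)%N -> (e0 <= e + m)%N ->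
  nondeg_at phik (fun i => red (coordK u i)) ->
  Cintegral mu (box (scaleK p k u) (addn_all k e)) integrand =
  vol R K k e * tk * iter_mean m (fun u => \prod_i h i (e + m)%N (phik i).@[coordK u]) e u.
Proof.
elim: m e u => [|m IH] e u Ou e1 em nd /=.
  rewrite addn0 in em *.
  apply: (local_integral hmu hp e0_gt0 hchi ht hm phik_int) => //.
  - exact: integrand_ucont.
  - exact: integrand_ubounded.
  - exact: integrand_scale.
rewrite box_split // (Cint_bigsetU hmu integrand_ucont integrand_ubounded); last first.
- by move=> c c' x _ _; exact: box_split_disj.
- move=> c _; apply: box_sub_integral; apply: scaleK_int => //; exact: integral_digits.
- by move=> c _; exact: box_meas.
rewrite mulrCA mulrA mulr_sumr; apply: eq_bigr => c _.
rewrite IH //; first by rewrite volS addSnnS mulrA -!mulrA.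
- exact: integral_digits.
- by rewrite addSnnS.
- by rewrite red_digits.
Qed.

(** The mean over the unit torus, after the powers of [q] and [t i] have been extracted. *)
Definition torus_coef : C :=
  \sum_(c : {ffun 'I_n -> residue K} | [forall i, c i != 0])
     iter_mean e0.-1 (fun u => \prod_i h i e0 (phik i).@[coordK u]) 1
       (mkK (fun i => lift_residue (c i))).

Lemma torus_integral : (forall u, integralK u -> (forall i, red (coordK u i) != 0) ->
    nondeg_at phik (fun i => red (coordK u i))) ->
  Cintegral mu (torus k) integrand = vol R K k 1 * tk * torus_coef.
Proof.
move=> nd; have Ou (c : {ffun 'I_n -> residue K}) : integralK (mkK (fun i => lift_residue (c i))).
  by move=> i; rewrite coord_mkK; exact: vge_lift.
rewrite (torus_split hp) (Cint_bigsetU hmu integrand_ucont integrand_ubounded); last first.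
- by move=> c c' x _ _; exact: torus_split_disj.
- by move=> c _; apply: box_sub_integral; apply: scaleK_int.
- by move=> c _; exact: box_meas.
rewrite mulr_sumr; apply: eq_bigr => c /forallP hc.
have E : (1 + e0.-1 = e0)%N by rewrite add1n prednK.
rewrite (@polydisc_integral e0.-1) ?E //; apply: nd => // i.
by rewrite coord_mkK red_lift.
Qed.

End FixedValuation.

(** The means at level [e0] only see the scaled polynomials modulo [pi ^ e0], hence only the excesses
    truncated at [e0]: this is what makes the coefficient eventually constant along each ray, also
    for characters of large conductor. *)
Lemma torus_coef_eq k k' :
  (forall i m, m \in msupp (fs i) -> minn (excess (fs i) k m) e0 = minn (excess (fs i) k' m) e0) ->
  torus_coef k = torus_coef k'.
Proof.
move=> he; apply: eq_bigr => c _; apply: eq_iter_mean; last first.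
  by move=> i; rewrite coord_mkK; exact: vge_lift.
move=> u Ou; apply: eq_bigr => i _; apply: (means_inv (hm i)) => //.
- by apply: intcoef_eval => //; exact: phik_int.
- by apply: intcoef_eval => //; exact: phik_int.
rewrite -mevalB mevalE; apply: vge_sum => m _; rewrite mulrC; apply: vgeMl.
  by apply: vge_prod => j _; apply: vge_exp; exact: Ou.
rewrite mcoeffB !mcoeff_scaled.
have [hm'|] := boolP (m \in msupp (fs i)); last first.
  by rewrite -mcoeff_eq0 => /eqP ->; rewrite !mul0r subrr vge0.
rewrite -mulrBr; apply: vgeMl; first exact: fs_int.
have := he i m hm'; rewrite -/(excess _ _ _) -/(excess _ _ _).
move: (excess _ k m) (excess _ k' m) => a b ab.
have [->|ne] := eqVneq a b; first by rewrite subrr vge0.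
by apply: vgeB; apply: vgeW (vge_unifX hp _); rewrite lez_nat; move: ab ne; lia.
Qed.

End TorusIntegral.

(** * Complex powers and polynomials in two variables *)

Section ComplexPowers.
Variables (R : realType) (K : localField) (p : K).
Hypothesis hp : uniformizer p.
Local Notation C := (complex R).
Local Notation q := ((resq K)%:R : R).
Local Notation qpow := (@qpow R K).

Lemma cexpD (z w : C) : cexp (z + w) = cexp z * cexp w.
Proof.
case: z w => [a b] [c d]; rewrite /cexp /= expRD cosD sinD.
by apply/eqP; rewrite eq_complex /=; apply/andP; split; apply/eqP; ring.
Qed.

Lemma cexp0 : cexp (0 : C) = 1.
Proof. by rewrite /cexp /= expR0 cos0 sin0 mul1r. Qed.

Lemma cexpMn (z : C) m : cexp (z *+ m) = cexp z ^+ m.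
Proof. by elim: m => [|m IH]; rewrite ?mulr0n ?cexp0 // mulrS cexpD IH exprS. Qed.

Lemma normc_cexp (z : C) : normc (cexp z) = expR (complex.Re z).
Proof.
rewrite /cexp normcM normc_real ger0_norm ?expR_ge0 //= cos2Dsin2.
by rewrite sqrtr1 mulr1.
Qed.

Lemma lnq_gt0 : 0 < ln q.
Proof. by rewrite ln_gt0 // ltr1n; exact: resq_gt1. Qed.

Lemma qpowE s : qpow s = cexp (- s * ((ln q)%:C)%C).
Proof. by rewrite /qpow /cpow pnatr_eq0 gtn_eqF // (ltn_trans _ (resq_gt1 K)). Qed.

Lemma qpowD s s' : qpow (s + s') = qpow s * qpow s'.
Proof. by rewrite !qpowE opprD mulrDl cexpD. Qed.

Lemma qpow0 : qpow 0 = 1.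
Proof. by rewrite qpowE oppr0 mul0r cexp0. Qed.

Lemma normc_qpow s : normc (qpow s) = expR (- (complex.Re s * ln q)).
Proof. by rewrite qpowE normc_cexp; case: s => a b /=; rewrite mulr0 subr0 mulNr. Qed.

Lemma normc_qpow_lt1 s : 0 < complex.Re s -> normc (qpow s) < 1.
Proof. by move=> s0; rewrite normc_qpow expR_lt1 oppr_lt0 mulr_gt0 // lnq_gt0. Qed.

Lemma cpow_absK (s : C) y : y != 0 -> vge (@nu K) 0 y ->
  cpow (absK R y) s = qpow s ^+ absz (nu y).
Proof.
move=> y0; rewrite vge_nu // => ny; rewrite /absK (negbTE y0).
have q0 : 0 < q by rewrite ltr0n (ltn_trans _ (resq_gt1 K)).
rewrite -[in LHS](gez0_abs ny) -exprnN /cpow invr_eq0 expf_eq0 (gt_eqF q0) andbF.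
rewrite lnV ?posrE ?exprn_gt0 // lnXn // qpowE -cexpMn; congr cexp.
by rewrite rmorphN rmorphMn mulrN mulNr mulrnAr mulNrn.
Qed.

End ComplexPowers.

Section ZetaIntegrand.
Variables (R : realType) (K : localField) (n : nat).
Variable mu : {measure set (borelK K n) -> \bar R}.
Variable p : K.
Hypothesis hp : uniformizer p.
Local Notation C := (complex R).

Definition pair2 (T : Type) (a b : T) (i : 'I_2) : T := if i == 0 then a else b.

Lemma zeta_integralE (chi1 chi2 : K -> C) (f g : {mpoly K[n]}) s1 s2 :
  is_character chi1 -> is_character chi2 -> intcoef f -> intcoef g ->
  zeta_integral mu p chi1 chi2 f g s1 s2 =
  Cintegral mu (@integralK K n)
    (integrand p (pair2 chi1 chi2) (pair2 (qpow K s1) (qpow K s2)) (pair2 f g)).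
Proof.
move=> h1 h2 hf hg; rewrite /zeta_integral /Cintegral.
have E x : integralK x ->
    chi1 (ac p f.@[coordK x]) * chi2 (ac p g.@[coordK x]) *
    cpow (absK R f.@[coordK x]) s1 * cpow (absK R g.@[coordK x]) s2 =
    integrand p (pair2 chi1 chi2) (pair2 (qpow K s1) (qpow K s2)) (pair2 f g) x.
  move=> Ox; rewrite /integrand prod_ord2 /pair2 /= /qchar.
  have fO := intcoef_eval hf Ox; have gO := intcoef_eval hg Ox.
  have [->|f0] := eqVneq f.@[coordK x] 0; first by rewrite /ac !mul0r char0 // !mul0r.
  have [->|g0] := eqVneq g.@[coordK x] 0.
    by rewrite /ac !mul0r (char0 h2) // !mul0r !mulr0 !mul0r.
  by rewrite !cpow_absK // mulrACA -!mulrA; congr (_ * _); rewrite mulrCA.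
by congr Complex; apply: eq_Rintegral => x /set_mem Ox; rewrite E.
Qed.

End ZetaIntegrand.

Section TwoVariablePolynomials.
Variable R : realType.
Local Notation C := (complex R).

(** Restricted to the open bidisc, where the means for the trivial character are defined by a
    convergent geometric series. *)
Definition poly2 (G : C -> C -> C) := exists P : {poly {poly C}},
  forall x y, normc x < 1 -> normc y < 1 -> G x y = P.[x, y].

Lemma poly2_ext G G' : (forall x y, normc x < 1 -> normc y < 1 -> G x y = G' x y) ->
  poly2 G -> poly2 G'.
Proof. by move=> e [P hP]; exists P => x y hx hy; rewrite -e // hP. Qed.

Lemma poly2_x (P : {poly C}) : poly2 (fun x _ => P.[x]).
Proof.
exists (map_poly polyC P) => x y _ _.
by rewrite horner_map /= hornerC.
Qed.

Lemma poly2_y (P : {poly C}) : poly2 (fun _ y => P.[y]).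
Proof. by exists P%:P => x y _ _; rewrite hornerC. Qed.

Lemma poly2_cst c : poly2 (fun _ _ => c).
Proof. by apply: poly2_ext (poly2_y c%:P) => x y _ _; rewrite hornerC. Qed.

Lemma poly2D G H : poly2 G -> poly2 H -> poly2 (fun x y => G x y + H x y).
Proof. by move=> [P hP] [Q hQ]; exists (P + Q) => x y hx hy; rewrite !hornerD hP // hQ. Qed.

Lemma poly2M G H : poly2 G -> poly2 H -> poly2 (fun x y => G x y * H x y).
Proof. by move=> [P hP] [Q hQ]; exists (P * Q) => x y hx hy; rewrite !hornerM hP // hQ. Qed.

Lemma poly2_sum (I : Type) (r : seq I) (P : pred I) (G : I -> C -> C -> C) :
  (forall i, P i -> poly2 (G i)) -> poly2 (fun x y => \sum_(i <- r | P i) G i x y).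
Proof.
move=> h; elim: r => [|i r IH].
  by apply: poly2_ext (poly2_cst 0) => x y _ _; rewrite big_nil.
case E : (P i).
  by apply: poly2_ext (poly2D (h i E) IH) => x y _ _; rewrite big_cons E.
by apply: poly2_ext IH => x y _ _; rewrite big_cons E.
Qed.

Lemma poly2_prod (I : Type) (r : seq I) (P : pred I) (G : I -> C -> C -> C) :
  (forall i, P i -> poly2 (G i)) -> poly2 (fun x y => \prod_(i <- r | P i) G i x y).
Proof.
move=> h; elim: r => [|i r IH].
  by apply: poly2_ext (poly2_cst 1) => x y _ _; rewrite big_nil.
case E : (P i).
  by apply: poly2_ext (poly2M (h i E) IH) => x y _ _; rewrite big_cons E.
by apply: poly2_ext IH => x y _ _; rewrite big_cons E.
Qed.

Lemma poly2_Xn m : poly2 (fun x _ => x ^+ m).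
Proof. by apply: poly2_ext (poly2_x 'X^m) => x y _ _; rewrite hornerXn. Qed.

Lemma poly2_Yn m : poly2 (fun _ y => y ^+ m).
Proof. by apply: poly2_ext (poly2_y 'X^m) => x y _ _; rewrite hornerXn. Qed.

End TwoVariablePolynomials.

(** * Exhaustion of the unit polydisc by tori *)

Section Cover.
Variables (R : realType) (K : localField) (n : nat).
Variable mu : {measure set (borelK K n) -> \bar R}.
Hypothesis hmu : is_haar mu.
Variable p : K.
Hypothesis hp : uniformizer p.
Local Notation "m <=v x" := (vge (@nu K) m x) (at level 70).
Local Notation C := (complex R).
Local Notation OKn := (@integralK K n : set (borelK K n)).
Local Notation q := ((resq K)%:R : R).

Lemma torus_sub (k : multinom n) : torus k `<=` OKn.
Proof.
move=> x hx i; have [x0 e] := hx i.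
by change (0 <=v coordK x i); rewrite vge_nu // e.
Qed.

Lemma torus_meas (k : multinom n) : measurable (torus k : set (borelK K n)).
Proof. by rewrite (torus_split hp); apply: bigsetU_measurable => c _; exact: box_meas. Qed.

Lemma torus_disj (k k' : multinom n) (x : borelK K n) : torus k x -> torus k' x -> k = k'.
Proof.
move=> h1 h2; apply/mnmP => i; have [_ e1] := h1 i; have [_ e2] := h2 i.
by move: e1; rewrite e2 => -[].
Qed.

Definition slab (M i : nat) : set (borelK K n) :=
  box 0 (fun j : 'I_n => if j == i :> nat then M else 0%N).

Lemma outside_tori (U : set (borelK K n)) M :
  (forall k : multinom n, (forall j, k j < M)%N -> torus k `<=` U) ->
  OKn `\` U `<=` \big[setU/set0]_(i < n) slab M i.
Proof.
move=> hU x [Ox nU]; rewrite -bigcup_seq /=; apply: contrapT => hn; apply: nU.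
have hx i : coordK x i != 0 /\ (absz (@nu K (coordK x i)) < M)%N.
  apply: contrapT => hi; apply: hn; exists i; first by rewrite /= mem_index_enum.
  move=> j; rewrite coordK0 subr0; case: eqVneq => [/val_inj ->|_]; last exact: Ox.
  have [->|x0] := eqVneq (coordK x i) 0; first exact: vge0.
  have ge0 : 0 <= @nu K (coordK x i) by have := Ox i; rewrite -vge_nu.
  rewrite vge_nu // leNgt; apply/negP => lt; apply: hi; split => //.
  by rewrite -ltz_nat gez0_abs.
apply: (hU (mkmnm (fun i => absz (@nu K (coordK x i))))).
  by move=> j; rewrite mkmnmE; have [] := hx j.
move=> i; rewrite mkmnmE; have [x0 _] := hx i; split => //.
by have ge0 : 0 <= @nu K (coordK x i); [have := Ox i; rewrite -vge_nu | rewrite gez0_abs].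
Qed.

Lemma mu_slabs (D : set (borelK K n)) M : measurable D ->
  D `<=` \big[setU/set0]_(i < n) slab M i -> fine (mu D) <= n%:R * q^-1 ^+ M.
Proof.
move=> mD sD; have mS i : measurable (slab M i) by exact: box_meas.
have sO : D `<=` OKn.
  move=> x /sD hx; have [i [_ _]] := bigsetU_mem hx; apply: box_sub_integral; exact: integral0.
rewrite -lee_fin fineK; last by apply: mu_fin.
apply: (le_trans (y := mu (\big[setU/set0]_(i < n) slab M i))).
  by apply: le_measure; rewrite ?inE //; exact: bigsetU_measurable.
apply: (le_trans (Boole_inequality mu (fun i _ => mS i))).
rewrite (eq_bigr (fun=> (q^-1 ^+ M)%:E)) => [|i _].
  by rewrite sumEFin lee_fin sumr_const card_ord -[_ *+ n]mulr_natl.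
apply: (etrans (mu_box hmu hp _ _)); congr (_ ^+ _)%:E.
rewrite (bigD1 i) //= eqxx big1 ?addn0 // => j ji.
by case: eqP => // e; move: ji; rewrite -val_eqE /= e eqxx.
Qed.

(** The rest of the unit polydisc lies in [n] polydiscs of volume [q ^- M], one for each coordinate
    whose valuation may be at least [M]. *)
Lemma Cint_cover (F : borelK K n -> C) (J : finType) (P : pred J) (kk : J -> multinom n) M :
  ucont F -> (forall x, OKn x -> normc (F x) <= 1) ->
  {in P &, injective kk} ->
  (forall k : multinom n, (forall j, k j < M)%N -> exists2 j, P j & kk j = k) ->
  normc (Cintegral mu OKn F - \sum_(j | P j) Cintegral mu (torus (kk j)) F) <=
  2 * (n%:R * q^-1 ^+ M).
Proof.
move=> Fc F1 inj cov; have Fb : ubounded F by exists 1.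
pose U := \big[setU/set0]_(j | P j) (torus (kk j) : set (borelK K n)).
have mU : measurable U by apply: bigsetU_measurable => j _; exact: torus_meas.
have sU : U `<=` OKn by move=> x hx; have [j [_ _]] := bigsetU_mem hx; exact: torus_sub.
have mD : measurable (OKn `\` U) by apply: measurableD => //; exact: OKn_meas.
have UE : Cintegral mu U F = \sum_(j | P j) Cintegral mu (torus (kk j)) F.
  rewrite /U (Cint_bigsetU hmu Fc Fb) //.
  - by move=> j _; exact: torus_meas.
  - by move=> j _; exact: torus_sub.
  - by move=> j j' x Pj Pj' h1 h2; apply: inj => //; exact: torus_disj h1 h2.
have OE : OKn = (OKn `\` U) `|` U by rewrite setUC setDUK.
have sD : OKn `\` U `<=` \big[setU/set0]_(i < n) slab M i.
  apply: outside_tori => k /cov[j Pj <-] x hx; rewrite /U -bigcup_seq_cond.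
  by exists j => //=; rewrite mem_index_enum.
have d0 : (OKn `\` U) `&` U = set0 by rewrite setDKI.
rewrite [in Cintegral mu OKn F]OE (Cint_setU hmu Fc Fb mD mU (fun x h => proj1 h) sU d0).
rewrite -UE addrK.
have := @Cint_close _ _ _ _ hmu F Fc Fb (OKn `\` U) 0 1 mD (fun x h => proj1 h).
rewrite mul0r subr0 mulr1 => /(_ _)/le_trans; apply.
  by move=> x [Ox _]; rewrite subr0; exact: F1.
by rewrite ler_pM2l // mu_slabs.
Qed.

End Cover.

(** * Rationality of the zeta integral *)

Section MainIdentity.
Variables (R : realType) (K : localField) (n : nat).
Variable mu : {measure set (borelK K n) -> \bar R}.
Hypothesis hmu : is_haar mu.
Variable p : K.
Hypothesis hp : uniformizer p.
Local Notation "m <=v x" := (vge (@nu K) m x) (at level 70).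
Local Notation C := (complex R).
Local Notation OKn := (@integralK K n : set (borelK K n)).
Local Notation q := ((resq K)%:R : R).
Local Notation qC := ((resq K)%:R : C).
Variables f g : {mpoly K[n]}.
Hypotheses (f_int : intcoef f) (g_int : intcoef g) (f0 : f != 0) (g0 : g != 0).
Hypothesis nd : newton_nondegenerate R f g.
Variables (l : nat) (gamma : 'I_l -> set 'rV[R]_n) (w : 'I_l -> multinom n).
Hypothesis gammaE : range gamma = [set t | is_facet (newton (f * g)) t].
Hypothesis wP : forall i, primitive (w i) /\ perpendicular (mvec R (w i)) (gamma i).
Variables chi1 chi2 : K -> C.
Hypotheses (hchi1 : is_character chi1) (hchi2 : is_character chi2).
Variable e0 : nat.
Hypothesis e0_gt0 : (0 < e0)%N.
Variables h1 h2 : C -> nat -> K -> C.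
Hypothesis hm1 : forall t, normc t < 1 -> means p chi1 t e0 (h1 t).
Hypothesis hm2 : forall t, normc t < 1 -> means p chi2 t e0 (h2 t).
Variables D1 D2 : {poly C}.
Hypothesis hD1 : forall e a, exists P : {poly C}, forall t, normc t < 1 -> D1.[t] * h1 t e a = P.[t].
Hypothesis hD2 : forall e a, exists P : {poly C}, forall t, normc t < 1 -> D2.[t] * h2 t e a = P.[t].

Local Notation fs := (pair2 f g).
Local Notation h := (f * g).
Local Notation chis := (pair2 chi1 chi2).

Lemma hne0 : h != 0. Proof. exact: mulf_neq0. Qed.

Lemma fs_int i : intcoef (fs i).
Proof. by rewrite /pair2; case: ifP. Qed.

Lemma chis_char i : is_character (chis i).
Proof. by rewrite /pair2; case: ifP. Qed.

(** The scaled polynomials reduce to the face polynomials, to which the hypothesis applies; for an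
    empty set of indices there is nothing to prove. *)
Lemma nondeg_torus (k : multinom n) u : integralK u -> (forall i, red (coordK u i) != 0) ->
  nondeg_at (phik p fs k) (fun i => red (coordK u i)).
Proof.
move=> Ou hu; set z := fun i => _.
pose N (rho : 'I_2 -> {mpoly (residue K)[n]}) :=
  let I := [set i | (rho i).@[z] == 0]%SET in
  \rank (\matrix_(r < #|I|, j < n) ((rho (enum_val r))^`M(j)).@[z]) = #|I|.
change (N (fun i => reduction (phik p fs k i))).
have -> : (fun i => reduction (phik p fs k i)) =
    (fun i => reduction (face_poly (mvec R k) (fs i))).
  by apply/funext => i; rewrite (reduction_scaled R hp) //; exact: fs_int.
rewrite /N; set I := [set i | _]%SET.
have [I0|I0] := eqVneq I finset.set0.
  have c0 : #|I| = 0%N by rewrite I0 cards0.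
  set M := \matrix_(_, _) _; have := rank_leq_row M; lia.
have := @nd (mvec R k) I z; rewrite /=; apply => //.
- exact: orthant_mvec.
- by move=> i; rewrite inE.
Qed.

Definition sig (k : multinom n) : nat := (\sum_j k j)%N.

(** The ratio of the contributions of two tori that differ by the normal of the facet [i]. *)
Definition facet_term i (x y : C) : C :=
  qC^-1 ^+ sig (w i) * (x ^+ support_min (w i) f * y ^+ support_min (w i) g).

(** The integral over a torus, as a function of [x = q^-s1] and [y = q^-s2]. *)
Definition torus_term (k : multinom n) (x y : C) : C :=
  qC^-1 ^+ (sig k + n) * (x ^+ support_min k f * y ^+ support_min k g) *
  torus_coef p (pair2 (h1 x) (h2 y)) e0 fs k.

Section FixedArguments.
Variables x y : C.
Hypotheses (x1 : normc x < 1) (y1 : normc y < 1).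
Local Notation F := (integrand p chis (pair2 x y) fs).

Lemma xy_lt1 i : normc (pair2 x y i) < 1.
Proof. by rewrite /pair2; case: ifP. Qed.

Lemma hm_xy i : means p (chis i) (pair2 x y i) e0 (pair2 (h1 x) (h2 y) i).
Proof. by rewrite /pair2; case: ifP => _; [exact: hm1 | exact: hm2]. Qed.

Lemma torus_termE (k : multinom n) : Cintegral mu (torus k) F = torus_term k x y.
Proof.
rewrite (torus_integral hmu hp e0_gt0 chis_char xy_lt1 hm_xy fs_int); last first.
  by move=> u Ou hu; exact: nondeg_torus.
rewrite /torus_term /tk prod_ord2 /pair2 /=; congr (_ * _ * _).
rewrite /vol; congr (_ ^+ _); rewrite /addn_all big_split /= /sig; congr addn.
by rewrite sum1_card card_ord.
Qed.

Lemma expr_trunc (c : C) (a T : nat) (v : multinom l) (s s' : 'I_l -> nat) :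
  (forall i, v i != 0%N -> s i = s' i) ->
  c ^+ (a + \sum_i v i * s i) =
  c ^+ (a + \sum_i truncm T v i * s i) * \prod_i (c ^+ s' i) ^+ (v i - T).
Proof.
move=> ss; rewrite (eq_bigr (fun i => c ^+ (s i * (v i - T)))); last first.
  move=> i _; rewrite -exprM; have [->|/ss ->//] := eqVneq (v i) 0%N.
  by rewrite sub0n !muln0.
rewrite -expr_sum -exprD -addnA -big_split /=; congr (_ ^+ (_ + _)).
by apply: eq_bigr => i _; rewrite truncmE [(s i * _)%N]mulnC -mulnDl; congr muln; lia.
Qed.

(** Shifting [k] by a facet normal multiplies the contribution of the torus by a monomial,
    as soon as the coordinate along that normal is large. *)
Lemma torus_term_trunc (m0 r : multinom n) (v : multinom l) T : m0 \in msupp h -> (e0 <= T)%N ->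
  in_fan h m0 r -> (forall i, v i != 0%N -> in_fan h m0 (w i)) ->
  torus_term (mnm_add r (comb h w m0 v)) x y =
  torus_term (mnm_add r (comb h w m0 (truncm T v))) x y *
  \prod_i facet_term i x y ^+ (v i - T).
Proof.
move=> hm eT hr hv.
have gE i : v i != 0%N -> gens h w m0 i = w i by move=> /hv hi; rewrite /gens hi.
have sigc (u : multinom l) : sig (mnm_add r (comb h w m0 u)) = (sig r + \sum_i u i * sig (gens h w m0 i))%N.
  apply: (proj2 (@additive_comb _ _ _ _ w hne0 _ hm sig u r _ _ hr)).
    by rewrite /sig big1 // => i _; rewrite mnm0E.
  move=> k k' _ _; rewrite /sig -big_split /=; apply: eq_bigr => i _; exact: mnmDE.
have gf : h = g * f by rewrite mulrC.
have ce : torus_coef p (pair2 (h1 x) (h2 y)) e0 fs (mnm_add r (comb h w m0 v)) =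
    torus_coef p (pair2 (h1 x) (h2 y)) e0 fs (mnm_add r (comb h w m0 (truncm T v))).
  apply: (torus_coef_eq hp e0_gt0 hm_xy fs_int) => i m; rewrite /pair2; case: ifP => _ hm'.
    by rewrite !(excess_comb R w hne0 hm _ f0 g0 erefl hr hm') minn_trunc_sum.
  by rewrite !(excess_comb R w hne0 hm _ g0 f0 gf hr hm') minn_trunc_sum.
rewrite /torus_term ce !sigc.
rewrite !(support_min_comb R w hne0 hm _ f0 g0 erefl hr) !(support_min_comb R w hne0 hm _ g0 f0 gf hr).
rewrite ![(sig r + _ + n)%N]addnAC.
rewrite (@expr_trunc qC^-1 (sig r + n) T v _ (fun i => sig (w i))); last by move=> i /gE ->.
rewrite (@expr_trunc x _ T v _ (fun i => support_min (w i) f)); last by move=> i /gE ->.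
rewrite (@expr_trunc y _ T v _ (fun i => support_min (w i) g)); last by move=> i /gE ->.
have -> : \prod_i facet_term i x y ^+ (v i - T) = \prod_i (qC^-1 ^+ sig (w i)) ^+ (v i - T) *
    (\prod_i (x ^+ support_min (w i) f) ^+ (v i - T) *
     \prod_i (y ^+ support_min (w i) g) ^+ (v i - T)).
  by rewrite -!big_split /=; apply: eq_bigr => i _; rewrite /facet_term !exprMn.
set a1 := \prod_i _; set a2 := \prod_i _; set a3 := \prod_i _.
move: (torus_coef _ _ _ _ _) a1 a2 a3 (qC^-1 ^+ _) (x ^+ _) (y ^+ _) => tc a1 a2 a3 b1 b2 b3.
by ring.
Qed.

Lemma facet_term_lt1 i : normc (facet_term i x y) < 1.
Proof.
have [pi _] := wP i; have [j wj] := primitive_neq0 pi.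
have s0 : (0 < sig (w i))%N by rewrite /sig (bigD1 j) //= addn_gt0 lt0n wj.
have q1 : normc (qC^-1) < 1.
  rewrite normcV -(rmorph_nat (real_complex R)) normc_real ger0_norm //.
  by rewrite invf_lt1 ?(q_gt0 R K) // (q_gt1 R K).
rewrite /facet_term !normcM !normcX.
have a1 : normc qC^-1 ^+ sig (w i) < 1 by rewrite exprn_ilt1 ?normc_ge0 // -lt0n.
have a2 : normc x ^+ support_min (w i) f <= 1 by rewrite exprn_ile1 ?normc_ge0 // ltW.
have a3 : normc y ^+ support_min (w i) g <= 1 by rewrite exprn_ile1 ?normc_ge0 // ltW.
have b : normc x ^+ support_min (w i) f * normc y ^+ support_min (w i) g <= 1 * 1.
  by apply: ler_pM; rewrite ?exprn_ge0 ?normc_ge0.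
apply: le_lt_trans a1; rewrite -[X in _ <= X]mulr1; apply: ler_wpM2l.
  by rewrite exprn_ge0 ?normc_ge0.
by rewrite mulr1 in b.
Qed.

End FixedArguments.

(** Vertices are given by their position in the support and remainders by bounded vectors, in order
    to sum over a finite type. *)
Definition Idx : finType := ('I_(size (msupp h)) * {ffun 'I_n -> 'I_(bound w).+1})%type.
Definition vert (j : Idx) : multinom n := nth mnm0 (msupp h) j.1.
Definition rest (j : Idx) : multinom n := mnm_ord j.2.

Lemma vert_supp j : vert j \in msupp h.
Proof. exact: mem_nth. Qed.

Definition point (j : Idx) (v : multinom l) : multinom n := mnm_add (rest j) (comb h w (vert j) v).
Definition goodb (j : Idx) (v : multinom l) : bool := `[< good h w (vert j) (rest j) v >].

Definition contrib j x y v : C := if goodb j v then torus_term (point j v) x y else 0.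

Lemma mnm_ord_inj m N : injective (@mnm_ord m N).
Proof.
move=> a b /mnmP e; apply/ffunP => i; apply: val_inj.
by have := e i; rewrite !mkmnmE.
Qed.

Lemma point_inj N : {in [pred c : Idx * {ffun 'I_l -> 'I_N} | goodb c.1 (mnm_ord c.2)] &,
  injective (fun c => point c.1 (mnm_ord c.2))}.
Proof.
move=> [j v] [j' v'] /asboolP /= g1 /asboolP /= g2 e.
have [em er ev] := good_inj g1 g2 e.
congr (_, _); last exact: mnm_ord_inj ev.
case: j j' er em {g1 g2 e} => [j1 j2] [j1' j2'] er em; congr (_, _); last exact: mnm_ord_inj er.
apply: val_inj; apply/eqP; rewrite -(nth_uniq mnm0 (ltn_ord j1) (ltn_ord j1') (msupp_uniq h)).
exact/eqP.
Qed.

Lemma point_cover M : exists N0, forall N, (N0 <= N)%N -> forall k : multinom n, (forall j, k j < M)%N ->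
  exists2 c : Idx * {ffun 'I_l -> 'I_N}, goodb c.1 (mnm_ord c.2) & point c.1 (mnm_ord c.2) = k.
Proof.
have fg m0 k : m0 \in msupp h -> in_fan h m0 k -> exists c : 'I_l -> R, [/\ forall i, 0 <= c i,
     forall i, c i != 0 -> in_fan h m0 (w i) & mvec R k = \sum_i c i *: mvec R (w i)].
  move=> hm /eqP hk; have [c [c0 c1 c2]] := fan_cone_generated gammaE wP hm hk.
  by exists c; split => // i /c1 e; exact/eqP.
have ex (k : {ffun 'I_n -> 'I_M}) : exists v : multinom l, exists j : Idx,
    goodb j v /\ point j v = mnm_ord k.
  have [m0 [r [v [hm gd kE]]]] := good_ex hne0 fg (mnm_ord k).
  have [_ /forallP br _ _] := gd.
  have im : (index m0 (msupp h) < size (msupp h))%N by rewrite index_mem.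
  pose j : Idx := (Ordinal im, [ffun i => inord (r i)]).
  have vj : vert j = m0 by rewrite /vert /= nth_index.
  have rj : rest j = r by apply/mnmP => i; rewrite mkmnmE ffunE inordK // ltnS.
  by exists v, j; rewrite /goodb /point vj rj; split => //; exact/asboolP.
have [vv hv] := choice ex.
exists (\max_(k : {ffun 'I_n -> 'I_M}) \max_i vv k i).+1 => N hN k hk.
pose k' : {ffun 'I_n -> 'I_M} := [ffun i => Ordinal (hk i)].
have kE : mnm_ord k' = k by apply/mnmP => i; rewrite mkmnmE ffunE.
have [j [gj pj]] := hv k'.
have lt i : (vv k' i < N)%N.
  apply: leq_trans hN; rewrite ltnS.
  apply: leq_trans (@leq_bigmax _ (fun k => \max_i vv k i)%N k').
  exact: (@leq_bigmax _ (fun i => vv k' i)).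
pose f' : {ffun 'I_l -> 'I_N} := [ffun i => Ordinal (lt i)].
have fE : mnm_ord f' = vv k' by apply/mnmP => i; rewrite mkmnmE ffunE.
by exists (j, f'); rewrite /= fE // pj kE.
Qed.

(** A uniform level beyond which the contributions vary geometrically. *)
Lemma level_exists : exists T, forall j x y, normc x < 1 -> normc y < 1 -> forall v,
  contrib j x y v = contrib j x y (truncm T v) * \prod_i facet_term i x y ^+ (v i - T).
Proof.
have [T0 hT0] := choice (fun j => good_trunc R w hne0 (rest j) (vert_supp j)).
pose T := maxn (\max_j T0 j) e0; exists T => j x y x1 y1 v.
have T1 : (0 < T)%N by rewrite leq_max e0_gt0 orbT.
have Tj : (T0 j <= T)%N by rewrite leq_max (@leq_bigmax _ T0 j).
have ge : goodb j v = goodb j (truncm T v).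
  by apply/asboolP/asboolP => /(hT0 j T v Tj T1).
rewrite /contrib -ge; case: ifP => [/asboolP gd|_]; last by rewrite mul0r.
have [fr br _ irr] := gd.
apply: torus_term_trunc => //; first exact: vert_supp.
  by rewrite leq_max leqnn orbT.
move=> i; apply: contra_neqT => wi; exact: irreducible_supp fr br irr wi.
Qed.

Definition finite_part T x y : C :=
  \sum_j \sum_(a : {ffun 'I_l -> 'I_T.+1}) contrib j x y (mnm_ord a) *
     \prod_i corner (fun i => facet_term i x y) a i.

(** The integral is the limit of its parts over finitely many tori; these are summed over the minimal
    representations, as truncated geometric sums in the directions of the facet normals. *)
Lemma integral_identity : exists T, forall x y, normc x < 1 -> normc y < 1 ->
  \prod_i (1 - facet_term i x y) * Cintegral mu OKn (integrand p chis (pair2 x y) fs) =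
  finite_part T x y.
Proof.
have [T hT] := level_exists; exists T => x y x1 y1; apply/eqP; rewrite -subr_eq0; apply/eqP.
set W := \prod_i _; set F := integrand _ _ _ _; set Z := Cintegral _ _ _.
have Fc : ucont F := integrand_ucont (chis_char) (xy_lt1 x1 y1) (hm_xy x1 y1) fs_int.
have F1 u : OKn u -> normc (F u) <= 1 := @integrand_bounded _ _ _ _ _ _ chis_char (xy_lt1 x1 y1) _ fs_int u.
apply: normc_small => eps eps0.
pose c1 := eps / 2 / (#|Idx|%:R + 1).
have c10 : 0 < c1 by rewrite !divr_gt0 // ltr_wpDl.
have [N1 hN1] := choice (fun j => truncated_sum_lim (fun i => facet_term_lt1 x1 y1 i) (hT j x y x1 y1) c10).
pose c2 := eps / 2 / (2 * n%:R * normc W + 1).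
have den0 : 0 < 2 * n%:R * normc W + 1 by rewrite ltr_wpDl // !mulr_ge0 // normc_ge0.
have c20 : 0 < c2 by rewrite !divr_gt0.
have qi : 0 <= q^-1 by rewrite invr_ge0.
have qi1 : q^-1 < 1 by rewrite invf_lt1 ?(q_gt0 R K) // (q_gt1 R K).
have [M hM] := expr_small qi qi1 c20; have {}hM := hM M (leqnn M).
have [N2 hN2] := point_cover M.
pose N := maxn (\max_j N1 j) N2.
pose S := \sum_j \sum_(a : {ffun 'I_l -> 'I_N}) contrib j x y (mnm_ord a).
have A1 : normc (Z - S) <= 2 * (n%:R * q^-1 ^+ M).
  have := @Cint_cover _ _ _ mu hmu p hp F _ _ _ M Fc F1 (@point_inj N) (hN2 N (leq_maxr _ _)).
  congr (normc (_ - _) <= _).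
  rewrite /S pair_big /= [LHS]big_mkcond /=; apply: eq_bigr => c _.
  by rewrite /contrib; case: ifP => // _; exact: torus_termE.
have A2 j : normc (W * (\sum_(a : {ffun 'I_l -> 'I_N}) contrib j x y (mnm_ord a)) -
    \sum_(a : {ffun 'I_l -> 'I_T.+1}) contrib j x y (mnm_ord a) *
     \prod_i corner (fun i => facet_term i x y) a i) <= c1.
  by apply: hN1; rewrite leq_max (@leq_bigmax _ N1 j).
have -> : W * Z - finite_part T x y = W * (Z - S) + (W * S - finite_part T x y).
  by rewrite mulrBr addrA subrK.
apply: le_trans (le_normcD _ _) _; rewrite [eps]splitr; apply: lerD.
  rewrite normcM; apply: (@le_trans _ _ (normc W * (2 * (n%:R * c2)))).
    apply: ler_wpM2l; first exact: normc_ge0.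
    apply: le_trans A1 _; rewrite ler_pM2l //; apply: ler_wpM2l => //.
  have -> : normc W * (2 * (n%:R * c2)) = (2 * n%:R * normc W) * c2 by ring.
  apply: (@le_trans _ _ ((2 * n%:R * normc W + 1) * c2)).
    by rewrite ler_pM2r // lerDl.
  by rewrite /c2 mulrC divfK // gt_eqF.
rewrite /S /finite_part mulr_sumr -sumrB; apply: le_trans (normc_sum _ _ _) _.
apply: (@le_trans _ _ (\sum_(j : Idx) c1)); first by apply: ler_sum => j _; exact: A2.
rewrite sumr_const -[c1 *+ _]mulr_natl.
apply: (@le_trans _ _ ((#|Idx|%:R + 1) * c1)).
  by rewrite ler_pM2r // lerDl.
by rewrite /c1 mulrC divfK // gt_eqF // ltr_wpDl.
Qed.

Lemma poly2_mean m k e u : poly2 (fun x y => D1.[x] * D2.[y] *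
  iter_mean p m (fun u => \prod_i pair2 (h1 x) (h2 y) i e0 (phik p fs k i).@[coordK u]) e u).
Proof.
elim: m e u => [|m IH] e u /=.
  have [P1 hP1] := hD1 e0 (phik p fs k ord0).@[coordK u].
  have [P2 hP2] := hD2 e0 (phik p fs k ord_max).@[coordK u].
  apply: poly2_ext (poly2M (poly2_x P1) (poly2_y P2)) => x y x1 y1.
  by rewrite -hP1 // -hP2 // prod_ord2 /pair2 /= mulrACA.
have := poly2M (poly2_cst (qC^-1 ^+ n)) (poly2_sum (index_enum _) (P := xpredT)
   (fun (c : {ffun 'I_n -> residue K}) _ => IH e.+1 (u + mkK (digits p e c)))).
by apply: poly2_ext => x y _ _; rewrite -mulr_sumr mulrCA.
Qed.

Lemma poly2_torus_term k : poly2 (fun x y => D1.[x] * D2.[y] * torus_term k x y).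
Proof.
have := poly2M (poly2M (poly2_cst (qC^-1 ^+ (sig k + n)))
    (poly2M (poly2_Xn R (support_min k f)) (poly2_Yn R (support_min k g))))
  (poly2_sum (index_enum _) (P := [pred c : {ffun 'I_n -> residue K} | [forall i, c i != 0]])
   (fun c _ => poly2_mean e0.-1 k 1 (mkK (fun i => lift_residue (c i))))).
by apply: poly2_ext => x y _ _; rewrite /torus_term /torus_coef -mulr_sumr mulrCA !mulrA.
Qed.

Lemma poly2_facet_term i : poly2 (facet_term i).
Proof.
exact: (poly2M (poly2_cst (qC^-1 ^+ sig (w i)))
   (poly2M (poly2_Xn R (support_min (w i) f)) (poly2_Yn R (support_min (w i) g)))).
Qed.

Lemma poly2_finite_part T : poly2 (fun x y => D1.[x] * D2.[y] * finite_part T x y).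
Proof.
have H j (a : {ffun 'I_l -> 'I_T.+1}) : poly2 (fun x y => D1.[x] * D2.[y] *
    (contrib j x y (mnm_ord a) * \prod_i corner (fun i => facet_term i x y) a i)).
  have B : poly2 (fun x y => \prod_i corner (fun i => facet_term i x y) a i).
    apply: poly2_prod => i _; rewrite /corner; case: (a i < T)%N; last exact: poly2_cst.
    have := poly2D (poly2_cst 1) (poly2M (poly2_cst (-1)) (poly2_facet_term i)).
    by apply: poly2_ext => x y _ _; rewrite mulN1r.
  rewrite /contrib; case: (goodb j (mnm_ord a)); last first.
    by apply: poly2_ext (poly2_cst 0) => x y _ _; rewrite mul0r mulr0.
  by apply: poly2_ext (poly2M (poly2_torus_term (point j (mnm_ord a))) B) => x y _ _; rewrite [RHS]mulrA.
have := poly2_sum (index_enum _) (P := xpredT) (fun j _ => poly2_sum (index_enum _) (P := xpredT)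
  (fun a _ => H j a)).
apply: poly2_ext => x y _ _; rewrite /finite_part mulr_sumr; apply: eq_bigr => j _.
by rewrite mulr_sumr.
Qed.

Definition denominator : {poly {poly C}} :=
  map_poly polyC D1 * D2%:P *
  \prod_i (1 - (qC^-1 ^+ sig (w i))%:P%:P * ('X^(support_min (w i) f) * ('X^(support_min (w i) g))%:P)).

Lemma denominatorE x y :
  denominator.[x, y] = D1.[x] * D2.[y] * \prod_i (1 - facet_term i x y).
Proof.
rewrite /denominator !hornerM horner_map /= !hornerC !horner_prod.
congr (_ * _); apply: eq_bigr => i _.
by rewrite !(hornerE, hornerXn); congr (1 - _); exact: (esym (mulrA _ _ _)).
Qed.

(** The finite part becomes polynomial after multiplication by the unit factors [D1] and [D2], which
    clear the denominators of the means. *)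
Theorem zeta_rational : exists P : {poly {poly C}}, forall s1 s2 : C,
  0 < complex.Re s1 -> 0 < complex.Re s2 ->
  zeta_integral mu p chi1 chi2 f g s1 s2 * denominator.[qpow K s1, qpow K s2] =
  P.[qpow K s1, qpow K s2].
Proof.
have [T hT] := integral_identity; have [P hP] := poly2_finite_part T.
exists P => s1 s2 r1 r2.
have x1 := normc_qpow_lt1 K r1; have y1 := normc_qpow_lt1 K r2.
rewrite -hP // -hT // denominatorE zeta_integralE //.
by rewrite mulrC !mulrA.
Qed.

End MainIdentity.

(** * Uniqueness of the continuation and location of poles *)

Section ZerosOfDenominator.
Variables (R : realType) (K : localField).
Local Notation C := (complex R).
Local Notation q := ((resq K)%:R : R).
Local Notation qpow := (@qpow R K).

(** After reduction modulo [2 pi], the half angle formula turns the equation into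
    [sin (y / 2) = 0] on an interval where the sine is positive except at 0. *)
Lemma cos_eq1 (t : R) : cos t = 1 -> exists k : int, t = 2 * pi * k%:~R.
Proof.
move=> ct; have pi0 : 0 < pi *+ 2 :> R by rewrite mulrn_wgt0 // pi_gt0.
pose k := Num.floor (t / (pi *+ 2)); pose y := t - (pi *+ 2) * k%:~R.
have cy : cos y = 1.
  rewrite -ct /y; case: (k) => m.
    rewrite -[in RHS](subrK ((pi *+ 2) * m%:~R) t) mulr_natr.
    by rewrite (periodicn (@cosD2pi R)).
  by rewrite NegzE mulrNz mulrN opprK mulr_natr (periodicn (@cosD2pi R)).
have y0 : 0 <= y by rewrite /y subr_ge0 mulrC -ler_pdivlMr // floor_le_tmp.
have y1 : y < pi *+ 2.
  rewrite /y ltrBlDr -[X in X + _]mulr1 -mulrDr mulrC -ltr_pdivrMr // addrC.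
  by have := floorD1_gt (t / (pi *+ 2)); rewrite intrD.
have s2 : sin (y / 2) = 0.
  have yE : y = (y / 2) *+ 2 by rewrite -mulr_natr divfK.
  move: cy; rewrite {1}yE cos_mulr2n cos2sin2 -mulr_natr => h.
  have : sin (y / 2) ^+ 2 = 0 by move: h; move: (_ ^+ 2) => z h; lra.
  by move=> /eqP; rewrite expf_eq0 /= => /eqP.
have yz : y = 0.
  apply/eqP; case: (ltgtP y 0) y0 => // yp _.
  have : 0 < sin (y / 2).
    apply: sin_gt0_pi; rewrite divr_gt0 //= ltr_pdivrMr //.
    by rewrite mulr_natr.
  by rewrite s2 ltxx.
exists k; move/eqP: yz; rewrite subr_eq0 => /eqP ->.
by rewrite [2 * pi]mulr_natl.
Qed.

Lemma qpow_eq1 s : qpow s = 1 ->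
  complex.Re s = 0 /\ exists k : int, complex.Im s = 2 * pi * k%:~R / ln q.
Proof.
have lq := lnq_gt0 R K; case: s => a b e.
have a0 : a = 0.
  have : expR (- (a * ln q)) = expR 0 by rewrite expR0; have := congr1 (@normc R) e; rewrite normc_qpow normc1.
  by move=> /expR_inj/eqP; rewrite oppr_eq0 mulf_eq0 (gt_eqF lq) orbF => /eqP.
split=> //=; move: e; rewrite a0 qpowE /cexp /=.
have -> : (- 0 * 0 + - b * ln q)%R = - (b * ln q) by ring.
have -> : (- 0 * ln q - - b * 0)%R = 0 by ring.
rewrite expR0 mul1r => -[c1 _].
move: c1; rewrite cosN => /cos_eq1[k hk]; exists k.
by rewrite -hk mulfK // gt_eqF.
Qed.

Lemma qpowMn s m : qpow (s *+ m) = qpow s ^+ m.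
Proof. by elim: m => [|m IH]; rewrite ?mulr0n ?qpow0 // mulrS qpowD IH exprS. Qed.

Lemma qpow1 : qpow 1 = ((resq K)%:R)^-1.
Proof.
transitivity ((q^-1)%:C)%C; last by rewrite fmorphV rmorph_nat.
rewrite qpowE mulN1r -rmorphN /cexp /= cos0 sin0 expRN lnK; last by rewrite posrE; exact: q_gt0.
by apply/eqP; rewrite eq_complex /= !mulr1 !mulr0 ?mul0r ?subr0 ?addr0 ?add0r !eqxx.
Qed.

End ZerosOfDenominator.

Section Uniqueness.
Variables (R : realType) (K : localField).
Local Notation C := (complex R).
Local Notation qpow := (@qpow R K).

Lemma poly_eq0_infinite (D : idomainType) (P : {poly D}) (r : nat -> D) :
  injective r -> (forall i, P.[r i] = 0) -> P = 0.
Proof.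
move=> ri h; apply/eqP; apply: contraT => P0.
have := max_poly_roots P0 (rs := map r (iota 0 (size P))).
rewrite size_map size_iota ltnn => -> //.
  by apply/allP => x /mapP[i _ ->]; apply/eqP.
by rewrite map_inj_uniq // iota_uniq.
Qed.

Lemma poly2_eq0 (D : idomainType) (P : {poly {poly D}}) (r : nat -> D) :
  injective r -> (forall i j, P.[r i, r j] = 0) -> P = 0.
Proof.
move=> ri h; apply: (@poly_eq0_infinite _ _ (fun i => (r i)%:P)).
  by move=> i j /polyC_inj /ri.
by move=> i; apply: (poly_eq0_infinite ri) => j; exact: h.
Qed.

Lemma qpow_nat_inj : injective (fun i : nat => qpow (((i.+1)%:R : R)%:C)%C).
Proof.
move=> i j /(congr1 (@normc R)); rewrite !normc_qpow /= => /expR_inj/oppr_inj/mulIf.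
by rewrite gt_eqF ?(lnq_gt0 R K) // => /(_ isT)/eqP; rewrite eqr_nat => /eqP[].
Qed.

Variables (n : nat) (mu : {measure set (borelK K n) -> \bar R}) (p : K).

(** Two continuations agree as fractions, since the zeta integral determines them on an
    infinite grid. *)
Lemma continuation_unique chi1 chi2 f g (P Q P' Q' : {poly {poly C}}) :
  zeta_continuation mu p chi1 chi2 f g P Q -> zeta_continuation mu p chi1 chi2 f g P' Q' ->
  P * Q' = P' * Q.
Proof.
move=> [_ h] [_ h']; apply/eqP; rewrite -subr_eq0; apply/eqP.
apply: (poly2_eq0 qpow_nat_inj) => i j.
rewrite !(hornerD, hornerN, hornerM).
have s0 m : 0 < complex.Re (((m.+1)%:R : R)%:C)%C by rewrite /= ltr0n.
rewrite -(h _ _ (s0 i) (s0 j)) -(h' _ _ (s0 i) (s0 j)).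
by apply/eqP; rewrite subr_eq0; apply/eqP; ring.
Qed.

End Uniqueness.

Section Poles.
Variables (R : realType) (K : localField).
Local Notation C := (complex R).
Local Notation qpow := (@qpow R K).

Definition continuousC (G : C -> C) (s : C) := forall e : R, 0 < e ->
  exists2 d : R, 0 < d & forall t, normc (t - s) < d -> normc (G t - G s) < e.

Lemma cont_small (G : R -> R) : {for 0, continuous G} -> forall e, 0 < e ->
  exists2 d : R, 0 < d & forall a, `|a| < d -> `|G a - G 0| < e.
Proof.
move=> Gc e e0; have /cvgrPdist_lt/(_ e e0) := Gc.
case=> d d0 hd; exists d => // a ad; rewrite distrC; apply: hd => /=.
by rewrite sub0r normrN.
Qed.

(** By the functional equation it suffices to compare [qpow (t - s)] with 1. *)
Lemma qpow_continuous s : continuousC qpow s.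
Proof.
move=> e e0; have lq := lnq_gt0 R K.
have N0 : 0 < normc (qpow s) by rewrite normc_qpow expR_gt0.
pose e1 := Num.min 1 (e / normc (qpow s) / 8).
have e10 : 0 < e1 by rewrite lt_min ltr01 !divr_gt0.
have [d1 d10 c1] := cont_small (@continuous_expR R 0) e10.
have [d2 d20 c2] := cont_small (@continuous_cos R 0) e10.
have [d3 d30 c3] := cont_small (@continuous_sin R 0) e10.
pose d := Num.min d1 (Num.min d2 d3) / ln ((resq K)%:R : R).
exists d; first by rewrite divr_gt0 // !lt_min d10 d20.
move=> t td.
have -> : qpow t - qpow s = qpow s * (qpow (t - s) - 1).
  by rewrite mulrBr mulr1 -qpowD [s + _]addrC subrK.
rewrite normcM mulrC -ltr_pdivlMr //.
case: (t - s) td => a b td; rewrite qpowE /cexp /=.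
have -> : (- a * ln (resq K)%:R - - b * 0 = - (a * ln (resq K)%:R))%R by ring.
have -> : (- a * 0 + - b * ln (resq K)%:R = - (b * ln (resq K)%:R))%R by ring.
set A := - (a * _); set B := - (b * _).
have dle x : `|x| <= normc (a +i* b)%C -> `|- (x * ln (resq K)%:R)| < Num.min d1 (Num.min d2 d3).
  move=> h; rewrite normrN normrM (ger0_norm (ltW lq)) -ltr_pdivlMr //.
  exact: le_lt_trans h td.
have := dle _ (normcRe (a +i* b)%C); rewrite /= -/A !lt_min => /and3P[A1 _ _].
have := dle _ (normcIm (a +i* b)%C); rewrite /= -/B !lt_min => /and3P[_ B2 B3].
have := c1 _ A1; have := c2 _ B2; have := c3 _ B3; rewrite sin0 cos0 expR0 subr0.
move=> s3 s2 s1.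
have e11 : e1 <= 1 by rewrite ge_min lexx.
have e12 : e1 <= e / normc (qpow s) / 8 by rewrite ge_min lexx orbT.
have r2 : expR A <= 2.
  by have := le_trans (ler_norm _) (ltW s1); lra.
have rp : 0 <= expR A := expR_ge0 A.
have E1 : `|expR A * cos B - 1| <= 3 * e1.
  have -> : expR A * cos B - 1 = expR A * (cos B - 1) + (expR A - 1) by ring.
  apply: le_trans (ler_normD _ _) _; rewrite normrM (ger0_norm rp).
  have : expR A * `|cos B - 1| <= 2 * e1 by apply: ler_pM => //; exact: ltW.
  by move=> h; lra.
have E2 : `|expR A * sin B| <= 2 * e1.
  by rewrite normrM (ger0_norm rp); apply: ler_pM => //; exact: ltW.
have E3 := normc_leD (((expR A)%:C * (cos B +i* sin B) - 1)%C); rewrite /= in E3.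
apply: le_lt_trans E3 _; rewrite !mul0r !subr0 addr0.
by lra.
Qed.

Lemma continuousC_cst c s : continuousC (fun=> c) s.
Proof. by move=> e e0; exists 1 => // t _; rewrite subrr normc0. Qed.

Lemma continuousCD G H s : continuousC G s -> continuousC H s ->
  continuousC (fun t => G t + H t) s.
Proof.
move=> hG hH e e0; have e2 : 0 < e / 2 by rewrite divr_gt0.
have [d1 d10 h1] := hG _ e2; have [d2 d20 h2] := hH _ e2.
exists (Num.min d1 d2); first by rewrite lt_min d10.
move=> t; rewrite lt_min => /andP[/h1 a1 /h2 a2].
rewrite opprD addrACA; apply: le_lt_trans (le_normcD _ _) _; lra.
Qed.

Lemma continuousCM G H s : continuousC G s -> continuousC H s ->
  continuousC (fun t => G t * H t) s.
Proof.
move=> hG hH e e0; pose M := normc (G s) + normc (H s) + 1.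
have M0 : 0 < M by rewrite ltr_wpDl // addr_ge0 // normc_ge0.
have e2 : 0 < e / (2 * M) by rewrite divr_gt0 // mulr_gt0.
have e3 : 0 < Num.min 1 (e / (2 * M)) by rewrite lt_min ltr01.
have [d1 d10 h1] := hG _ e3; have [d2 d20 h2] := hH _ e3.
exists (Num.min d1 d2); first by rewrite lt_min d10.
move=> t; rewrite lt_min => /andP[/h1 a1 /h2 a2].
move: a1 a2; rewrite !lt_min => /andP[a1 a1'] /andP[a2 a2'].
have -> : G t * H t - G s * H s = (G t - G s) * H t + G s * (H t - H s) by ring.
have H1 : normc (H t) <= M.
  have := le_normcD (H t - H s) (H s); rewrite subrK => /le_trans; apply.
  by have := normc_ge0 (G s); rewrite /M; lra.
have G1 : normc (G s) <= M by have := normc_ge0 (H s); rewrite /M; lra.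
apply: le_lt_trans (le_normcD _ _) _; rewrite !normcM.
have x1 : normc (G t - G s) * normc (H t) <= normc (G t - G s) * M.
  by apply: ler_wpM2l => //; exact: normc_ge0.
have x2 : normc (G s) * normc (H t - H s) <= M * normc (H t - H s).
  by apply: ler_wpM2r => //; exact: normc_ge0.
move: a1' a2'; rewrite !ltr_pdivlMr ?mulr_gt0 // => a1' a2'.
by lra.
Qed.

Lemma horner_continuous (P : {poly C}) y s : continuousC y s -> continuousC (fun t => P.[y t]) s.
Proof.
move=> hy; elim/poly_ind: P => [|P c IH].
  have -> : (fun t => (0 : {poly C}).[y t]) = fun=> 0 by apply/funext => t; rewrite horner0.
  exact: continuousC_cst.
have -> : (fun t => (P * 'X + c%:P).[y t]) = fun t => P.[y t] * y t + c.
  by apply/funext => t; rewrite hornerMXaddC.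
apply: continuousCD; last exact: continuousC_cst.
exact: continuousCM.
Qed.

Lemma horner2_continuous (P : {poly {poly C}}) x y s : continuousC x s -> continuousC y s ->
  continuousC (fun t => P.[x t, y t]) s.
Proof.
move=> hx hy; elim/poly_ind: P => [|P c IH].
  have -> : (fun t => (0 : {poly {poly C}}).[x t, y t]) = fun=> 0.
    by apply/funext => t; rewrite !horner0.
  exact: continuousC_cst.
have -> : (fun t => (P * 'X + c%:P).[x t, y t]) = fun t => P.[x t, y t] * x t + c.[y t].
  by apply/funext => t; rewrite hornerMXaddC hornerD hornerM hornerC.
apply: continuousCD; last exact: horner_continuous.
exact: continuousCM.
Qed.

Definition on_line (P : {poly {poly C}}) (s : C) : C := P.[qpow s, qpow (- s)].

Lemma on_line_continuous P s : continuousC (on_line P) s.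
Proof.
apply: horner2_continuous; first exact: qpow_continuous.
move=> e e0; have [d d0 h] := @qpow_continuous (- s) e e0; exists d => // t td.
by apply: h; rewrite -opprD normcN.
Qed.

(** A point where the reduced denominator does not vanish is not a pole: the function is
    bounded near it, whatever its values at the zeros of the given denominator. *)
Lemma pole_denominator (Z : C -> C) (P Q P0 Q0 : {poly {poly C}}) (s : C) :
  P * Q0 = P0 * Q -> (forall t, Z t = on_line P t / on_line Q t) -> is_pole Z s ->
  on_line Q0 s = 0.
Proof.
move=> E hZ pole; apply/eqP; apply: contrapT => /negP Q0s.
pose c := normc (on_line Q0 s) / 2.
have c0 : 0 < c.
  rewrite divr_gt0 // lt_def normc_ge0 andbT.
  by apply: contra_neq Q0s => /eq0_normc.
have [d1 d10 h1] := @on_line_continuous Q0 s c c0.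
have [d2 d20 h2] := @on_line_continuous P0 s 1 ltr01.
pose B : R := (normc (on_line P0 s) + 1) / c.
have B0 : 0 <= B by rewrite divr_ge0 ?(ltW c0) // addr_ge0 // normc_ge0.
have bnd t : normc (t - s) < Num.min d1 d2 -> normc (Z t) <= B.
  rewrite lt_min => /andP[/h1 a1 /h2 a2].
  have q1 : c <= normc (on_line Q0 t).
    have := le_normcD (on_line Q0 s - on_line Q0 t) (on_line Q0 t).
    by rewrite subrK normcB; move: a1; rewrite /c; lra.
  have q2 : on_line Q0 t != 0 by apply: contraTneq q1 => ->; rewrite normc0 -ltNge.
  have p1 : normc (on_line P0 t) <= normc (on_line P0 s) + 1.
    have := le_normcD (on_line P0 t - on_line P0 s) (on_line P0 s).
    by rewrite subrK; lra.
  rewrite hZ; have [->|Qt] := eqVneq (on_line Q t) 0; first by rewrite invr0 mulr0 normc0.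
  have -> : on_line P t / on_line Q t = on_line P0 t / on_line Q0 t.
    apply/eqP; rewrite eqr_div //; apply/eqP.
    have := congr1 (fun P => on_line P t) E.
    by rewrite /on_line !hornerM.
  rewrite normcM normcV; apply: ler_pM; rewrite ?normc_ge0 ?invr_ge0 ?normc_ge0 //.
  by rewrite lef_pV2 ?posrE // (lt_le_trans c0).
have [|e e0 he] := pole [set x : C^o | (B%:C)%C < x].
  by exists (B%:C)%C; split => //; apply/complex_realP; exists B.
have [er eE] : exists er : R, e = (er%:C)%C.
  by apply/complex_realP; rewrite ger0_real // ltW.
rewrite /= eE ltcR in e0.
pose r := Num.min er (Num.min d1 d2) / 2.
have r0 : 0 < r by rewrite divr_gt0 // !lt_min e0 d10 d20.
have rlt : r < Num.min er (Num.min d1 d2) by move: r0; rewrite /r; lra.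
pose t : C := s + (r%:C)%C.
have ts : normc (t - s) = r by rewrite /t addrC addKr normc_real ger0_norm // ltW.
have : (B%:C)%C < `|Z t|.
  apply: (he t).
    rewrite /ball_ /= -normrN opprB [X in X < _](_ : _ = ((normc (t - s))%:C)%C) // ts eE ltcR.
    by move: rlt; rewrite lt_min => /andP[].
  apply/eqP => e1; move: ts; rewrite e1 subrr normc0 => /eqP.
  by rewrite eq_sym gt_eqF.
rewrite [X in _ < X](_ : _ = ((normc (Z t))%:C)%C) // ltcR ltNge bnd // ts.
by move: rlt; rewrite lt_min => /andP[].
Qed.

End Poles.

(** * Zeros of the denominator on the line (s, -s) *)

Section Candidates.
Variables (R : realType) (K : localField).
Local Notation C := (complex R).
Local Notation q := ((resq K)%:R : R).
Local Notation qC := ((resq K)%:R : C).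
Local Notation qpow := (@qpow R K).

Lemma qpow_natr m : qpow ((m%:R : R)%:C)%C = qC^-1 ^+ m.
Proof. by rewrite -qpow1 -qpowMn (rmorph_nat (real_complex R)). Qed.

Lemma unit_zero s : 1 - qC^-1 * qpow s = 0 -> exists k : int, s = unit_candidate K (- 1) k.
Proof.
move/eqP; rewrite subr_eq0 -qpow1 -qpowD => /eqP/esym/qpow_eq1[].
case: s => a b /= /eqP; rewrite addrC addr_eq0 => /eqP -> [k]; rewrite add0r => ->.
by exists k.
Qed.

Lemma unit_zeroN s : 1 - qC^-1 * qpow (- s) = 0 -> exists k : int, s = unit_candidate K 1 k.
Proof.
move=> /unit_zero[k e]; exists (- k); rewrite -[s]opprK e /unit_candidate.
apply/eqP; rewrite eq_complex /= opprK eqxx /= mulrNz mulrN mulNr.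
by [].
Qed.

Variables (n : nat) (f g : {mpoly K[n]}).
Hypotheses (f0 : f != 0) (g0 : g != 0).

Lemma ddiffE (w : multinom n) : ddiff R f g w = (support_min w g)%:R - (support_min w f)%:R.
Proof. by rewrite /ddiff !dmin_newton. Qed.

Lemma sigmavE (w : multinom n) : sigmav (mvec R w) = (sig w)%:R.
Proof. by rewrite /sigmav /sig natr_sum; apply: eq_bigr => i _; rewrite mxE. Qed.

Lemma facet_term_line (l : nat) (w : 'I_l -> multinom n) i s :
  facet_term f g w i (qpow s) (qpow (- s)) =
  qpow (((sig (w i))%:R)%:C - (ddiff R f g (w i))%:C * s)%C.
Proof.
rewrite /facet_term -qpow_natr -!qpowMn -!qpowD; congr (qpow (_ + _)).
rewrite ddiffE rmorphB !rmorph_nat mulrBl opprB mulr_natl mulr_natl.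
by rewrite mulNrn.
Qed.

(** On the line the factor is [1 - q^-(sigma - ddiff s)].  If [ddiff] vanishes it is a nonzero constant;
    otherwise its zeros form one arithmetic progression. *)
Lemma facet_zero (l : nat) (w : 'I_l -> multinom n) i s : (0 < sig (w i))%N ->
  1 - facet_term f g w i (qpow s) (qpow (- s)) = 0 ->
  exists k : int, ddiff R f g (w i) <> 0 /\ s = facet_candidate R f g (w i) k.
Proof.
move=> s0 /eqP; rewrite subr_eq0 facet_term_line => /eqP/esym/qpow_eq1[].
case: s => a b /= ha' [k hb'].
have ha : (sig (w i))%:R = ddiff R f g (w i) * a.
  by apply/eqP; rewrite -subr_eq0 -ha'; apply/eqP; ring.
have hb : - (ddiff R f g (w i) * b) = 2 * pi * k%:~R / ln q by rewrite -hb'; ring.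
have lq := lnq_gt0 R K.
have dn : ddiff R f g (w i) != 0.
  apply: contraTneq s0 => d0; move: ha; rewrite d0 mul0r => /eqP.
  by rewrite pnatr_eq0 -leqNgt => /eqP ->.
exists (- k); split; first exact/eqP.
rewrite /facet_candidate sigmavE; apply/eqP; rewrite eq_complex /=; apply/andP; split; apply/eqP.
  by rewrite ha mulrC mulKf.
have -> : b = - (2 * pi * k%:~R / ln q) / ddiff R f g (w i) by rewrite -hb opprK mulrC mulKf.
rewrite mulrNz; have lq0 : ln q != 0 by rewrite gt_eqF.
by move: (ln q) (ddiff R f g (w i)) (k%:~R) lq0 dn => L D k' L0 D0; field; rewrite D0 L0.
Qed.

(** None of the candidates is 0, so the denominator does not vanish identically on the line. *)
Lemma facet_term_line0 (l : nat) (w : 'I_l -> multinom n) i : (0 < sig (w i))%N ->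
  1 - facet_term f g w i (qpow 0) (qpow (- 0)) != 0.
Proof.
move=> s0; apply/eqP => /(facet_zero s0)[k [dn]].
rewrite /facet_candidate sigmavE => /(congr1 (@complex.Re R)) /= /esym/eqP.
by rewrite mulf_eq0 invr_eq0 pnatr_eq0 (gtn_eqF s0) /= => /eqP.
Qed.

Lemma unit_line0 : 1 - qC^-1 * qpow 0 != 0.
Proof.
apply/eqP => /unit_zero[k] /(congr1 (@complex.Re R)) /= /eqP.
by rewrite eq_sym oppr_eq0 oner_eq0.
Qed.

End Candidates.

Section CharacterInverse.
Variables (R : realType) (K : localField).
Local Notation C := (complex R).

Lemma char_inv_character (chi : K -> C) : is_character chi -> is_character (char_inv chi).
Proof.
move=> hc; split.
- by move=> x hx; rewrite /char_inv (char_out hc hx) invr0.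
- by move=> x y hx hy; rewrite /char_inv (charM hc hx hy) invfM.
- by move=> x hx; rewrite /char_inv normfV (char_circle hc hx) invr1.
move=> x hx e e0; have [m hm] := char_cont hc hx e0; exists m => y hy xy.
have x0 := char_unit_neq0 hc hx; have y0 := char_unit_neq0 hc hy.
rewrite /char_inv (_ : _ - _ = - (chi y - chi x) / (chi x * chi y)); last by field; rewrite x0 y0.
by rewrite normrM normrN normfV normrM !(char_circle hc) // mulr1 invr1 mulr1 hm.
Qed.

Lemma char_inv_triv : char_inv (chi_triv R K) = chi_triv R K.
Proof. by apply/funext => x; rewrite /char_inv /chi_triv; case: (x \in _); rewrite ?invr1 ?invr0. Qed.

Lemma char_inv_inj (chi : K -> C) : char_inv chi = chi_triv R K -> chi = chi_triv R K.
Proof.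
by move=> e; apply/funext => x; rewrite -char_inv_triv -e /char_inv invrK.
Qed.

End CharacterInverse.

(** * Continuation and poles of the zeta function *)

Lemma intcoef_mpolyOver (K : localField) n (f : {mpoly K[n]}) :
  f \is a mpolyOver n (integers K) -> intcoef f.
Proof.
rewrite qualifE /= => /allP h m; have [hm|] := boolP (m \in msupp f).
  by apply: (h f@_m); exact: map_f.
by rewrite -mcoeff_eq0 => /eqP ->; exact: vge0.
Qed.

Section ZetaFraction.
Variables (R : realType) (K : localField) (n : nat).
Variable mu : {measure set (borelK K n) -> \bar R}.
Hypothesis hmu : is_haar mu.
Variable p : K.
Hypothesis hp : uniformizer p.
Local Notation C := (complex R).
Local Notation qC := ((resq K)%:R : C).
Variables f g : {mpoly K[n]}.
Hypotheses (f_int : intcoef f) (g_int : intcoef g) (f0 : f != 0) (g0 : g != 0).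
Hypothesis nd : newton_nondegenerate R f g.
Variables (l : nat) (gamma : 'I_l -> set 'rV[R]_n) (w : 'I_l -> multinom n).
Hypothesis gammaE : range gamma = [set t | is_facet (newton (f * g)) t].
Hypothesis wP : forall i, primitive (w i) /\ perpendicular (mvec R (w i)) (gamma i).

(** Only the trivial character has a nonzero mean over the units, which is where the poles with real
    part 1 or -1 come from. *)
Definition unit_factor (chi : K -> C) : {poly C} :=
  if `[< chi = chi_triv R K >] then 1 - qC^-1 *: 'X else 1.

Definition zeta_denominator (chi : K -> C) : {poly {poly C}} :=
  denominator f g w (unit_factor chi) (unit_factor chi).

Lemma zeta_fraction (chi : K -> C) : is_character chi ->
  exists P, forall s1 s2 : C, 0 < complex.Re s1 -> 0 < complex.Re s2 ->
    zeta_integral mu p chi (char_inv chi) f g s1 s2 *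
    (zeta_denominator chi).[qpow K s1, qpow K s2] = P.[qpow K s1, qpow K s2].
Proof.
move=> hc; have hc' := char_inv_character hc.
rewrite /zeta_denominator /unit_factor; case: asboolP => [ct|nt].
  rewrite ct char_inv_triv; have [h [hm hD]] := means_trivial R hp.
  apply: (zeta_rational hmu hp f_int g_int f0 g0 nd gammaE wP (chi_triv_character R K)
    (chi_triv_character R K) (ltn0Sn 0) hm hm) => e a.
    by have [P hP] := hD e a; exists P => t t1; rewrite -hP // !hornerE.
  by have [P hP] := hD e a; exists P => t t1; rewrite -hP // !hornerE.
have nt' : char_inv chi <> chi_triv R K by move=> /char_inv_inj.
have [e1 [h1 [e10 hm1 hD1]]] := means_nontrivial hp hc nt.
have [e2 [h2 [e20 hm2 hD2]]] := means_nontrivial hp hc' nt'.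
have e0 : (0 < maxn e1 e2)%N by rewrite leq_max e10.
have hm1' t (t1 : normc t < 1) := means_weaken (leq_maxl e1 e2) (hm1 t t1).
have hm2' t (t1 : normc t < 1) := means_weaken (leq_maxr e1 e2) (hm2 t t1).
apply: (zeta_rational hmu hp f_int g_int f0 g0 nd gammaE wP hc hc' e0 hm1' hm2').
- by move=> e a; have [P hP] := hD1 e a; exists P => t _; rewrite hornerE mul1r.
- by move=> e a; have [P hP] := hD2 e a; exists P => t _; rewrite hornerE mul1r.
Qed.

Lemma sig_gt0 i : (0 < sig (w i))%N.
Proof.
have [pi _] := wP i; have [j wj] := primitive_neq0 pi.
by rewrite /sig (bigD1 j) //= addn_gt0 lt0n wj.
Qed.

Lemma zeta_denominator_line0 chi : on_line K (zeta_denominator chi) 0 != 0.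
Proof.
rewrite /on_line denominatorE /unit_factor !mulf_neq0 //.
- by case: asboolP => _; rewrite !hornerE ?oner_eq0 // unit_line0.
- by case: asboolP => _; rewrite !hornerE ?oner_eq0 // oppr0 unit_line0.
- by apply/prodf_neq0 => i _; apply: facet_term_line0 => //; exact: sig_gt0.
Qed.

Lemma zeta_denominator_neq0 chi : zeta_denominator chi != 0.
Proof.
by apply: contraNneq (zeta_denominator_line0 chi) => ->; rewrite /on_line !horner0.
Qed.

Lemma zeta_pole chi (Z : C -> C) s : is_character chi ->
  is_zeta mu p chi f g Z -> is_pole Z s -> on_line K (zeta_denominator chi) s = 0.
Proof.
move=> hc [P [Q [cont _ hZ]]]; have [P0 hP0] := zeta_fraction hc.
apply: pole_denominator hZ; apply: continuation_unique cont _.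
by split; [exact: zeta_denominator_neq0 | exact: hP0].
Qed.

Lemma zeta_exists chi : is_character chi -> exists Z, is_zeta mu p chi f g Z.
Proof.
move=> hc; have [P hP] := zeta_fraction hc.
exists (fun s => on_line K P s / on_line K (zeta_denominator chi) s).
exists P, (zeta_denominator chi); split => //.
  by split; [exact: zeta_denominator_neq0 | exact: hP].
by exists 0; exact: zeta_denominator_line0.
Qed.

End ZetaFraction.

Unset Implicit Arguments.

Theorem proposition4p1 (R : realType) (K : localField) (varpi : K) (n : nat)
    (mu : {measure set (borelK K n) -> \bar R})
    (f g : {mpoly K[n]})
    (l : nat) (gamma : 'I_l -> set 'rV[R]_n) (w : 'I_l -> multinom n) :
  uniformizer varpi ->
  (2 <= n)%N ->
  is_haar mu ->
  f \is a mpolyOver n (integers K) -> f \isn't a mpolyOver n (maxideal K) ->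
  g \is a mpolyOver n (integers K) -> g \isn't a mpolyOver n (maxideal K) ->
  nonconstant f -> nonconstant g ->
  mcoprime f g ->
  f.@[fun=> 0] = 0 -> g.@[fun=> 0] = 0 ->
  newton_nondegenerate R f g ->
  range gamma = [set t | is_facet (newton (f * g)) t] ->
  (forall i, primitive (w i) /\ perpendicular (mvec R (w i)) (gamma i)) ->
  [/\ forall chi : K -> R[i], is_character chi ->
        exists Z, is_zeta mu varpi chi f g Z,
      forall (Z : R[i] -> R[i]) (s : R[i]),
        is_zeta mu varpi (chi_triv R K) f g Z -> is_pole Z s ->
        [\/ exists k : int, s = unit_candidate K 1 k,
            exists k : int, s = unit_candidate K (- 1) k |
            exists (k : int) (i : 'I_l),
              ddiff R f g (w i) <> 0 /\ s = facet_candidate R f g (w i) k] &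
      forall (chi : K -> R[i]) (Z : R[i] -> R[i]) (s : R[i]),
        is_character chi -> chi <> chi_triv R K ->
        is_zeta mu varpi chi f g Z -> is_pole Z s ->
        exists (k : int) (i : 'I_l),
          ddiff R f g (w i) <> 0 /\ s = facet_candidate R f g (w i) k].
Proof.
move=> hp _ hmu fO fM gO gM _ _ _ _ _ nd gammaE wP.
have f_int := intcoef_mpolyOver fO; have g_int := intcoef_mpolyOver gO.
have nz (h : {mpoly K[n]}) : h \isn't a mpolyOver n (maxideal K) -> h != 0.
  by apply: contraNneq => ->; exact: mpolyOver0.
have f0 := nz f fM; have g0 := nz g gM.
split.
- by move=> chi hc; exact: (zeta_exists hmu hp f_int g_int f0 g0 nd gammaE wP).
- move=> Z s hZ /(zeta_pole hmu hp f_int g_int f0 g0 nd gammaE wP (chi_triv_character R K) hZ).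
  rewrite /on_line denominatorE /unit_factor; case: asboolP => // _ /eqP.
  rewrite !mulf_eq0 => /orP[/orP[]|].
  + by rewrite !hornerE => /eqP /unit_zero; constructor 2.
  + by rewrite !hornerE => /eqP /unit_zeroN; constructor 1.
  + move=> /prodf_eq0[i _ /eqP h]; constructor 3.
    have [k hk] := facet_zero f0 g0 (sig_gt0 wP i) h.
    by exists k, i.
move=> chi Z s hc nt hZ /(zeta_pole hmu hp f_int g_int f0 g0 nd gammaE wP hc hZ).
rewrite /on_line denominatorE /unit_factor; case: asboolP => // _ /eqP.
rewrite !hornerE ?mul1r => /prodf_eq0[i _ /eqP h].
have [k hk] := facet_zero f0 g0 (sig_gt0 wP i) h.
by exists k, i.
Qed.
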